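(* Let $\phi:\mathbb{D}\to\mathbb{D}$ and $\psi:\mathbb{D}\to\mathbb{C}$ be analytic, and let $C_{\psi,\phi}$ be the corresponding weighted composition operator on the Dirichlet space $\mathcal{D}$. Assume that $\phi',\phi'',\psi,\psi'$ are all bounded functions on $\mathbb{D}$. If the following conditions hold: (i) $\phi$ is univalent on $\mathbb{D}$; (ii) $\lim_{|z|\to1^-}\frac{|\psi(z)|(1-|z|^2)}{1-|\phi(z)|^2}=0$; (iii) $\lim_{|z|\to1^-}|\psi''(z)|(1-|z|^2)=0$; then the operator $C_{\psi,\phi}$ is compact on $\mathcal{D}$.
   Context: $\mathbb{D}=\{z\in\mathbb{C}:|z|<1\}$ and $dA$ is area Lebesgue measure on $\mathbb{D}$. The Dirichlet space $\mathcal{D}$ is the Hilbert space of all holomorphic $f$ on $\mathbb{D}$ with $\int_{\mathbb{D}}|f'|^2dA<\infty$, with norm $\|f\|_{\mathcal{D}}^2=\|f\|_{H^2(\mathbb{D})}^2+\frac1\pi\int_{\mathbb{D}}|f'(z)|^2dA(z)$, where $H^2(\mathbb{D})$ is the Hardy space; equivalently, for $f(z)=\sum_{n\ge0}\hat f_nz^n$ and $g(z)=\sum_{n\ge0}\hat g_nz^n$, the inner product is $\langle f,g\rangle_{\mathcal{D}}=\sum_{n\ge0}(n+1)\hat f_n\overline{\hat g_n}$. The weighted composition operator is $(C_{\psi,\phi}f)(z)=\psi(z)f(\phi(z))$ for $f\in\mathcal{D}$, $z\in\mathbb{D}$. Univalent means injective (and holomorphic). *)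

(* Defs.v *)
From mathcomp Require Import all_boot all_order all_algebra.
From mathcomp Require Import all_classical all_reals all_analysis.
From mathcomp Require Import complex.

Set Implicit Arguments.
Unset Strict Implicit.
Unset Printing Implicit Defensive.

Import Order.TTheory GRing.Theory Num.Theory.
Import numFieldNormedType.Exports.

Local Open Scope ring_scope.
Local Open Scope complex_scope.
Local Open Scope classical_set_scope.

(* The alias [^o] carries the norm topology of the numeric field R[i], so that
   [derivable f z 1] is complex differentiability at z and [f^`()] is the
   complex derivative. *)
Notation CC R := (R[i]^o).

(* A function on the disc is represented by a total function CC R -> CC R whose
   values off the disc are irrelevant: every notion below only depends on the
   restriction to the disc, which is open. *)
Definition disc (R : realType) : set (CC R) := [set z | `|z| < 1].

Definition holomorphic_disc (R : realType) (f : CC R -> CC R) : Prop :=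
  forall z, disc z -> derivable f z 1.

(* The filter |z| -> 1^-. *)
Definition disc_boundary (R : realType) : set_system (CC R) :=
  [set A | \forall r \near (1 : R)^'-, forall z : CC R, `|z| = r%:C -> A z].

Global Instance disc_boundary_filter (R : realType) :
  Filter (@disc_boundary R).
Proof.
rewrite /disc_boundary; split=> /=.
- by near=> r.
- by move=> P Q; apply: (@filterS2 _ (1 : R)^'- _) => r p q z h; split;
    [exact: p | exact: q].
- by move=> P Q PQ; apply: (@filterS _ (1 : R)^'- _) => r p z h; apply: PQ;
    exact: p.
Unshelve. all: by end_near. Qed.

Definition disc_integral (R : realType) (F : CC R -> \bar R) : \bar R :=
  (\int[(@lebesgue_measure R) \x (@lebesgue_measure R)]_(p in
     [set p : R * R | disc (p.1 +i* p.2 : CC R)])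
       F (p.1 +i* p.2))%E.

Definition dirichlet_integral (R : realType) (f : CC R -> CC R) : \bar R :=
  disc_integral (fun z => ((ComplexField.Normc.normc (f^`()%classic z)) ^+ 2)%:E).

(* ||f||_{H^2}^2 = sup_{0 <= r < 1} (2 pi)^-1 \int_0^{2 pi} |f(r e^{it})|^2 dt *)
Definition hardy_norm2 (R : realType) (f : CC R -> CC R) : \bar R :=
  ereal_sup [set (((2 * pi)^-1)%:E *
    \int[@lebesgue_measure R]_(t in `[0%R, (2 * pi)%R])
      ((ComplexField.Normc.normc (f ((r * cos t) +i* (r * sin t)))) ^+ 2)%:E)%E
    | r in `[0, 1[ ].

Definition dirichlet_norm (R : realType) (f : CC R -> CC R) : \bar R :=
  sqrte (hardy_norm2 f + (pi^-1)%:E * dirichlet_integral f)%E.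

Definition dirichlet_space (R : realType) : set (CC R -> CC R) :=
  [set f | holomorphic_disc f /\ (dirichlet_integral f < +oo)%E].

Definition weighted_comp (R : realType) (psi phi : CC R -> CC R)
    (f : CC R -> CC R) : CC R -> CC R :=
  fun z => psi z * f (phi z).

(* T is a compact operator on the Dirichlet space: a linear self-map taking
   every norm-bounded sequence to one with a norm-convergent subsequence. *)
Definition dirichlet_compact (R : realType)
    (T : (CC R -> CC R) -> (CC R -> CC R)) : Prop :=
  [/\ set_fun (@dirichlet_space R) (@dirichlet_space R) T,
      forall (a : R[i]) (f g : CC R -> CC R),
        dirichlet_space f -> dirichlet_space g ->
        forall z, disc z -> T (a *: f + g) z = a * T f z + T g z
    & forall f_ : nat -> CC R -> CC R,
        (forall n, dirichlet_space (f_ n)) ->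
        (exists M : R, forall n, (dirichlet_norm (f_ n) <= M%:E)%E) ->
        exists2 e : nat -> nat, {homo e : m n / (m < n)%N} &
        exists2 g : CC R -> CC R, dirichlet_space g &
          dirichlet_norm (T (f_ (e n)) - g) @[n --> \oo] --> 0%E].

(* Main.v *)
(* Write [T f = psi * (f o phi)], so that [(T f)' = psi' * (f o phi) + psi * phi' * (f' o phi)].
   As [phi] is injective, a change of variables bounds the Dirichlet energy of [f o phi] by that
   of [f]. The boundedness of [phi'] and [psi'] turns (ii) into: [psi z] is small as soon as
   [|phi z|] is close to 1. Hence, for every eps, the squared norm of [T f] is at most eps times
   the energy of [f] plus a constant times the supremum of [|f|^2 + |f'|^2] over a compact disc:
   the term [psi'] is absorbed by a Poincare-type inequality, the Hardy norm by a bound of the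
   circular means by the energy. A bounded sequence has, by Montel, a subsequence converging
   with its derivatives uniformly on compact discs, and that estimate makes its image converge.

   The complex analysis (Goursat, Cauchy estimates, sub-mean values of [|h|^2]) is done on
   rectangles and squares, where contour and area integrals split into one-dimensional
   Lebesgue integrals. *)

Require Import Defs.
From HB Require Import structures.
From mathcomp Require Import all_boot all_order all_algebra.
From mathcomp Require Import all_classical all_reals all_analysis.
From mathcomp Require Import measurable_realfun complex ring lra.
Import Order.TTheory GRing.Theory Num.Theory.
Import numFieldNormedType.Exports.

Set Implicit Arguments.
Unset Strict Implicit.
Unset Printing Implicit Defensive.

Local Open Scope ring_scope.
Local Open Scope complex_scope.
Local Open Scope classical_set_scope.

(** Only inequalities up to a constant are needed, because the factor in front of the energy in the
    final estimate can be made as small as desired. So Cauchy's formula may keep an unevaluated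
    constant [cc s], the sub-mean inequality may be stated on squares with a factor 8, and the
    change of variables may lose a factor [cvC R] in place of an exact Jacobian formula. The
    obstacle is that [psi'] is merely bounded: nothing makes it small near the boundary, and
    convergence of [f] on compact discs says nothing about [f o phi] there. What helps is that
    [f o phi] is integrated without a derivative: its mass near the circle is paid for by its values
    further inside and by an arbitrarily small multiple of its energy. The term with [(f o phi)']
    has no such gain and relies on the decay of [psi]. Moduli are kept real-valued ([nm]), and a
    holomorphic function is handled together with its derivative as a pair, so that estimates become
    real arithmetic. *)

Notation nm := ComplexField.Normc.normc.
Notation Re := complex.Re.
Notation Im := complex.Im.

(** * Complex differentiability *)

Section complex_modulus.
Variable R : realType.
Implicit Types (x y : R) (z w : R[i]).

Lemma nmE z : `|z| = (nm z)%:C. Proof. by []. Qed.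

Lemma nm_ge0 z : 0 <= nm z.
Proof. by case: z => a b; exact: sqrtr_ge0. Qed.

Lemma nmM z w : nm (z * w) = nm z * nm w.
Proof. exact: ComplexField.Normc.normcM. Qed.

Lemma nmN z : nm (- z) = nm z.
Proof. by apply: complexI; rewrite -!nmE normrN. Qed.

Lemma nm0 : nm (0 : R[i]) = 0.
Proof. by apply: complexI; rewrite -nmE normr0. Qed.

Lemma nm1 : nm (1 : R[i]) = 1.
Proof. by apply: complexI; rewrite -nmE normr1. Qed.

Lemma nmi : nm ('i : R[i]) = 1.
Proof. by rewrite /= expr0n expr1n add0r sqrtr1. Qed.

Lemma nmV z : nm z^-1 = (nm z)^-1.
Proof. exact: ComplexField.Normc.normcV. Qed.

Lemma nmX z n : nm (z ^+ n) = nm z ^+ n.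
Proof. by elim: n => [|n IH]; rewrite ?expr0 ?nm1// !exprS nmM IH. Qed.

Lemma nmR x : nm x%:C = `|x|.
Proof. by rewrite /= expr0n addr0 sqrtr_sqr. Qed.

Lemma nm_eq0 z : (nm z == 0) = (z == 0).
Proof. by apply/eqP/eqP => [/ComplexField.Normc.eq0_normc//|->]; rewrite nm0. Qed.

Lemma nm_gt0 z : (0 < nm z) = (z != 0).
Proof. by rewrite lt0r nm_ge0 andbT nm_eq0. Qed.

Lemma nmD z w : nm (z + w) <= nm z + nm w.
Proof. by have := ler_normD z w; rewrite !nmE -rmorphD lecR. Qed.

Lemma nmB z w : nm (z - w) <= nm z + nm w.
Proof. by rewrite -(nmN w) nmD. Qed.

Lemma nm_distC z w : nm (z - w) = nm (w - z).
Proof. by rewrite -nmN opprB. Qed.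

Lemma nm_tri u z w : nm (z - w) <= nm (z - u) + nm (u - w).
Proof. by rewrite (le_trans _ (nmD _ _))// addrA subrK. Qed.

Lemma nm_subl z w : nm z - nm w <= nm (z - w).
Proof. by rewrite lerBlDr (le_trans _ (nmD _ _))// subrK. Qed.

Lemma sqr_nm z : nm z ^+ 2 = Re z ^+ 2 + Im z ^+ 2.
Proof. by case: z => a b /=; rewrite sqr_sqrtr// addr_ge0// sqr_ge0. Qed.

Lemma Re_le_nm z : `|Re z| <= nm z.
Proof.
by rewrite -(@ler_pXn2r _ 2)// ?nnegrE ?nm_ge0// sqr_nm real_normK ?num_real// lerDl sqr_ge0.
Qed.

Lemma Im_le_nm z : `|Im z| <= nm z.
Proof.
by rewrite -(@ler_pXn2r _ 2)// ?nnegrE ?nm_ge0// sqr_nm real_normK ?num_real// lerDr sqr_ge0.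
Qed.

Lemma complex_split z : z = (Re z)%:C + 'i * (Im z)%:C.
Proof. exact: complexE. Qed.

Lemma nm_le_ReIm z : nm z <= `|Re z| + `|Im z|.
Proof.
by rewrite {1}[z]complex_split (le_trans (nmD _ _))// nmM nmi mul1r !nmR.
Qed.

Lemma discE (z : CC R) : disc z <-> nm z < 1.
Proof. by rewrite /disc /= nmE -[1 : R[i]]/(1%:C) ltcR. Qed.

(** A unimodular factor that rotates [z] onto the nonnegative real axis. It turns a bound on the
    modulus of an integral or of an increment into a bound on a real part; the value 1 at 0 keeps it
    unimodular everywhere. *)
Definition unitdir z := if z == 0 then 1 else (nm z)%:C / z.

Lemma nm_unitdir z : nm (unitdir z) = 1.
Proof.
rewrite /unitdir; have [_|z0] := eqVneq z 0; first by rewrite nm1.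
by rewrite nmM nmV nmR ger0_norm ?nm_ge0// divff// nm_eq0.
Qed.

Lemma unitdirM z : unitdir z * z = (nm z)%:C.
Proof.
rewrite /unitdir; have [->|z0] := eqVneq z 0; first by rewrite nm0 mulr0.
by rewrite divfK.
Qed.

End complex_modulus.

Section hasder.
Variable R : realType.
Implicit Types (f g : R[i] -> R[i]) (z d e : R[i]).

(* Complex differentiability in terms of the real-valued modulus; [hasderP] and
   [derivable_hasder] relate it to [derivable f z 1]. *)
Definition hasder f z d := forall eps : R, 0 < eps -> exists2 del : R, 0 < del &
  forall w, nm (w - z) < del -> nm (f w - f z - d * (w - z)) <= eps * nm (w - z).

Definition contat f z := forall eps : R, 0 < eps -> exists2 del : R, 0 < del &
  forall w, nm (w - z) < del -> nm (f w - f z) < eps.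

Lemma diffq_nm d w h (e : R) : h != 0 ->
  nm (w - d * h) <= e * nm h -> nm (d - h^-1 * w) <= e.
Proof.
move=> h0 H; rewrite -(@ler_pM2r _ (nm h)) ?nm_gt0// -nmM (le_trans _ H)//.
rewrite nm_distC mulrBl mulrAC mulVf// mul1r//.
Qed.

Lemma diffq_nm_inv d w h (e : R) : h != 0 ->
  nm (d - h^-1 * w) <= e -> nm (w - d * h) <= e * nm h.
Proof.
move=> h0 H; rewrite -(@ler_pM2r _ (nm h)) ?nm_gt0// -nmM in H.
by rewrite (le_trans _ H)// nm_distC mulrBl mulrAC mulVf// mul1r.
Qed.

Lemma hasderP (f : CC R -> CC R) (z d : CC R) :
  hasder f z d -> derivable f z 1 /\ (f^`()%classic z) = d.
Proof.
move=> H.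
have C : (fun h : CC R => h^-1 *: (f (h *: 1 + z) - f z)) @ (0 : CC R)^' --> (d : CC R).
  apply/cvgrPdist_le => e e0.
  have eR : (Re e)%:C = e by apply: RRe_real; exact: gtr0_real.
  have e0' : 0 < Re e by rewrite -ltcR eR.
  have [del del0 Hd] := H _ e0'.
  near=> h.
  have h0 : h != 0 by near: h; exact: nbhs_dnbhs_neq.
  have hd : nm h < del.
    rewrite -ltcR -[(nm h)%:C]/(`|h|).
    near: h; apply: dnbhs0_lt; by rewrite ltcR.
  have := Hd (h + z); rewrite addrK => /(_ hd) {}Hd.
  rewrite -eR nmE lecR.
  rewrite [h *: 1]mulr1; exact: diffq_nm.
split; first by apply/cvg_ex; exists d.
by rewrite derive1E /derive; exact: (cvg_lim _ C).
Unshelve. all: by end_near.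
Qed.

Lemma derivable_hasder (f : CC R -> CC R) (z : CC R) :
  derivable f z 1 -> hasder f z (f^`()%classic z).
Proof.
move=> D e e0; rewrite derive1E.
have /cvgrPdist_le := D => /(_ e%:C).
rewrite -[lim _]/('D_1 f z) ltcR => /(_ e0).
rewrite /dnbhs /within /= => /nbhs_ballP[r /= r0 Hr].
have rR : (Re r)%:C = r by apply: RRe_real; exact: gtr0_real.
exists (Re r); first by rewrite -ltcR rR.
move=> w wr; have [->|wz] := eqVneq w z; first by rewrite !subrr mulr0 subrr nm0 mulr0.
have wz0 : w - z != 0 by rewrite subr_eq0.
have := Hr (w - z); rewrite /ball /= sub0r normrN nmE -rR ltcR => /(_ wr wz0).
rewrite nmE lecR => h.
have E : ((w - z : CC R) *: (1 : CC R) + z)%R = w by rewrite [_ *: _]mulr1 subrK.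
rewrite E in h; exact: diffq_nm_inv wz0 h.
Qed.

Lemma hasder_contat f z d : hasder f z d -> contat f z.
Proof.
move=> H eps eps0; have [del del0 Hd] := H 1 ltr01.
have K0 : 0 < 1 + nm d by rewrite ltr_pwDl// nm_ge0.
exists (Num.min del (eps / (1 + nm d))); first by rewrite lt_min del0 divr_gt0.
move=> w; rewrite lt_min => /andP[wd we].
have h := Hd _ wd; rewrite mul1r in h.
rewrite ltr_pdivlMr// in we; apply: le_lt_trans we.
rewrite mulrDr mulr1 (le_trans _ (lerD h (lexx _)))//.
rewrite (mulrC _ (nm d)) -nmM (le_trans _ (nmD _ _))// subrK//.
Qed.

End hasder.

Section hasder_calculus.
Variable R : realType.
Implicit Types (f g : R[i] -> R[i]) (z d e : R[i]).

Lemma contatP (f : CC R -> CC R) (z : CC R) : contat f z <-> f @ z --> f z.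
Proof.
split=> [H|H].
  apply/(@cvgrPdist_lt R[i] (CC R) (CC R) (nbhs z) _ f (f z)) => e'.
  have [e ->] : exists e : R[i], e' = e by exists e'.
  move=> {e'} e0.
  have eR : (Re e)%:C = e by apply: RRe_real; exact: gtr0_real.
  have [del del0 Hd] := H (Re e) ltac:(by rewrite -ltcR eR).
  apply/nbhs_ballP; exists del%:C; first by rewrite /= ltcR.
  move=> w; rewrite /ball /= nmE ltcR => zw.
  by rewrite -eR nmE ltcR nm_distC; apply: Hd; rewrite nm_distC.
move=> e e0; move/(@cvgrPdist_lt R[i] (CC R) (CC R) (nbhs z) _ f (f z)): H => /(_ e%:C); rewrite ltcR => /(_ e0).
move=> /nbhs_ballP[r /= r0 Hr].
have rR : (Re r)%:C = r by apply: RRe_real; exact: gtr0_real.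
exists (Re r); first by rewrite -ltcR rR.
move=> w; rewrite (nm_distC w z) => zw; have := Hr w.
rewrite /ball /= nmE -rR ltcR => /(_ zw).
by rewrite nmE ltcR nm_distC.
Qed.

Lemma contat_cst c z : contat (fun=> c) z.
Proof. by move=> e e0; exists 1 => // w _; rewrite subrr nm0. Qed.

Lemma contat_id z : contat id z.
Proof. by move=> e e0; exists e. Qed.

Lemma contatD f g z : contat f z -> contat g z -> contat (fun w => f w + g w) z.
Proof.
move=> /(@contatP f) hf /(@contatP g) hg; apply/(@contatP (fun w => f w + g w)).
exact: cvgD hf hg.
Qed.

Lemma contatM f g z : contat f z -> contat g z -> contat (fun w => f w * g w) z.
Proof.
move=> /(@contatP f) hf /(@contatP g) hg; apply/(@contatP (fun w => f w * g w)).
exact: (@cvgM R[i] _ (nbhs (z : CC R)) _ f g _ _ hf hg).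
Qed.

Lemma contatN f z : contat f z -> contat (fun w => - f w) z.
Proof.
by move=> hf e e0; have [r r0 h] := hf e e0; exists r => // w /h; rewrite -opprD nmN.
Qed.

Lemma contatV f z : f z != 0 -> contat f z -> contat (fun w => (f w)^-1) z.
Proof.
move=> fz /(@contatP f) hf; apply/(@contatP (fun w => (f w)^-1)).
exact: (@cvgV R[i] _ (nbhs (z : CC R)) _ f _ fz hf).
Qed.

Lemma contat_comp f g z : contat f z -> contat g (f z) -> contat (g \o f) z.
Proof.
move=> hf hg e e0; have [r r0 h] := hg e e0; have [s s0 k] := hf r r0.
by exists s => // w /k /h.
Qed.

(** Carathéodory's slope: differentiability at [z] with derivative [d] becomes continuity of this
    function at [z]. The rules for sums, products and composition then follow from those for
    continuous functions. *)
Definition quot f z d w := if w == z then d else (f w - f z) / (w - z).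

Lemma quotE f z d w : f w = f z + quot f z d w * (w - z).
Proof.
rewrite /quot; have [->|wz] := eqVneq w z; first by rewrite subrr mulr0 addr0.
by rewrite divfK ?subr_eq0// addrC subrK.
Qed.

Lemma quotzz f z d : quot f z d z = d. Proof. by rewrite /quot eqxx. Qed.

Lemma hasder_quot f z d : hasder f z d <-> contat (quot f z d) z.
Proof.
split=> [H e e0|H e e0].
  have [r r0 h] := H (e / 2) ltac:(by rewrite divr_gt0).
  exists r => // w /h; rewrite quotzz /quot.
  have [-> _|wz k] := eqVneq w z; first by rewrite subrr nm0.
  have wz0 : w - z != 0 by rewrite subr_eq0.
  have : nm ((f w - f z) / (w - z) - d) <= e / 2.
    rewrite -(@ler_pM2r _ (nm (w - z))) ?nm_gt0// -nmM (le_trans _ k)//.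
    by rewrite mulrBl divfK.
  by move=> /le_lt_trans; apply; rewrite ltr_pdivrMr// ltr_pMr// ltrDl.
have [r r0 h] := H _ e0; exists r => // w /h.
rewrite quotzz => k; rewrite {1}(quotE f z d w) (addrC (f z)) addrK -mulrBl nmM.
by rewrite ler_wpM2r ?nm_ge0// ltW.
Qed.

Lemma hasder_carath f z q d : contat q z -> q z = d ->
  (forall w, f w = f z + q w * (w - z)) -> hasder f z d.
Proof.
move=> H <- fq e e0; have [r r0 h] := H _ e0; exists r => // w /h k.
rewrite {1}(fq w) (addrC (f z)) addrK -mulrBl nmM.
by rewrite ler_wpM2r ?nm_ge0// ltW.
Qed.

Lemma hasder_cst c z : hasder (fun=> c) z 0.
Proof. by move=> e e0; exists 1 => // w _; rewrite subrr mul0r subrr nm0 mulr_ge0 ?nm_ge0// ltW. Qed.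

Lemma hasder_id z : hasder id z 1.
Proof. by move=> e e0; exists 1 => // w _; rewrite mul1r subrr nm0 mulr_ge0 ?nm_ge0// ltW. Qed.

Lemma hasderD f g z d e : hasder f z d -> hasder g z e ->
  hasder (fun w => f w + g w) z (d + e).
Proof.
move=> /hasder_quot hf /hasder_quot hg.
apply: (hasder_carath (q := fun w => quot f z d w + quot g z e w)).
- exact: contatD.
- by rewrite !quotzz.
by move=> w /=; rewrite {1}(quotE f z d w) {1}(quotE g z e w); ring.
Qed.

Lemma hasderM f g z d e : hasder f z d -> hasder g z e ->
  hasder (fun w => f w * g w) z (d * g z + f z * e).
Proof.
move=> hf hg; have cg := hasder_contat hg.
move: hf hg => /hasder_quot hf /hasder_quot hg.
apply: (hasder_carath (q := fun w => quot f z d w * g w + f z * quot g z e w)).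
- by apply: contatD; [exact: contatM|apply: contatM => //; exact: contat_cst].
- by rewrite !quotzz.
by move=> w /=; rewrite {1}(quotE f z d w) {1 2}(quotE g z e w); ring.
Qed.

Lemma hasder_comp f g z d e : hasder f z d -> hasder g (f z) e ->
  hasder (g \o f) z (e * d).
Proof.
move=> hf hg; have cf := hasder_contat hf.
move: hf hg => /hasder_quot hf /hasder_quot hg.
apply: (hasder_carath (q := fun w => quot g (f z) e (f w) * quot f z d w)).
- by apply: contatM => //; apply: contat_comp cf hg.
- by rewrite !quotzz.
move=> w /=; rewrite {1}(quotE g (f z) e (f w)) {2}(quotE f z d w); ring.
Qed.

Lemma hasderN f z d : hasder f z d -> hasder (fun w => - f w) z (- d).
Proof.
move=> hf e e0; have [r r0 h] := hf e e0; exists r => // w /h.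
by rewrite (_ : - f w - - f z - _ = - (f w - f z - d * (w - z))) ?nmN//; ring.
Qed.

Lemma hasderB f g z d e : hasder f z d -> hasder g z e ->
  hasder (fun w => f w - g w) z (d - e).
Proof. by move=> hf hg; apply: hasderD => //; exact: hasderN. Qed.

Lemma hasderZ c f z d : hasder f z d -> hasder (fun w => c * f w) z (c * d).
Proof.
by move=> hf; have := hasderM (hasder_cst c z) hf; rewrite mul0r add0r.
Qed.

Lemma hasderV f z d : f z != 0 -> hasder f z d ->
  hasder (fun w => (f w)^-1) z (- d / f z ^+ 2).
Proof.
move=> fz hf; have cf := hasder_contat hf.
have [r r0 fnz] := cf (nm (f z)) ltac:(by rewrite nm_gt0).
have {}fnz w : nm (w - z) < r -> f w != 0.
  move=> /fnz; apply: contraTneq => ->; rewrite sub0r nmN ltxx//.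
move: hf => /hasder_quot hf.
(* The slope of the inverse. It factors the increment only where [f w] is nonzero, that is near [z],
   so [hasder_carath], which asks for the factorization everywhere, is replaced by a direct estimate
   on a smaller disc. *)
pose q w := - quot f z d w / (f z * f w).
have -> : - d / f z ^+ 2 = q z by rewrite /q quotzz expr2.
have cq : contat q z.
  apply: contatM; first exact: contatN.
  apply: contatV; first by rewrite mulf_neq0.
  by apply: contatM => //; exact: contat_cst.
move=> e e0; have [s s0 h] := cq _ e0.
exists (Num.min r s); first by rewrite lt_min r0.
move=> w; rewrite lt_min => /andP[/fnz fw /h k].
have -> : (f w)^-1 - (f z)^-1 - q z * (w - z) = (q w - q z) * (w - z).
  rewrite mulrBl; congr (_ - _).
  have E := quotE f z d w.
  have -> : (f w)^-1 - (f z)^-1 = - (f w - f z) / (f z * f w).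
    by field; rewrite fz fw.
  by rewrite {1}E (addrC (f z)) addrK /q -!mulNr mulrAC.
by rewrite nmM ler_wpM2r ?nm_ge0// ltW.
Qed.

End hasder_calculus.

(** * Contour integrals and Cauchy estimates *)

Section segment_integral.
Variable R : realType.
Notation mu := (@lebesgue_measure R).
Implicit Types (a b m : R) (u : R -> R) (g h : R[i] -> R[i]) (p v z : R[i]).

Definition fint u a b : R := \int[mu]_(t in `[a, b]) u t.

Lemma within_eps u a b :
  (forall t, a <= t <= b -> forall e, 0 < e -> exists2 d, 0 < d & forall s,
     a <= s <= b -> `|s - t| < d -> `|u s - u t| < e) ->
  {within `[a, b], continuous u}.
Proof.
move=> H; apply/subspace_continuousP => t; rewrite /= in_itv /= => /H{}H.
apply/cvgrPdist_lt => e e0; have [d d0 K] := H _ e0.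
rewrite /within /=; apply/nbhs_ballP; exists d => // s.
by rewrite /ball /= distrC => st; rewrite in_itv /= => ab; rewrite distrC K.
Qed.

Lemma is_derive_eps u (t d : R) :
  (forall e, 0 < e -> exists2 r, 0 < r & forall s, `|s - t| < r ->
     `|u s - u t - d * (s - t)| <= e * `|s - t|) -> is_derive t 1 u d.
Proof.
move=> H.
have C : (fun k : R => k^-1 *: (u (k *: 1 + t) - u t)) @ 0^' --> d.
  apply/cvgrPdist_le => e e0; have [r r0 K] := H _ e0.
  near=> k.
  have k0 : k != 0 by near: k; exact: nbhs_dnbhs_neq.
  have kr : `|k| < r by near: k; apply: dnbhs0_lt.
  have := K (k + t); rewrite addrK => /(_ kr).
  rewrite [k *: 1]mulr1 => {}K.
  rewrite -(@ler_pM2r _ `|k|) ?normr_gt0// -normrM; apply: le_trans K.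
  by rewrite distrC /GRing.scale /= mulrBl mulrAC mulVf// mul1r.
apply: DeriveDef; first by apply/cvg_ex; exists d.
exact: (cvg_lim _ C).
Unshelve. all: by end_near.
Qed.

Lemma fint_integrable u a b : {within `[a, b], continuous u} ->
  mu.-integrable `[a, b] (EFin \o u).
Proof. by move=> H; apply: continuous_compact_integrable => //; exact: segment_compact. Qed.

Lemma fintD u1 u2 a b : {within `[a, b], continuous u1} ->
  {within `[a, b], continuous u2} ->
  fint (fun t => u1 t + u2 t) a b = fint u1 a b + fint u2 a b.
Proof. by move=> /fint_integrable h1 /fint_integrable h2; rewrite /fint RintegralD. Qed.

Lemma fintZ k u a b : {within `[a, b], continuous u} ->
  fint (fun t => k * u t) a b = k * fint u a b.
Proof. by move=> /fint_integrable h; rewrite /fint RintegralZl. Qed.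

Lemma fint_cst k a b : a <= b -> fint (fun=> k) a b = k * (b - a).
Proof.
move=> ab; rewrite /fint Rintegral_cst//= lebesgue_measure_itv /= lte_fin.
by case: ltP => // ba; rewrite (le_anti (introT andP (conj ab ba))) subrr.
Qed.

Lemma fint_le u1 u2 a b : {within `[a, b], continuous u1} ->
  {within `[a, b], continuous u2} ->
  (forall t, a <= t <= b -> u1 t <= u2 t) -> fint u1 a b <= fint u2 a b.
Proof.
move=> /fint_integrable h1 /fint_integrable h2 H; apply: le_Rintegral => // t.
Qed.

Lemma fint_split u a m b : a <= m -> m <= b -> {within `[a, b], continuous u} ->
  fint u a b = fint u a m + fint u m b.
Proof.
move=> am mb cu; have iu := fint_integrable cu; rewrite /fint.
have := @Rintegral_itvB R u (BLeft a) (BRight b) m iu; rewrite !bnd_simp => /(_ am mb).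
rewrite Rintegral_itv_obnd_cbnd => [<-|]; first by rewrite addrC subrK.
apply: integrableS iu => //; apply: subset_itvr.
by rewrite bnd_simp.
Qed.

Lemma fint_ftc u (F : R -> R) a b : a < b -> {within `[a, b], continuous u} ->
  {within `[a, b], continuous F} ->
  (forall t, a < t < b -> is_derive t 1 F (u t)) -> fint u a b = F b - F a.
Proof.
move=> ab cu cF dF; rewrite /fint /Rintegral.
have [_ cFa cFb] := (continuous_within_itvP F ab).1 cF.
rewrite (continuous_FTC2 ab cu (F := F))//.
- split => // t; rewrite in_itv /= => tab.
  by have [] := dF _ tab.
- move=> t; rewrite in_itv /= => tab.
  by have [? <-] := dF _ tab; rewrite derive1E.
Qed.

Definition CI (F : R -> R[i]) a b : R[i] :=
  fint (fun t => Re (F t)) a b +i* fint (fun t => Im (F t)) a b.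

Definition line p v (t : R) : R[i] := p + v * t%:C.

(** The contour integral of [g] along the segment parametrized by [line p v]; the factor [v] is the
    derivative of the parametrization. *)
Definition seg g p v a b : R[i] := v * CI (g \o line p v) a b.

Definition scont g p v a b := forall t, a <= t <= b -> contat g (line p v t).

Lemma lineB p v s t : nm (line p v s - line p v t) = nm v * `|s - t|.
Proof. by rewrite /line opprD addrACA subrr add0r -mulrBr -rmorphB nmM nmR. Qed.

Lemma scont_within (k : R[i] -> R) g p v a b :
  (forall z w, `|k z - k w| <= nm (z - w)) -> scont g p v a b ->
  {within `[a, b], continuous (k \o g \o line p v)}.
Proof.
move=> klip H; apply: within_eps => t /H gt e e0.
have [d d0 K] := gt _ e0; have v1 : 0 < nm v + 1 by rewrite ltr_wpDl ?nm_ge0.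
exists (d / (nm v + 1)); first by rewrite divr_gt0.
move=> s _; rewrite ltr_pdivlMr// => st; apply: le_lt_trans (klip _ _) _.
apply: K; rewrite lineB; apply: le_lt_trans st.
by rewrite mulrC ler_wpM2l// lerDl.
Qed.

Lemma Re_lip z w : `|Re z - Re w| <= nm (z - w).
Proof. by case: z w => a b [c d]; exact: (Re_le_nm ((a - c) +i* (b - d))). Qed.

Lemma Im_lip z w : `|Im z - Im w| <= nm (z - w).
Proof. by case: z w => a b [c d]; exact: (Im_le_nm ((a - c) +i* (b - d))). Qed.

Lemma nm_lip z w : `|nm z - nm w| <= nm (z - w).
Proof. by rewrite ler_norml lerNl opprB {1}nm_distC !nm_subl. Qed.

Lemma scont_Re g p v a b : scont g p v a b ->
  {within `[a, b], continuous (fun t => Re (g (line p v t)))}.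
Proof. exact: (scont_within (k := @complex.Re R) Re_lip). Qed.

Lemma scont_Im g p v a b : scont g p v a b ->
  {within `[a, b], continuous (fun t => Im (g (line p v t)))}.
Proof. exact: (scont_within (k := @complex.Im R) Im_lip). Qed.

Lemma scont_nm g p v a b : scont g p v a b ->
  {within `[a, b], continuous (fun t => nm (g (line p v t)))}.
Proof. exact: (scont_within (k := fun z => nm z) nm_lip). Qed.

Lemma seg_deg g p v a : seg g p v a a = 0.
Proof.
rewrite /seg /CI /fint set_itv1 !Rintegral_set1.
by rewrite -[_ +i* _]/(0 : R[i]) mulr0.
Qed.

Lemma Im_segH g p a b : Im (seg g p 1 a b) = fint (fun t => Im (g (line p 1 t))) a b.
Proof. by rewrite /seg mul1r. Qed.

Lemma Im_segV g p a b : Im (seg g p 'i a b) = fint (fun t => Re (g (line p 'i t))) a b.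
Proof. by rewrite /seg mulrC ImiRe. Qed.

Lemma segD g h p v a b : scont g p v a b -> scont h p v a b ->
  seg (fun z => g z + h z) p v a b = seg g p v a b + seg h p v a b.
Proof.
move=> cg ch; rewrite /seg -mulrDr; congr (_ * _); rewrite /CI.
transitivity ((fint (fun t => Re (g (line p v t))) a b + fint (fun t => Re (h (line p v t))) a b)
  +i* (fint (fun t => Im (g (line p v t))) a b + fint (fun t => Im (h (line p v t))) a b)) => //.
rewrite -!fintD; do ?[exact: scont_Re|exact: scont_Im].
by congr (fint _ _ _ +i* fint _ _ _); apply/funext => t /=;
  case: (g _) => ? ?; case: (h _).
Qed.

Lemma CIZ (k : R[i]) g p v a b : scont g p v a b ->
  CI (fun t => k * g (line p v t)) a b = k * CI (g \o line p v) a b.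
Proof.
move=> cg; rewrite /CI.
have cR := scont_Re cg; have cI := scont_Im cg.
have zc (c : R) (u : R -> R) : {within `[a, b], continuous u} ->
    {within `[a, b], continuous (fun t => c * u t)}.
  by move=> hu t; apply: cvgM; [exact: cvg_cst|exact: hu].
have lin (x y : R) : x * fint (fun t => Re (g (line p v t))) a b +
     y * fint (fun t => Im (g (line p v t))) a b =
     fint (fun t => x * Re (g (line p v t)) + y * Im (g (line p v t))) a b.
  rewrite -(fintZ x cR) -(fintZ y cI) fintD//; [exact: (zc x _ cR)|exact: (zc y _ cI)].
case: k => x y; transitivity
  ((x * fint (fun t => Re (g (line p v t))) a b + - y * fint (fun t => Im (g (line p v t))) a b)
   +i* (y * fint (fun t => Re (g (line p v t))) a b + x * fint (fun t => Im (g (line p v t))) a b)).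
  rewrite !lin; congr (fint _ _ _ +i* fint _ _ _); apply/funext => t /=;
    by case: (g _) => ? ? /=; ring.
rewrite /CI; congr (_ +i* _); [by rewrite mulNr|by rewrite addrC].
Qed.

Lemma segZ (k : R[i]) g p v a b : scont g p v a b ->
  seg (fun z => k * g z) p v a b = k * seg g p v a b.
Proof. by move=> cg; rewrite /seg mulrCA -(CIZ k cg). Qed.

Lemma seg_split g p v a m b : a <= m -> m <= b -> scont g p v a b ->
  seg g p v a b = seg g p v a m + seg g p v m b.
Proof.
move=> am mb cg; rewrite /seg -mulrDr; congr (_ * _); rewrite /CI.
rewrite (fint_split am mb (scont_Re cg)) (fint_split am mb (scont_Im cg)) //.
Qed.

(** Multiplied by [unitdir] of its own value, the integral becomes the integral of a real part,
    which is compared pointwise with the modulus. *)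
Lemma seg_nm_le g p v a b : scont g p v a b ->
  nm (seg g p v a b) <= nm v * fint (fun t => nm (g (line p v t))) a b.
Proof.
move=> cg; rewrite nmM ler_wpM2l ?nm_ge0//.
set c := CI _ _ _; pose k := unitdir c.
have ck : scont (fun z => k * g z) p v a b.
  by move=> t /cg ct; apply: contatM => //; exact: contat_cst.
have := CIZ k cg; rewrite -/c unitdirM => /(congr1 (@complex.Re R)) /= <-.
apply: fint_le; [exact: scont_Re ck|exact: scont_nm|move=> t _].
by rewrite (le_trans (ler_norm _))// (le_trans (Re_le_nm _))// nmM nm_unitdir mul1r.
Qed.

Lemma seg_bound g p v a b (M : R) : a <= b -> scont g p v a b ->
  (forall t, a <= t <= b -> nm (g (line p v t)) <= M) ->
  nm (seg g p v a b) <= nm v * (M * (b - a)).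
Proof.
move=> ab cg H; rewrite (le_trans (seg_nm_le cg))// ler_wpM2l ?nm_ge0//.
rewrite -fint_cst//; apply: fint_le => //; first exact: scont_nm.
by move=> t; exact: cvg_cst.
Qed.

(** [k] is meant to be [Re] or [Im]; the hypotheses list what the two share: additivity, real
    homogeneity and domination by the modulus. *)
Lemma is_derive_line (k : R[i] -> R) h p v (t : R) d :
  (forall z w, k (z - w) = k z - k w) -> (forall z (r : R), k (z * r%:C) = k z * r) ->
  (forall z, `|k z| <= nm z) -> hasder h (line p v t) d ->
  is_derive t 1 (fun t => k (h (line p v t))) (k (v * d)).
Proof.
move=> kB kM kn dh; apply: is_derive_eps => e e0.
have v1 : 0 < nm v + 1 by rewrite ltr_wpDl ?nm_ge0.
have [r r0 K] := dh _ (divr_gt0 e0 v1).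
exists (r / (nm v + 1)); first by rewrite divr_gt0.
move=> s; rewrite ltr_pdivlMr// => st.
have := K (line p v s); rewrite lineB.
have E : line p v s - line p v t = v * (s - t)%:C.
  by rewrite /line opprD addrACA subrr add0r -mulrBr -rmorphB.
rewrite -kB -kM -kB E mulrA (mulrC _ v) => /(_ _)/(le_trans (kn _))/le_trans; apply.
  by apply: le_lt_trans st; rewrite mulrC ler_wpM2l// lerDl.
rewrite mulrA ler_wpM2r// mulrAC ler_pdivrMr// ler_pM2l//.
by rewrite lerDl.
Qed.

Lemma is_derive_Re_line h p v (t : R) d : hasder h (line p v t) d ->
  is_derive t 1 (fun t => Re (h (line p v t))) (Re (v * d)).
Proof.
apply: (is_derive_line (k := @complex.Re R)); [| |exact: Re_le_nm].
  by case=> ? ? [].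
by case=> ? ? r /=; ring.
Qed.

Lemma is_derive_Im_line h p v (t : R) d : hasder h (line p v t) d ->
  is_derive t 1 (fun t => Im (h (line p v t))) (Im (v * d)).
Proof.
apply: (is_derive_line (k := @complex.Im R)); [| |exact: Im_le_nm].
  by case=> ? ? [].
by case=> ? ? r /=; ring.
Qed.

Lemma seg_ftc g h p v a b : a < b -> scont g p v a b ->
  (forall t, a <= t <= b -> hasder h (line p v t) (g (line p v t))) ->
  seg g p v a b = h (line p v b) - h (line p v a).
Proof.
move=> ab cg dh.
have cvg : scont (fun z => v * g z) p v a b.
  by move=> t /cg ct; apply: contatM => //; exact: contat_cst.
have chh : scont h p v a b by move=> t /dh /hasder_contat.
rewrite /seg -CIZ// /CI.
have -> : h (line p v b) - h (line p v a) =
  (Re (h (line p v b)) - Re (h (line p v a))) +i* (Im (h (line p v b)) - Im (h (line p v a))).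
  by case: (h _) => ? ?; case: (h _).
congr (_ +i* _).
  apply: (fint_ftc (F := fun t => Re (h (line p v t)))) => //.
  - exact: scont_Re cvg.
  - exact: scont_Re.
  - move=> t /andP[/ltW at_ /ltW tb]; apply: is_derive_Re_line; apply: dh.
    by rewrite at_.
apply: (fint_ftc (F := fun t => Im (h (line p v t)))) => //.
- exact: scont_Im cvg.
- exact: scont_Im.
- move=> t /andP[/ltW at_ /ltW tb]; apply: is_derive_Im_line; apply: dh.
  by rewrite at_.
Qed.

End segment_integral.

(** * Successive quartering of a rectangle *)

Section bisection.
Variable R : realType.
Implicit Types a b c d e p q w h x y : R.

Definition subrect a b c d a' b' c' d' :=
  [/\ a <= a', a' <= b', b' <= b & [/\ c <= c', c' <= d' & d' <= d]].

Lemma nested_point (x : nat -> R) (w : nat -> R) :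
  (forall n, 0 <= w n) -> (forall n, x n <= x n.+1) ->
  (forall n, x n.+1 + w n.+1 <= x n + w n) ->
  exists p, forall n, x n <= p <= x n + w n.
Proof.
move=> w0 xi xd.
have mono n k : x n <= x (n + k)%N.
  by elim: k => [|k IH]; rewrite ?addn0// addnS (le_trans IH).
have monod n k : x (n + k)%N + w (n + k)%N <= x n + w n.
  by elim: k => [|k IH]; rewrite ?addn0// addnS (le_trans _ IH).
have ub m n : x m <= x n + w n.
  rewrite (le_trans (mono m n))// (le_trans _ (monod n m))// addnC lerDl//.
exists (sup (range x)) => n; apply/andP; split.
  apply: ub_le_sup; last by exists n.
  by exists (x 0%N + w 0%N) => _ [m _ <-].
by apply: ge_sup; [exists (x 0%N), 0%N|move=> _ [m _ <-]].
Qed.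

Lemma half_sum4 (K n1 n2 n3 n4 : R) : K <= n1 + n2 + (n3 + n4) ->
  [\/ K / 4 <= n1, K / 4 <= n2, K / 4 <= n3 | K / 4 <= n4].
Proof.
move=> H; have [h1|h1] := leP (K / 4) n1; first by constructor.
have [h2|h2] := leP (K / 4) n2; first by constructor.
have [h3|h3] := leP (K / 4) n3; first by constructor.
by constructor; lra.
Qed.

(** Goursat's argument freed from the integrand. If the value [K] on the whole rectangle were
    positive, one quarter would carry at least [K / 4], and so on; the nested rectangles shrink to a
    point, where the local quadratic bound is too small for [K / 4 ^ n]. *)
Lemma rect_bisection (N : R -> R -> R -> R -> R) a b c d : a <= b -> c <= d ->
  (forall a' b' c' d', subrect a b c d a' b' c' d' ->
     let m := (a' + b') / 2 in let n := (c' + d') / 2 in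
     N a' b' c' d' <= N a' m c' n + N m b' c' n + (N a' m n d' + N m b' n d')) ->
  (forall p q, a <= p <= b -> c <= q <= d -> forall e, 0 < e ->
     exists2 r, 0 < r & forall a' b' c' d', subrect a b c d a' b' c' d' ->
       a' <= p <= b' -> c' <= q <= d' -> b' - a' < r -> d' - c' < r ->
       N a' b' c' d' <= e * (b' - a' + (d' - c')) ^+ 2) ->
  N a b c d <= 0.
Proof.
move=> ab cd sub loc; rewrite leNgt; apply/negP; set K := N a b c d => K0.
pose s n : R := 2^-1 ^+ n; pose w n := (b - a) * s n; pose h n := (d - c) * s n.
have sS n : s n = s n.+1 + s n.+1 by rewrite /s exprS; lra.
have s0 n : 0 < s n by rewrite exprn_gt0.
have w0 n : 0 <= w n by rewrite mulr_ge0 ?subr_ge0// ltW.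
have h0 n : 0 <= h n by rewrite mulr_ge0 ?subr_ge0// ltW.
have wS n : w n = w n.+1 + w n.+1 by rewrite /w sS mulrDr.
have hS n : h n = h n.+1 + h n.+1 by rewrite /h sS mulrDr.
(* The side lengths at stage [n] are fixed beforehand as [w n] and [h n], so a rectangle is recorded
   by its lower left corner alone. *)
pose good n (z : R * R) :=
  subrect a b c d z.1 (z.1 + w n) z.2 (z.2 + h n) /\
  K * (4^-1) ^+ n <= N z.1 (z.1 + w n) z.2 (z.2 + h n).
have step n z : good n z -> exists z', good n.+1 z' /\
    (z.1 <= z'.1 /\ z'.1 + w n.+1 <= z.1 + w n) /\
    (z.2 <= z'.2 /\ z'.2 + h n.+1 <= z.2 + h n).
  case: z => x y; rewrite /good /= => -[sr].
  have := sub _ _ _ _ sr => /=.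
  have -> : (x + (x + w n)) / 2 = x + w n.+1 by rewrite wS; lra.
  have -> : (y + (y + h n)) / 2 = y + h n.+1 by rewrite hS; lra.
  move=> H H'; have := half_sum4 (le_trans H' H).
  have wn := w0 n.+1; have hn := h0 n.+1; have wSn := wS n; have hSn := hS n.
  have ex : K * 4^-1 ^+ n / 4 = K * 4^-1 ^+ n.+1 by rewrite exprS; lra.
  rewrite ex.
  have -> : x + w n = x + w n.+1 + w n.+1 by rewrite wS; lra.
  have -> : y + h n = y + h n.+1 + h n.+1 by rewrite hS; lra.
  clear H H' ex; case: sr => ? ? ? [? ? ?].
  case=> HK; [exists (x, y)|exists (x + w n.+1, y)|exists (x, y + h n.+1)|
     exists (x + w n.+1, y + h n.+1)]; rewrite /= HK; clear HK; repeat split; lra.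
have g0 : good 0%N (a, c).
  rewrite /good /= /w /h /s !expr0 !mulr1 (addrC a) (addrC c) !subrK.
  by split.
(* [choice] requires a total function: a corner that is not good is left where it is. *)
have [f fS] : {f : forall n, R * R -> R * R | forall n z, good n z -> good n.+1 (f n z) /\
    (z.1 <= (f n z).1 /\ (f n z).1 + w n.+1 <= z.1 + w n) /\
    (z.2 <= (f n z).2 /\ (f n z).2 + h n.+1 <= z.2 + h n)}.
  have /choice[f Hf] : forall nz : nat * (R * R), exists z', good nz.1 nz.2 -> good nz.1.+1 z' /\
    (nz.2.1 <= z'.1 /\ z'.1 + w nz.1.+1 <= nz.2.1 + w nz.1) /\
    (nz.2.2 <= z'.2 /\ z'.2 + h nz.1.+1 <= nz.2.2 + h nz.1).
    move=> [n z]; have [/step[z' ?]|ng] := pselect (good n z); first by exists z'.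
    by exists z => /ng.
  by exists (fun n z => f (n, z)) => n z; exact: (Hf (n, z)).
pose z := fix z n := if n is n'.+1 then f n' (z n') else (a, c).
have gz n : good n (z n) by elim: n => // n IH; have [] := fS n _ IH.
have [p Hp] := @nested_point (fun n => (z n).1) w w0
  (fun n => (fS n _ (gz n)).2.1.1) (fun n => (fS n _ (gz n)).2.1.2).
have [q Hq] := @nested_point (fun n => (z n).2) h h0
  (fun n => (fS n _ (gz n)).2.2.1) (fun n => (fS n _ (gz n)).2.2.2).
have pab : a <= p <= b.
  by have := Hp 0%N; rewrite /= /w /s expr0 mulr1 (addrC a) subrK.
have qcd : c <= q <= d.
  by have := Hq 0%N; rewrite /= /h /s expr0 mulr1 (addrC c) subrK.
pose D := (b - a) + (d - c) + 1.
have D0 : 0 < D by rewrite /D; lra.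
(* [D] exceeds the sum of the two sides, so with this tolerance the local bound at stage [n] is less
   than half of [K / 4 ^ n]. The added 1 keeps [D] positive for a degenerate rectangle. *)
have [r r0 Hr] := loc p q pab qcd (K / (2 * D ^+ 2)) ltac:(by rewrite divr_gt0// mulr_gt0// exprn_gt0).
have [n Hn] : exists n, s n * D < r.
  have /cvgr0Pnorm_lt : (fun n => s n) @ \oo --> 0 by apply: cvg_expr; rewrite ger0_norm//; lra.
  move=> /(_ (r / D) ltac:(by rewrite divr_gt0)) [n _ Hn]; exists n.
  by have := Hn n (leqnn n); rewrite /= ger0_norm ?ltW// ltr_pdivlMr.
have sD (x : R) : 0 <= x -> x <= D -> x * s n < r.
  by move=> x0 xD; rewrite (le_lt_trans _ Hn)// mulrC ler_wpM2l// ltW.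
have [sr HN] := gz n.
have addKl (x y : R) : x + y - x = y by rewrite addrC addKr.
have := Hr _ _ _ _ sr (Hp n) (Hq n); rewrite !addKl.
have wr : w n < r by apply: sD; rewrite /D; lra.
have hr : h n < r by apply: sD; rewrite /D; lra.
move=> /(_ wr hr).
have -> : K / (2 * D ^+ 2) * (w n + h n) ^+ 2 =
    (K * 4^-1 ^+ n) * (((b - a) + (d - c)) ^+ 2 / (2 * D ^+ 2)).
  have -> : w n + h n = ((b - a) + (d - c)) * s n by rewrite mulrDl.
  rewrite exprMn (_ : s n ^+ 2 = 4^-1 ^+ n); first by ring.
  by rewrite /s -exprM mulnC exprM; congr (_ ^+ n); lra.
have K4 : 0 < K * 4^-1 ^+ n by rewrite mulr_gt0// exprn_gt0// invr_gt0.
move=> /(le_trans HN).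
rewrite -[X in X <= _]mulr1 ler_pM2l//.
have lt1 : (b - a + (d - c)) ^+ 2 / (2 * D ^+ 2) < 1.
  rewrite ltr_pdivrMr ?mul1r ?mulr_gt0 ?exprn_gt0//.
  apply: le_lt_trans (_ : D ^+ 2 < _); last by rewrite ltr_pMl ?exprn_gt0//; lra.
  by rewrite ler_sqr ?nnegrE; rewrite /D; lra.
by rewrite leNgt lt1.
Qed.

End bisection.

Local Opaque seg.

(** * Goursat's theorem on rectangles *)

Section rectangle_integral.
Variable R : realType.
Implicit Types (a b c d m r s : R) (f g h : R[i] -> R[i]) (p v w z k : R[i]).

(* Integral along the counterclockwise boundary of the rectangle [[a, b] x [c, d]]. *)
Definition J g a b c d : R[i] :=
  seg g ('i * c%:C) 1 a b + seg g b%:C 'i c d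
  - seg g ('i * d%:C) 1 a b - seg g a%:C 'i c d.

Lemma lineHE c t : line ('i * c%:C) 1 t = t +i* c :> R[i].
Proof. by apply/eqP; rewrite eq_complex /=; apply/andP; split; apply/eqP; ring. Qed.

Lemma lineVE a t : line a%:C 'i t = a +i* t :> R[i].
Proof. by apply/eqP; rewrite eq_complex /=; apply/andP; split; apply/eqP; ring. Qed.

Definition bcont g a b c d :=
  [/\ scont g ('i * c%:C) 1 a b, scont g b%:C 'i c d,
      scont g ('i * d%:C) 1 a b & scont g a%:C 'i c d].

Lemma bcontP g a b c d : a <= b -> c <= d ->
  (forall x y, a <= x <= b -> c <= y <= d ->
     [|| x == a, x == b, y == c | y == d] -> contat g (x +i* y)) ->
  bcont g a b c d.
Proof.
move=> ab cd H; split=> t tab; rewrite ?lineHE ?lineVE; apply: H => //;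
  rewrite ?lexx ?ab ?cd ?eqxx ?orbT//.
Qed.

Lemma bcontD g h a b c d : bcont g a b c d -> bcont h a b c d ->
  bcont (fun z => g z + h z) a b c d.
Proof.
by move=> [? ? ? ?] [? ? ? ?]; split=> t tab; apply: contatD; auto.
Qed.

Lemma bcontZ k g a b c d : bcont g a b c d -> bcont (fun z => k * g z) a b c d.
Proof.
by move=> [? ? ? ?]; split=> t tab; apply: contatM; auto; exact: contat_cst.
Qed.

Lemma JD g h a b c d : bcont g a b c d -> bcont h a b c d ->
  J (fun z => g z + h z) a b c d = J g a b c d + J h a b c d.
Proof. by move=> [? ? ? ?] [? ? ? ?]; rewrite /J !segD//; ring. Qed.

Lemma JZ k g a b c d : bcont g a b c d ->
  J (fun z => k * g z) a b c d = k * J g a b c d.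
Proof. by move=> [? ? ? ?]; rewrite /J !segZ//; ring. Qed.

Lemma JB g h a b c d : bcont g a b c d -> bcont h a b c d ->
  J (fun z => g z - h z) a b c d = J g a b c d - J h a b c d.
Proof.
move=> cg ch; have := bcontZ (-1) ch => ch'.
rewrite -[X in _ - X]mul1r -mulNr -JZ// -JD//.
apply: (congr1 (fun u => J u a b c d)); apply/funext => z.
by rewrite mulN1r.
Qed.

Lemma J_splitH g a m b c d : a <= m -> m <= b ->
  scont g ('i * c%:C) 1 a b -> scont g ('i * d%:C) 1 a b ->
  J g a b c d = J g a m c d + J g m b c d.
Proof.
by move=> am mb h1 h2; rewrite /J (seg_split am mb h1) (seg_split am mb h2); ring.
Qed.

Lemma J_splitV g a b c m d : c <= m -> m <= d ->
  scont g a%:C 'i c d -> scont g b%:C 'i c d ->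
  J g a b c d = J g a b c m + J g a b m d.
Proof.
by move=> am mb h1 h2; rewrite /J (seg_split am mb h1) (seg_split am mb h2); ring.
Qed.

Lemma J_bound g a b c d M : a <= b -> c <= d -> bcont g a b c d ->
  (forall x y, a <= x <= b -> c <= y <= d ->
     [|| x == a, x == b, y == c | y == d] -> nm (g (x +i* y)) <= M) ->
  nm (J g a b c d) <= 2 * M * ((b - a) + (d - c)).
Proof.
move=> ab cd [h1 h2 h3 h4] H; rewrite /J.
have b1 : nm (seg g ('i * c%:C) 1 a b) <= M * (b - a).
  rewrite -[leRHS]mul1r -[X in X * (M * _)](nm1 R); apply: seg_bound => // t tab.
  by rewrite lineHE H// ?lexx ?eqxx ?orbT.
have b2 : nm (seg g b%:C 'i c d) <= M * (d - c).
  rewrite -[leRHS]mul1r -[X in X * (M * _)](nmi R); apply: seg_bound => // t tab.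
  by rewrite lineVE H// ?lexx ?eqxx ?orbT ?ab.
have b3 : nm (seg g ('i * d%:C) 1 a b) <= M * (b - a).
  rewrite -[leRHS]mul1r -[X in X * (M * _)](nm1 R); apply: seg_bound => // t tab.
  by rewrite lineHE H// ?lexx ?eqxx ?orbT ?cd.
have b4 : nm (seg g a%:C 'i c d) <= M * (d - c).
  rewrite -[leRHS]mul1r -[X in X * (M * _)](nmi R); apply: seg_bound => // t tab.
  by rewrite lineVE H// ?lexx ?eqxx ?orbT ?ab.
rewrite (le_trans (nmB _ _))// (le_trans (lerD (nmB _ _) (lexx _)))//.
rewrite (le_trans (lerD (lerD (nmD _ _) (lexx _)) (lexx _)))//.
by lra.
Qed.

Lemma seg_ftc_le g h p v a b : a <= b -> scont g p v a b ->
  (forall t, a <= t <= b -> hasder h (line p v t) (g (line p v t))) ->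
  seg g p v a b = h (line p v b) - h (line p v a).
Proof.
rewrite le_eqVlt => /predU1P[<- _ _|]; first by rewrite seg_deg subrr.
exact: seg_ftc.
Qed.

Lemma J_ftc g h a b c d : a <= b -> c <= d -> bcont g a b c d ->
  (forall x y, a <= x <= b -> c <= y <= d ->
     [|| x == a, x == b, y == c | y == d] -> hasder h (x +i* y) (g (x +i* y))) ->
  J g a b c d = 0.
Proof.
move=> ab cd [h1 h2 h3 h4] H; rewrite /J.
rewrite (@seg_ftc_le g h _ _ _ _ ab h1); last first.
  by move=> t tab; rewrite lineHE; apply: H; rewrite ?lexx ?eqxx ?orbT.
rewrite (@seg_ftc_le g h _ _ _ _ cd h2); last first.
  by move=> t tab; rewrite lineVE; apply: H; rewrite ?lexx ?eqxx ?orbT ?ab.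
rewrite (@seg_ftc_le g h _ _ _ _ ab h3); last first.
  by move=> t tab; rewrite lineHE; apply: H; rewrite ?lexx ?eqxx ?orbT ?cd.
rewrite (@seg_ftc_le g h _ _ _ _ cd h4); last first.
  by move=> t tab; rewrite lineVE; apply: H; rewrite ?lexx ?eqxx ?orbT ?ab.
rewrite !lineHE !lineVE; ring.
Qed.

Lemma nm_rect_le a b c d x y x' y' : a <= x <= b -> c <= y <= d ->
  a <= x' <= b -> c <= y' <= d ->
  nm ((x +i* y) - (x' +i* y') : R[i]) <= (b - a) + (d - c).
Proof.
move=> *; apply: le_trans (nm_le_ReIm _) _; rewrite /= lerD// ler_norml; lra.
Qed.

(** Near a point, [g] differs from its affine approximation by [e / 2] times the distance. The
    affine part has a primitive and integrates to 0; the rest is at most [e / 2] times the sum of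
    the sides, on a contour of twice that length, which is the quadratic bound that [rect_bisection]
    asks for. The derivative of [g] need not be continuous. *)
Lemma goursat g a b c d : a <= b -> c <= d ->
  (forall x y, a <= x <= b -> c <= y <= d -> exists e, hasder g (x +i* y) e) ->
  J g a b c d = 0.
Proof.
move=> ab cd H; apply/eqP; rewrite -nm_eq0; apply/eqP/le_anti; rewrite nm_ge0 andbT.
have cg x y : a <= x <= b -> c <= y <= d -> contat g (x +i* y).
  by move=> hx hy; have [e /hasder_contat] := H _ _ hx hy.
have bc a' b' c' d' : subrect a b c d a' b' c' d' -> bcont g a' b' c' d'.
  by move=> [? ? ? [? ? ?]]; apply: bcontP => // x y ? ? _; apply: cg; lra.
apply: (rect_bisection (N := fun a b c d => nm (J g a b c d))) => //=.
  move=> a' b' c' d' [? ? ? [? ? ?]].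
  rewrite (@J_splitV g a' b' c' ((c' + d') / 2)); [|lra|lra| |]; last 2 first.
  - by move=> t ?; rewrite lineVE; apply: cg; lra.
  - by move=> t ?; rewrite lineVE; apply: cg; lra.
  rewrite (@J_splitH g a' ((a' + b') / 2) b' c'); [|lra|lra| |]; last 2 first.
  - by move=> t ?; rewrite lineHE; apply: cg; lra.
  - by move=> t ?; rewrite lineHE; apply: cg; lra.
  rewrite (@J_splitH g a' ((a' + b') / 2) b' _ d'); [|lra|lra| |]; last 2 first.
  - by move=> t ?; rewrite lineHE; apply: cg; lra.
  - by move=> t ?; rewrite lineHE; apply: cg; lra.
  by rewrite (le_trans (nmD _ _))// lerD// nmD.
move=> p q pab qcd e e0; have [D HD] := H _ _ pab qcd.
have e2 : 0 < e / 2 by rewrite divr_gt0.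
have [r r0 Hr] := HD _ e2.
exists (r / 2); first by rewrite divr_gt0.
move=> a' b' c' d' sr pab' qcd' wr hr; have bg := bc _ _ _ _ sr.
have [? ab' ? [? cd' ?]] := sr.
pose z0 : R[i] := p +i* q; pose k := g z0 - D * z0.
pose A z := k + D * z; pose P z := k * z + D * (2^-1 * (z * z)).
have two0 : (2 : R[i]) != 0 by rewrite pnatr_eq0.
have PA z : hasder P z (A z).
  have := hasderD (hasderZ k (hasder_id z))
     (hasderZ D (hasderZ 2^-1 (hasderM (hasder_id z) (hasder_id z)))).
  rewrite (_ : k * 1 + _ = A z)//.
  by rewrite /A; field.
have cA z : contat A z.
  by apply: contatD; [|apply: contatM; [|exact: contat_id]]; exact: contat_cst.
have bA : bcont A a' b' c' d' by apply: bcontP.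
have J0 : J A a' b' c' d' = 0 by apply: (J_ftc (h := P)).
rewrite -[J g _ _ _ _]subr0 -J0 -JB//.
have -> : e * (b' - a' + (d' - c')) ^+ 2 =
  2 * (e / 2 * (b' - a' + (d' - c'))) * (b' - a' + (d' - c')) by field.
apply: J_bound => //.
  rewrite (_ : (fun z => g z - A z) = (fun z => g z + -1 * A z)).
    exact: bcontD bg (bcontZ (-1) bA).
  by apply/funext => z; rewrite mulN1r.
move=> x y xab ycd _.
have dz : nm ((x +i* y) - z0) <= b' - a' + (d' - c') by apply: nm_rect_le.
have := Hr (x +i* y); rewrite -/z0 => /(_ ltac:(apply: le_lt_trans dz _; lra)).
rewrite (_ : g _ - A _ = g (x +i* y) - g z0 - D * ((x +i* y) - z0)); last first.
  by rewrite /A /k; ring.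
by move=> /le_trans; apply; rewrite ler_pM2l.
Qed.

End rectangle_integral.

Ltac side4 := first [constructor 1; lra|constructor 2; lra|constructor 3; lra|constructor 4; lra].

(** * Cauchy's formulas on squares *)

Section cauchy.
Variable R : realType.
Implicit Types (a b c d m r s x y t : R) (f g h : R[i] -> R[i]) (p v w z k : R[i]).

Definition sqbnd s x y :=
  [/\ - s <= x <= s, - s <= y <= s & [|| x == - s, x == s, y == - s | y == s]].

Lemma sqbnd_ge s x y : 0 <= s -> sqbnd s x y -> s <= nm (x +i* y : R[i]).
Proof.
move=> s0 [hx hy /or4P[]/eqP E].
- by apply: le_trans (Re_le_nm _); rewrite /= E normrN ger0_norm.
- by apply: le_trans (Re_le_nm _); rewrite /= E ger0_norm.
- by apply: le_trans (Im_le_nm _); rewrite /= E normrN ger0_norm.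
- by apply: le_trans (Im_le_nm _); rewrite /= E ger0_norm.
Qed.

(** This crude bound by the sum of the coordinates is why later hypotheses on a square of half-side
    [s] are stated on the disc of radius [2 * s]. *)
Lemma sq_le s x y : - s <= x <= s -> - s <= y <= s -> nm (x +i* y : R[i]) <= 2 * s.
Proof.
by move=> hx hy; apply: le_trans (nm_le_ReIm _) _; rewrite /= mulr2n mulrDl !mul1r lerD// ler_norml.
Qed.

Lemma complex_eq0 x y : (x +i* y == 0 :> R[i]) = (x == 0) && (y == 0).
Proof. by rewrite eq_complex. Qed.

Definition Jc s g := J g (- s) s (- s) s.

Definition bc s g := bcont g (- s) s (- s) s.

Lemma bcP s g : 0 <= s -> (forall x y, sqbnd s x y -> contat g (x +i* y)) -> bc s g.
Proof. by move=> s0 H; apply: bcontP; [lra|lra|move=> x y ? ? ?; apply: H]. Qed.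

Lemma Jc_bound s g M : 0 <= s -> bc s g ->
  (forall x y, sqbnd s x y -> nm (g (x +i* y)) <= M) -> nm (Jc s g) <= 8 * s * M.
Proof.
move=> s0 cg H; have -> : 8 * s * M = 2 * M * ((s - - s) + (s - - s)) by ring.
by apply: J_bound => //; [lra|lra|move=> x y *; apply: H].
Qed.

(** By Goursat on the four rectangles around a concentric square, the contour can be shrunk to
    half-side [q]. There the modulus of [g] is at most [e / (8 * q)], on a contour of length
    [8 * q]. *)
Lemma Jc_punctured g s : 0 < s ->
  (forall x y, - s <= x <= s -> - s <= y <= s -> x +i* y != 0 ->
     exists e, hasder g (x +i* y) e) ->
  (forall e, 0 < e -> exists2 r, 0 < r &
     forall z, z != 0 -> nm z < r -> nm (g z) * nm z <= e) ->
  Jc s g = 0.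
Proof.
move=> s0 H lim; apply/eqP; rewrite -nm_eq0; apply/eqP/le_anti; rewrite nm_ge0 andbT.
have cg x y : - s <= x <= s -> - s <= y <= s -> x +i* y != 0 -> contat g (x +i* y).
  by move=> hx hy /(H _ _ hx hy)[e /hasder_contat].
have red r : 0 < r <= s -> Jc s g = Jc r g.
  move=> /andP[r0 rs]; rewrite /Jc.
  have z0 x y : [\/ x < 0, 0 < x, y < 0 | 0 < y] -> x +i* y != 0 :> R[i].
    by rewrite complex_eq0 negb_and; case => h; rewrite ?(lt_eqF h) ?(gt_eqF h) ?orbT.
  rewrite (@J_splitH _ g (- s) (- r) s); [|lra|lra| |]; last 2 first.
  - by move=> t ?; rewrite lineHE; apply: cg; [lra|lra|apply: z0; side4].
  - by move=> t ?; rewrite lineHE; apply: cg; [lra|lra|apply: z0; side4].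
  rewrite (@J_splitH _ g (- r) r s); [|lra|lra| |]; last 2 first.
  - by move=> t ?; rewrite lineHE; apply: cg; [lra|lra|apply: z0; side4].
  - by move=> t ?; rewrite lineHE; apply: cg; [lra|lra|apply: z0; side4].
  rewrite (@J_splitV _ g (- r) r (- s) (- r) s); [|lra|lra| |]; last 2 first.
  - by move=> t ?; rewrite lineVE; apply: cg; [lra|lra|apply: z0; side4].
  - by move=> t ?; rewrite lineVE; apply: cg; [lra|lra|apply: z0; side4].
  rewrite (@J_splitV _ g (- r) r (- r) r s); [|lra|lra| |]; last 2 first.
  - by move=> t ?; rewrite lineVE; apply: cg; [lra|lra|apply: z0; side4].
  - by move=> t ?; rewrite lineVE; apply: cg; [lra|lra|apply: z0; side4].
  have G a b c d : a <= b -> c <= d -> subrect (- s) s (- s) s a b c d ->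
      [\/ b < 0, 0 < a, d < 0 | 0 < c] -> J g a b c d = 0.
    move=> ab cd [? ? ? [? ? ?]] out; apply: goursat => // x y hx hy.
    by apply: H; [lra|lra|apply: z0; case: out => ?; side4].
  have -> : J g (- s) (- r) (- s) s = 0 by apply: G; [lra|lra|repeat split; lra|side4].
  have -> : J g r s (- s) s = 0 by apply: G; [lra|lra|repeat split; lra|side4].
  have -> : J g (- r) r (- s) (- r) = 0 by apply: G; [lra|lra|repeat split; lra|side4].
  have -> : J g (- r) r r s = 0 by apply: G; [lra|lra|repeat split; lra|side4].
  by rewrite add0r addr0 add0r addr0.
apply/ler_addgt0Pr => e e0; rewrite add0r.
have [r r0 Hr] := lim (e / 8) ltac:(by rewrite divr_gt0).
(* The points of this square have modulus at most [2 * q], hence less than [r]. *)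
pose q := Num.min s (r / 4).
have q0 : 0 < q by rewrite lt_min s0 divr_gt0.
have qs : q <= s by rewrite ge_min lexx.
have qr : q <= r / 4 by rewrite ge_min lexx orbT.
rewrite (red q) ?q0//.
have nz x y : sqbnd q x y -> 0 < nm (x +i* y : R[i]).
  by move=> /(sqbnd_ge (ltW q0)); apply: lt_le_trans.
have -> : e = 8 * q * (e / 8 / q) by field; rewrite gt_eqF.
apply: Jc_bound; first exact: ltW.
  apply: bcP; first exact: ltW.
  move=> x y sq; have [? ? _] := sq; apply: cg; [lra|lra|].
  by rewrite -nm_gt0 nz.
move=> x y sq; have [hx hy _] := sq.
rewrite ler_pdivlMr//; have := Hr (x +i* y); rewrite -nm_gt0 => /(_ (nz _ _ sq)).
move=> /(_ ltac:(apply: le_lt_trans (sq_le hx hy) _; lra)); apply: le_trans.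
by rewrite ler_wpM2l ?nm_ge0// sqbnd_ge// ltW.
Qed.

(* This plays the role of [2 i pi], of which only [4 <= nm (cc s)] is needed. *)
Definition cc s : R[i] := Jc s (fun z => z^-1).

Lemma bcV s : 0 < s -> bc s (fun z => z^-1).
Proof.
move=> s0; apply: bcP; first exact: ltW.
move=> x y sq; apply: contatV (contat_id _).
by rewrite -nm_gt0 (lt_le_trans s0)// sqbnd_ge// ltW.
Qed.

Lemma bcV2 s : 0 < s -> bc s (fun z => z^-1 * z^-1).
Proof.
move=> s0; have [? ? ? ?] := bcV s0.
by split=> t tab; apply: contatM; auto.
Qed.

Lemma Jc_V2 s : 0 < s -> Jc s (fun z => z^-1 * z^-1) = 0.
Proof.
move=> s0; apply: (J_ftc (h := fun z => - z^-1)); [lra|lra|exact: bcV2|].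
move=> x y hx hy sq.
have nz : (x +i* y : R[i]) != 0.
  by rewrite -nm_gt0 (lt_le_trans s0)// sqbnd_ge// ltW.
have := hasderN (hasderV (f := id) nz (hasder_id _)); congr hasder.
by rewrite /= mulNr opprK mul1r expr2 invfM.
Qed.

Lemma fint_ge (u : R -> R) a b (M : R) : a <= b -> {within `[a, b], continuous u} ->
  (forall t, a <= t <= b -> M <= u t) -> M * (b - a) <= fint u a b.
Proof.
move=> ab cu H; rewrite -fint_cst//; apply: fint_le => //; by move=> t; exact: cvg_cst.
Qed.

(** Each side contributes at least 1 to the imaginary part: there the relevant component of the
    inverse has absolute value [s / (s ^+ 2 + t ^+ 2)], at least [(2 * s)^-1], and the side has
    length [2 * s]. *)
Lemma cc_ge4 s : 0 < s -> 4 <= nm (cc s).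
Proof.
move=> s0; have s2 : 0 < 2 * s by lra.
have [c1 c2 c3 c4] := bcV s0.
have imV x y : Im ((x +i* y : R[i])^-1) = - y / (x ^+ 2 + y ^+ 2) by rewrite /= mulNr.
have reV x y : Re ((x +i* y : R[i])^-1) = x / (x ^+ 2 + y ^+ 2) by [].
have key x y : x ^+ 2 = s ^+ 2 -> - s <= y <= s -> (2 * s)^-1 <= s / (x ^+ 2 + y ^+ 2).
  move=> -> hy; have p : 0 < s ^+ 2 + y ^+ 2.
    by rewrite ltr_pwDl ?sqr_ge0// exprn_gt0.
  rewrite ler_pdivlMr// -[leRHS](mulKf (lt0r_neq0 s2)) ler_pM2l ?invr_gt0//.
  by nra.
have half (u : R -> R) : {within `[- s, s], continuous u} ->
   (forall t, - s <= t <= s -> (2 * s)^-1 <= u t) -> 1 <= fint u (- s) s.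
  move=> cu H; have ss : - s <= s by lra.
  have := fint_ge ss cu H.
  suff -> : (2 * s)^-1 * (s - - s) = 1 by [].
  by field; rewrite gt_eqF.
have neg (u : R -> R) : {within `[- s, s], continuous u} ->
   (forall t, - s <= t <= s -> u t <= - (2 * s)^-1) -> fint u (- s) s <= - 1.
  move=> cu H; rewrite -lerN2 opprK -mulN1r -fintZ//; apply: half.
    by move=> t; apply: cvgM; [exact: cvg_cst|exact: cu].
  by move=> t /H; rewrite mulN1r lerNr.
have i1 : 1 <= Im (seg (fun z => z^-1) ('i * (- s)%:C) 1 (- s) s).
  rewrite Im_segH; apply: half; first exact: scont_Im c1.
  move=> t ht; cbv beta; rewrite lineHE imV opprK addrC; apply: key => //; ring.
have i2 : 1 <= Im (seg (fun z => z^-1) s%:C 'i (- s) s).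
  rewrite Im_segV; apply: half; first exact: scont_Re c2.
  by move=> t ht; cbv beta; rewrite lineVE reV; apply: key.
have i3 : Im (seg (fun z => z^-1) ('i * s%:C) 1 (- s) s) <= -1.
  rewrite Im_segH; apply: neg; first exact: scont_Im c3.
  move=> t ht; cbv beta; rewrite lineHE imV mulNr lerN2 addrC; exact: key.
have i4 : Im (seg (fun z => z^-1) (- s)%:C 'i (- s) s) <= -1.
  rewrite Im_segV; apply: neg; first exact: scont_Re c4.
  move=> t ht; cbv beta; rewrite lineVE reV mulNr lerN2; apply: key => //; ring.
apply: le_trans (le_trans (ler_norm _) (Im_le_nm _)); rewrite /cc /Jc /J.
move: i1 i2 i3 i4; case: (seg _ _ _ _ _) => ? ?; case: (seg _ _ _ _ _) => ? ?.
case: (seg _ _ _ _ _) => ? ?; case: (seg _ _ _ _ _) => ? ? /=; lra.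
Qed.

Lemma cc_neq0 s : 0 < s -> cc s != 0.
Proof. by move=> s0; rewrite -nm_gt0 (lt_le_trans _ (cc_ge4 s0)). Qed.

Lemma hasder_shift f w z e : hasder f (w + z) e -> hasder (fun z => f (w + z)) z e.
Proof.
move=> H; have := hasder_comp (hasderD (hasder_cst w z) (hasder_id z)) H.
by rewrite add0r mulr1.
Qed.

Section formula.
Variables (f df : R[i] -> R[i]) (w : R[i]) (s : R).
Hypothesis s0 : 0 < s.
Hypothesis fD : forall z, nm z <= 2 * s -> hasder f (w + z) (df (w + z)).

Let shiftD x y : - s <= x <= s -> - s <= y <= s ->
  hasder (fun z => f (w + z)) (x +i* y) (df (w + (x +i* y))).
Proof. by move=> hx hy; apply: hasder_shift; apply: fD; exact: sq_le. Qed.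

Let D0 : hasder f w (df w).
Proof. by have := @fD 0; rewrite addr0 nm0; apply; rewrite mulr_ge0 ?ltW. Qed.

Let bcF : bc s (fun z => f (w + z)).
Proof.
by apply: bcP; [exact: ltW|move=> x y [hx hy _]; exact: hasder_contat (shiftD hx hy)].
Qed.

Let bcM g h : bc s g -> bc s h -> bc s (fun z => g z * h z).
Proof. by move=> [? ? ? ?] [? ? ? ?]; split=> t tab; apply: contatM; auto. Qed.

(** After subtraction of [f w / z], the integrand times [z] is [f (w + z) - f w], which tends to 0,
    so [Jc_punctured] applies; the subtracted term integrates to [f w * cc s] by definition of
    [cc]. *)
Lemma cauchy0 : Jc s (fun z => z^-1 * f (w + z)) = cc s * f w.
Proof.
have : Jc s (fun z => z^-1 * f (w + z) - f w * z^-1) = 0.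
  apply: Jc_punctured => //.
    move=> x y hx hy nz; eexists.
    apply: hasderB; first exact: hasderM (hasderV nz (hasder_id _)) (shiftD hx hy).
    exact: hasderZ (hasderV nz (hasder_id _)).
  move=> e e0; have [r r0 Hr] := hasder_contat D0 e0.
  exists r => // z nz zr; rewrite -nmM.
  have -> : (z^-1 * f (w + z) - f w * z^-1) * z = f (w + z) - f w by field; rewrite nz.
  have := Hr (w + z); rewrite (_ : w + z - w = z)//; last by rewrite addrC addKr.
  by move=> /(_ zr)/ltW.
rewrite /Jc JB; [|exact: bcM (bcV s0) bcF|exact: bcontZ (bcV s0)].
rewrite JZ; last exact: bcV.
by move/eqP; rewrite subr_eq0 => /eqP ->; rewrite mulrC.
Qed.

(** Two terms are subtracted: [f w / z ^ 2], which has a primitive and contributes nothing, and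
    [df w / z], which produces the result. What is left, times [z], is the first-order remainder of
    [f] divided by [z], so differentiability of [f] suffices and nothing is asked of [df]. *)
Lemma cauchy1 : Jc s (fun z => (z^-1 * z^-1) * f (w + z)) = cc s * df w.
Proof.
have : Jc s (fun z => ((z^-1 * z^-1) * f (w + z) - f w * (z^-1 * z^-1)) - df w * z^-1) = 0.
  apply: Jc_punctured => //.
    move=> x y hx hy nz; eexists.
    have V := hasderV nz (hasder_id _).
    apply: hasderB; last exact: hasderZ V.
    apply: hasderB; first exact: hasderM (hasderM V V) (shiftD hx hy).
    exact: hasderZ (hasderM V V).
  move=> e e0; have [r r0 Hr] := D0 e0.
  exists r => // z nz zr; rewrite -nmM.
  have -> : ((z^-1 * z^-1) * f (w + z) - f w * (z^-1 * z^-1) - df w * z^-1) * z =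
     (f (w + z) - f w - df w * z) / z by field; rewrite nz.
  have := Hr (w + z); rewrite (_ : w + z - w = z)//; last by rewrite addrC addKr.
  by move=> /(_ zr); rewrite nmM nmV ler_pdivrMr// nm_gt0.
have b2 := bcV2 s0; have b1 := bcM b2 bcF; have b3 := bcontZ (f w) b2.
have b4 := bcontZ (df w) (bcV s0).
rewrite /Jc JB//; last first.
  rewrite (_ : (fun z => _ - _) = (fun z => z^-1 * z^-1 * f (w + z) + (-1) * (f w * (z^-1 * z^-1)))).
    exact: bcontD b1 (bcontZ _ b3).
  by apply/funext => z; rewrite mulN1r.
rewrite JB// JZ// JZ; last exact: bcV.
rewrite -!/(Jc _ _) Jc_V2// mulr0 subr0 => /eqP; rewrite subr_eq0 => /eqP ->.
by rewrite mulrC.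
Qed.

(** The contour has length [8 * s], the kernel is at most [s ^- 2] on it, and [nm (cc s)] is at
    least 4. *)
Lemma cauchy_est M : (forall z, nm z <= 2 * s -> nm (f (w + z)) <= M) ->
  nm (df w) <= 2 * M / s.
Proof.
move=> H; have : nm (cc s * df w) <= 8 * s * (M / s ^+ 2).
  rewrite -cauchy1; apply: Jc_bound; [exact: ltW|exact: bcM (bcV2 s0) bcF|].
  move=> x y sq; have [hx hy _] := sq; have g := sqbnd_ge (ltW s0) sq.
  have nz : 0 < nm (x +i* y : R[i]) by apply: lt_le_trans g.
  rewrite !nmM !nmV mulrC; apply: ler_pM; rewrite ?nm_ge0// ?mulr_ge0 ?invr_ge0 ?nm_ge0//.
    exact: H (sq_le hx hy).
  by rewrite -invfM lef_pV2 ?posrE ?mulr_gt0 ?exprn_gt0// expr2 ler_pM// ltW.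
have -> : 8 * s * (M / s ^+ 2) = 4 * (2 * M / s) by field; rewrite gt_eqF.
rewrite nmM => le1; rewrite -(@ler_pM2l _ 4)// (le_trans _ le1)//.
by rewrite ler_wpM2r ?nm_ge0// cc_ge4.
Qed.

End formula.

End cauchy.

(** * The derivative of a holomorphic function is holomorphic *)

Section holomorphic_derivative.
Variable R : realType.
Implicit Types (a b c d m r s x y t M L : R) (f g h df : R[i] -> R[i]) (p v w z k : R[i]).

(** Once rotated by [unitdir], the increment equals its real part, to which the real mean value
    theorem applies along the segment. *)
Lemma mean_value_ineq f df p q L :
  (forall t, 0 <= t <= 1 -> hasder f (line p (q - p) t) (df (line p (q - p) t)) /\
     nm (df (line p (q - p) t)) <= L) ->
  nm (f q - f p) <= L * nm (q - p).
Proof.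
move=> H; pose k := unitdir (f q - f p); pose F z := k * f z.
have dF t : 0 <= t <= 1 -> hasder F (line p (q - p) t) (k * df (line p (q - p) t)).
  by move=> /H[h _]; exact: hasderZ.
have D t : 0 <= t <= 1 -> is_derive t 1 (fun t => Re (F (line p (q - p) t)))
    (Re ((q - p) * (k * df (line p (q - p) t)))).
  by move=> /dF /is_derive_Re_line.
have [t|  |c] := @MVT_segment R (fun t => Re (F (line p (q - p) t)))
    (fun t => Re ((q - p) * (k * df (line p (q - p) t)))) 0 1 ler01.
- by rewrite in_itv /= => /andP[/ltW t0 /ltW t1]; apply: D; rewrite t0.
- by apply: (scont_Re (g := F)) => t /dF; exact: hasder_contat.
rewrite in_itv /= => c01.
have -> : line p (q - p) 1 = q by rewrite /line mulr1 addrC subrK.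
have -> : line p (q - p) 0 = p by rewrite /line mulr0 addr0.
have -> : Re (F q) - Re (F p) = nm (f q - f p).
  transitivity (Re (k * (f q - f p))); last by rewrite unitdirM.
  by rewrite mulrBr /F; case: (k * f q) => ? ?; case: (k * f p).
rewrite subr0 mulr1 => ->; rewrite (le_trans (ler_norm _))// (le_trans (Re_le_nm _))//.
rewrite !nmM nm_unitdir mul1r mulrC ler_wpM2r ?nm_ge0//.
by have [] := H _ c01.
Qed.

Lemma line_ball w0 p q t r : 0 <= t <= 1 -> nm (p - w0) < r -> nm (q - w0) < r ->
  nm (line p (q - p) t - w0) < r.
Proof.
move=> /andP[t0 t1] hp hq.
have -> : line p (q - p) t - w0 = (1 - t)%:C * (p - w0) + t%:C * (q - w0).
  by rewrite /line rmorphB /=; ring.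
apply: le_lt_trans (nmD _ _) _; rewrite !nmM !nmR !ger0_norm ?subr_ge0//.
have [->|tn] := eqVneq t 0; first by rewrite subr0 mul1r mul0r addr0.
have tp : 0 < t by rewrite lt0r tn.
have -> : r = (1 - t) * r + t * r by ring.
by apply: ler_ltD; [rewrite ler_wpM2l ?subr_ge0// ltW|rewrite ltr_pM2l].
Qed.

Lemma lip_ball f df w0 r L p q :
  (forall z, nm (z - w0) < r -> hasder f z (df z) /\ nm (df z) <= L) ->
  nm (p - w0) < r -> nm (q - w0) < r -> nm (f q - f p) <= L * nm (q - p).
Proof.
move=> H hp hq; apply: (@mean_value_ineq f df) => t t01.
by apply: H; exact: line_ball.
Qed.

Lemma der_bound f df w0 r M s z : 0 < s -> nm (z - w0) + 2 * s < r ->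
  (forall z, nm (z - w0) < r -> hasder f z (df z) /\ nm (f z) <= M) ->
  nm (df z) <= 2 * M / s.
Proof.
move=> s0 zr H.
have inb u : nm u <= 2 * s -> nm (z + u - w0) < r.
  move=> hu; apply: le_lt_trans zr; rewrite addrAC (le_trans (nmD _ _))// lerD2l//.
apply: (@cauchy_est _ f df z s) => // u /inb /H[]//.
Qed.

(** Cauchy's estimate for the function [f (k + z) - f z] with [k = q - p]: it is bounded by
    [L * nm k], and its derivative at [p] is [df q - df p]. Thus [df] is Lipschitz before anything
    is known about a second derivative. *)
Lemma der_lip f df w0 r L s p q : 0 < s ->
  (forall z, nm (z - w0) < r -> hasder f z (df z) /\ nm (df z) <= L) ->
  nm (p - w0) + 2 * s + nm (q - p) < r ->
  nm (df q - df p) <= 2 * L / s * nm (q - p).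
Proof.
move=> s0 H hr; pose k := q - p.
have E : q = p + k by rewrite /k addrC subrK.
have -> : 2 * L / s * nm (q - p) = 2 * (L * nm k) / s by rewrite /k; lra.
have inb u : nm u <= 2 * s -> nm (p + u - w0) < r /\ nm (k + (p + u) - w0) < r.
  move=> hu; have h1 : nm (p + u - w0) <= nm (p - w0) + nm u by rewrite addrAC nmD.
  have h2 : nm (k + (p + u) - w0) <= nm k + nm (p + u - w0) by rewrite -addrA nmD.
  by have := nm_ge0 k; split; [|rewrite -/k in hr]; rewrite -?/k in hr *; lra.
have := @cauchy_est _ (fun z => f (k + z) - f z) (fun z => df (k + z) - df z) p s s0.
rewrite {1}(addrC k p) -E; apply.
  move=> u /inb[h1 h2]; apply: hasderB; last by have [] := H _ h1.
  by apply: hasder_shift; have [] := H _ h2.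
move=> u /inb[h1 h2].
have := lip_ball H h1 h2; rewrite (_ : k + (p + u) - (p + u) = k)//.
by rewrite addrK.
Qed.

(** [cauchy1] is written at the centres [w0 + k] and [w0] over squares of the same size, so the
    increment of [df] is an integral of increments of [f] against a fixed kernel. Subtracting [k]
    times the integral of [df] leaves the second-order remainder of [f], of size [nm k ^ 2]. *)
Lemma der_hasder f df w0 r : 0 < r ->
  (forall z, nm (z - w0) < r -> hasder f z (df z)) -> exists e, hasder df w0 e.
Proof.
move=> r0 fD.
have [r1 r10 Hr1] := hasder_contat (fD w0 ltac:(by rewrite subrr nm0)) ltr01.
(* Every Cauchy estimate uses up some radius: [f] is bounded within [q], [df] within [q / 2], and
   [df] is Lipschitz around the points within [q / 4]. *)
pose q := Num.min r r1; have q0 : 0 < q by rewrite lt_min r0.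
pose M := nm (f w0) + 1.
have fM z : nm (z - w0) < q -> hasder f z (df z) /\ nm (f z) <= M.
  rewrite lt_min => /andP[/fD ? /Hr1 /ltW h]; split => //.
  by rewrite -[f z](subrK (f w0)) (le_trans (nmD _ _))// addrC lerD2l.
pose L := 2 * M / (q / 8).
have q8 : 0 < q / 8 by lra.
have dL z : nm (z - w0) < q / 2 -> hasder f z (df z) /\ nm (df z) <= L.
  move=> hz; split; first by have [] := fM z ltac:(lra).
  by apply: (@der_bound f df w0 q M (q / 8)) => //; lra.
pose K := 2 * L / (q / 32).
have q32 : 0 < q / 32 by lra.
have M0 : 0 <= M by rewrite addr_ge0 ?nm_ge0.
have L0 : 0 <= L by apply: divr_ge0; [apply: mulr_ge0|exact: ltW].
have K0 : 0 <= K by apply: divr_ge0; [apply: mulr_ge0|exact: ltW].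
have dK (y z : R[i]) : nm (y - w0) < q / 4 -> nm (z - y) < q / 8 ->
    nm (df z - df y) <= K * nm (z - y).
  by move=> hy hz; apply: (@der_lip f df w0 (q / 2)) => //; lra.
(* The quadratic remainder needs only the Lipschitz bound [dK]: [f u - df z * u] has derivative
   [df u - df z], small on the segment. *)
have taylor z k : nm (z - w0) < q / 4 -> nm k < q / 8 ->
    nm (f (k + z) - f z - df z * k) <= K * nm k * nm k.
  move=> hz hk; pose g u := f u - df z * u.
  have -> : f (k + z) - f z - df z * k = g (k + z) - g z by rewrite /g; ring.
  rewrite -[X in _ <= _ * nm X](addrK z k).
  apply: (@mean_value_ineq g (fun u => df u - df z)) => t t01.
  set u := line _ _ _.
  have uz : u - z = k * t%:C by rewrite /u /line addrK addrC addKr.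
  have uz' : nm (u - z) <= nm k.
    rewrite uz nmM nmR ger0_norm; last by case/andP: t01.
    by rewrite ler_piMr ?nm_ge0//; case/andP: t01.
  split.
    have -> : df u - df z = df u - df z * 1 by rewrite mulr1.
    apply: hasderB; last exact: hasderZ (hasder_id _).
    have : nm (u - w0) <= nm (u - z) + nm (z - w0) by apply: nm_tri.
    by move=> ?; have [] := dL u ltac:(lra).
  by rewrite (le_trans (dK z u hz _))//; [lra|rewrite ler_wpM2l].
pose s := q / 16; have s0 : 0 < s by rewrite /s; lra.
pose c := cc s; have c0 : c != 0 by exact: cc_neq0.
pose V z : R[i] := z^-1 * z^-1.
(* The value that [cauchy1], read for [df] in place of [f], predicts for the second derivative. *)
pose e := Jc s (fun z => V z * df (w0 + z)) / c.
have inb u : nm u <= 2 * s -> nm (w0 + u - w0) < q / 4.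
  by rewrite addrC addKr /s => ?; lra.
have bM g h : bc s g -> bc s h -> bc s (fun z => g z * h z).
  by move=> [? ? ? ?] [? ? ? ?]; split=> t tab; apply: contatM; auto.
have bV : bc s V by exact: bcV2.
have bdf : bc s (fun z => df (w0 + z)).
  apply: bcP; first exact: ltW.
  move=> x y [hx hy _]; have hz := inb _ (sq_le hx hy).
  move=> eps eps0; exists (Num.min (q / 8) (eps / (K + 1))).
    by rewrite lt_min q8 divr_gt0// ltr_wpDl.
  move=> u; rewrite lt_min => /andP[u1 u2].
  have E : w0 + u - (w0 + (x +i* y)) = u - (x +i* y) by rewrite opprD addrACA subrr add0r.
  have := dK _ (w0 + u) hz; rewrite E => /(_ u1)/le_lt_trans; apply.
  have K1 : 0 < K + 1 by lra.
  rewrite ltr_pdivlMr// in u2; apply: le_lt_trans u2; rewrite mulrC ler_wpM2l ?nm_ge0//.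
  by lra.
have bf k : nm k < q / 8 -> bc s (fun z => f (w0 + k + z)).
  move=> hk; apply: bcP; first exact: ltW.
  move=> x y [hx hy _]; have hz := inb _ (sq_le hx hy).
  apply: (hasder_contat (d := df (w0 + k + (x +i* y)))); apply: hasder_shift.
  have : nm (w0 + k + (x +i* y) - w0) <= nm k + nm (w0 + (x +i* y) - w0).
    by rewrite (_ : _ - _ = k + (w0 + (x +i* y) - w0)) ?nmD//; ring.
  by move=> ?; have [] := dL (w0 + k + (x +i* y)) ltac:(lra).
have cau k : nm k < q / 8 -> Jc s (fun z => V z * f (w0 + k + z)) = c * df (w0 + k).
  move=> hk; apply: cauchy1 => // z hz; have hz' := inb _ hz.
  have : nm (w0 + k + z - w0) <= nm k + nm (w0 + z - w0).
    by rewrite (_ : _ - _ = k + (w0 + z - w0)) ?nmD//; ring.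
  by move=> ?; have [] := dL (w0 + k + z) ltac:(lra).
pose K' := 2 * K / s.
have K'0 : 0 <= K' by apply: divr_ge0; [apply: mulr_ge0|exact: ltW].
have main k : nm k < q / 8 -> nm (df (w0 + k) - df w0 - e * k) <= K' * nm k * nm k.
  move=> hk.
  have z0 : nm (0 : R[i]) < q / 8 by rewrite nm0.
  have E : c * (df (w0 + k) - df w0 - e * k) =
     Jc s (fun z => (V z * f (w0 + k + z) - V z * f (w0 + 0 + z)) - k * (V z * df (w0 + z))).
    rewrite /Jc JB; last 2 first.
    - rewrite (_ : (fun z => _ - _) = (fun z => V z * f (w0 + k + z) + (-1) * (V z * f (w0 + 0 + z)))).
        exact: bcontD (bM _ _ bV (bf _ hk)) (bcontZ _ (bM _ _ bV (bf _ z0))).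
      by apply/funext => z; rewrite mulN1r.
    - exact: bcontZ (bM _ _ bV bdf).
    rewrite JB; [|exact: bM _ _ bV (bf _ hk)|exact: bM _ _ bV (bf _ z0)].
    rewrite JZ; last exact: bM _ _ bV bdf.
    rewrite -!/(Jc _ _) cau// cau// addr0 /e; field.
    by rewrite c0.
  have : nm (c * (df (w0 + k) - df w0 - e * k)) <= 8 * s * (K * nm k * nm k / s ^+ 2).
    rewrite E; apply: Jc_bound; first exact: ltW.
      rewrite (_ : (fun z => _ - _ - _) = (fun z => V z * f (w0 + k + z) + (-1) * (V z * f (w0 + 0 + z)) + (-1) * (k * (V z * df (w0 + z))))).
        apply: bcontD (bcontZ _ (bcontZ _ (bM _ _ bV bdf))).
        exact: bcontD (bM _ _ bV (bf _ hk)) (bcontZ _ (bM _ _ bV (bf _ z0))).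
      by apply/funext => z; rewrite !mulN1r.
    move=> x y sq; have [hx hy _] := sq; have hz := inb _ (sq_le hx hy).
    have g := sqbnd_ge (ltW s0) sq; set z := x +i* y in hz g *.
    have -> : V z * f (w0 + k + z) - V z * f (w0 + 0 + z) - k * (V z * df (w0 + z)) =
       V z * (f (k + (w0 + z)) - f (w0 + z) - df (w0 + z) * k).
      by rewrite addr0 (_ : k + (w0 + z) = w0 + k + z); ring.
    have nz : 0 < nm z by apply: lt_le_trans g.
    rewrite nmM mulrC ler_pM ?nm_ge0//; first exact: taylor.
    rewrite !nmM !nmV -invfM lef_pV2 ?posrE ?mulr_gt0 ?exprn_gt0// expr2.
    by rewrite ler_pM// ltW.
  have -> : 8 * s * (K * nm k * nm k / s ^+ 2) = 4 * (K' * nm k * nm k).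
    by rewrite /K'; field; rewrite gt_eqF.
  rewrite nmM => le1; rewrite -(@ler_pM2l _ 4)// (le_trans _ le1)//.
  by rewrite ler_wpM2r ?nm_ge0// cc_ge4.
exists e => eps eps0; exists (Num.min (q / 8) (eps / (K' + 1))).
  by rewrite lt_min q8 divr_gt0// ltr_wpDl.
move=> u; rewrite lt_min => /andP[u1 u2].
have := main _ u1; rewrite (_ : w0 + (u - w0) = u); last by rewrite addrC subrK.
move=> /le_trans; apply; rewrite ler_wpM2r ?nm_ge0//.
have K1 : 0 < K' + 1 by lra.
rewrite ltr_pdivlMr// in u2; apply: le_trans (ltW u2); rewrite mulrC ler_wpM2l ?nm_ge0//.
by lra.
Qed.

End holomorphic_derivative.

(** * Area integrals and sub-mean values *)

Section plane_measure.
Variable R : realType.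
Notation mu := (@lebesgue_measure R).
Notation mu2 := (mu \x mu)%E.
Implicit Types (A U : set (R * R)) (p q : R * R).

Definition sbox p (e : R) : set (R * R) := [set q | `|q.1 - p.1| < e /\ `|q.2 - p.2| < e].

Definition open2 A := forall p, A p -> exists2 e, 0 < e & sbox p e `<=` A.

(** An open set is the union of the rational boxes that it contains. They are enumerated through
    [unpickle], with the empty set at every code that does not yield such a box. *)
Lemma open2_measurable A : open2 A -> measurable A.
Proof.
move=> oA.
pose box (q : rat * rat * rat * rat) : set (R * R) :=
  `](ratr q.1.1.1), (ratr q.1.1.2)[ `*` `](ratr q.1.2), (ratr q.2)[.
pose F (n : nat) : set (R * R) := if unpickle n is Some q then
  if `[< box q `<=` A >] then box q else set0 else set0.
have -> : A = \bigcup_n F n.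
  apply/seteqP; split=> [p Ap|p [n _]]; last first.
    by rewrite /F; case: unpickle => // q; case: asboolP => // h /h.
  have [e e0 He] := oA _ Ap.
  have lt1 (x : R) : x - e < x by rewrite ltrBlDr ltrDl.
  have lt2 (x : R) : x < x + e by rewrite ltrDl.
  have [a1 ha1] := rat_in_itvoo (lt1 p.1); have [b1 hb1] := rat_in_itvoo (lt2 p.1).
  have [a2 ha2] := rat_in_itvoo (lt1 p.2); have [b2 hb2] := rat_in_itvoo (lt2 p.2).
  move: ha1 hb1 ha2 hb2; rewrite !in_itv /= => /andP[? ?] /andP[? ?] /andP[? ?] /andP[? ?].
  have [q pq sub] : exists2 q, box q p & box q `<=` A.
    exists (a1, b1, a2, b2); rewrite /box /=; first by rewrite !in_itv /=; split; apply/andP.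
    move=> q; rewrite /= !in_itv /= => -[/andP[? ?] /andP[? ?]].
    by apply: He; split; rewrite ltr_norml; lra.
  by exists (pickle q); [exact: I|rewrite /F pickleK asboolT].
apply: bigcupT_measurable => n; rewrite /F.
case: unpickle => [q|]; last exact: measurable0.
by case: ifP => _; [exact: measurableX|exact: measurable0].
Qed.

Definition cont2 (u : R * R -> R) p := forall e, 0 < e -> exists2 d, 0 < d &
  forall q, sbox p d q -> `|u q - u p| < e.

Lemma cont2_measurable A (u : R * R -> R) : open2 A -> (forall p, A p -> cont2 u p) ->
  measurable_fun A u.
Proof.
move=> oA cu mA; apply: (measurability _ (RGenOInfty.measurableE R)) => //.
move=> /= _ [_ [x ->] <-]; apply: open2_measurable => p [Ap]; rewrite /= in_itv /= andbT => xp.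
have [e e0 He] := oA _ Ap; have [d d0 Hd] := cu _ Ap (u p - x) ltac:(by rewrite subr_gt0).
exists (Num.min e d); first by rewrite lt_min e0.
move=> q; rewrite /sbox /= !lt_min => -[/andP[? ?] /andP[? ?]]; split; first exact: He.
rewrite in_itv /= andbT.
have : `|u q - u p| < u p - x by apply: Hd.
by rewrite ltr_norml => /andP[? _]; lra.
Qed.

Lemma lebesgue_translation (c : R) (A : set R) : measurable A ->
  pushforward mu ((fun x => c + x) : _ -> measurableTypeR R) A = mu A.
Proof.
move=> mA; have mt : measurable_fun setT ((fun x => c + x) : R -> measurableTypeR R).
  by apply: measurable_funD.
apply/esym/lebesgue_measure_unique => //= _ [[a b]] _ <-.
rewrite /pushforward /=.
have -> : (fun x => c + x) @^-1` `]a, b] = `](a - c), (b - c)]%classic.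
  by apply/seteqP; split=> x; rewrite /= !in_itv /= => /andP[? ?]; apply/andP; split; lra.
rewrite !lebesgue_measure_itv/= !lte_fin ltrD2r.
by rewrite -!EFinB opprB addrA subrK.
Qed.

Lemma integral_translation (c : R) (f : R -> \bar R) : measurable_fun setT f ->
  (forall x, 0 <= f x)%E -> (\int[mu]_x f (c + x)%R = \int[mu]_x f x)%E.
Proof.
move=> mf f0; have mt : measurable_fun setT ((fun x => c + x) : R -> measurableTypeR R).
  by apply: measurable_funD.
transitivity (\int[pushforward mu ((fun x => c + x)%R : _ -> measurableTypeR R)]_y f y)%E.
  by rewrite ge0_integral_pushforward//= preimage_setT.
by apply: eq_measure_integral => //= A mA AS; exact: lebesgue_translation.
Qed.

Lemma integral_oppr (f : R -> \bar R) : measurable_fun setT f ->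
  (forall x, 0 <= f x)%E -> (\int[mu]_x f (- x)%R = \int[mu]_x f x)%E.
Proof.
move=> mf f0.
transitivity (\int[pushforward mu (-%R : _ -> measurableTypeR R)]_y f y)%E.
  by rewrite ge0_integral_pushforward//= preimage_setT.
by apply: eq_measure_integral => //= A mA AS; exact: lebesgue_measureN.
Qed.

Lemma integral2_translation (c : R * R) (f : R * R -> \bar R) : measurable_fun setT f ->
  (forall p, 0 <= f p)%E ->
  (\int[mu2]_p f (c.1 + p.1, c.2 + p.2)%R = \int[mu2]_p f p)%E.
Proof.
move=> mf f0.
have mt : measurable_fun setT (fun p : R * R => (c.1 + p.1, c.2 + p.2)%R : R * R).
  by apply: measurable_fun_pair; apply: measurable_funD.
rewrite fubini_tonelli1//; last exact: measurableT_comp.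
rewrite [RHS](fubini_tonelli1 (m1 := mu) (m2 := mu) f mf f0).
have mF := measurable_fun_fubini_tonelli_F (m2 := mu) f mf f0.
rewrite -(@integral_translation c.1 _ mF); last by move=> x; apply: integral_ge0.
have mx (x : R) : measurable_fun setT (fun y => f (x, y)).
  exact: (measurableT_comp mf (pair1_measurable x)).
by apply: eq_integral => x _; rewrite /fubini_F /= -[RHS](@integral_translation c.2).
Qed.

Definition Z p : R[i] := p.1 +i* p.2.

Lemma ZB p q : nm (Z q - Z p) <= `|q.1 - p.1| + `|q.2 - p.2|.
Proof. exact: nm_le_ReIm. Qed.

Lemma contat_cont2 (k : R[i] -> R) f p : (forall z w, `|k z - k w| <= nm (z - w)) ->
  contat f (Z p) -> cont2 (fun q => k (f (Z q))) p.
Proof.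
move=> kl cf e e0; have [d d0 H] := cf _ e0; exists (d / 2); first by rewrite divr_gt0.
move=> q [h1 h2]; apply: le_lt_trans (kl _ _) _; apply: H.
by apply: le_lt_trans (ZB p q) _; lra.
Qed.

Lemma open2_nm (w : R[i]) (r : R) : open2 [set p | nm (Z p - w) < r].
Proof.
move=> p /= pr; exists ((r - nm (Z p - w)) / 2); first by lra.
move=> q [h1 h2] /=; have := ZB p q; have := nm_tri (Z p) (Z q) w; lra.
Qed.

Lemma measurable_nm (A : set (R * R)) f : open2 A -> (forall p, A p -> contat f (Z p)) ->
  measurable_fun A (fun p => nm (f (Z p))).
Proof.
move=> oA H; apply: cont2_measurable => // p Ap.
by apply: (contat_cont2 (k := fun z => nm z)); [exact: nm_lip|exact: H].
Qed.

Lemma measurable_nm2 (A : set (R * R)) f : open2 A -> (forall p, A p -> contat f (Z p)) ->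
  measurable_fun A (fun p => (nm (f (Z p)) ^+ 2)%:E).
Proof.
by move=> oA H; apply/measurable_EFinP; apply: measurable_funX; exact: measurable_nm.
Qed.

End plane_measure.

Lemma within_sqr (R : realType) (a b : R) (k : R -> R) : {within `[a, b], continuous k} ->
  {within `[a, b], continuous (fun t => k t ^+ 2)}.
Proof.
move=> ck; rewrite (_ : (fun t => k t ^+ 2) = (fun t => k t * k t)).
  by move=> t; apply: cvgM; exact: ck.
by apply/funext => t; rewrite expr2.
Qed.

(** * Sub-mean value inequality for the squared modulus *)

Section submean.
Variable R : realType.
Notation mu := (@lebesgue_measure R).
Notation mu2 := (mu \x mu)%E.
Variables (h dh : R[i] -> R[i]) (w : R[i]) (r : R).
Hypothesis r0 : 0 < r.
Hypothesis hD : forall z, nm z <= 2 * r -> hasder h (w + z) (dh (w + z)).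
Let N := nm (h w).
Let u z : R := nm (h (w + z)) ^+ 2.

(** On the contour [s / nm z <= 1], and [N * x <= N ^+ 2 / 4 + x ^+ 2] for [x] the modulus of [h].
    This passes from the modulus, as in Cauchy's formula, to its square. *)
Let side s p v : 0 < s <= r -> nm v = 1 -> scont (fun z => h (w + z)) p v (- s) s ->
  (forall t, - s <= t <= s -> s <= nm (line p v t)) ->
  nm (seg (fun z => z^-1 * h (w + z)) p v (- s) s) * (s * N) <=
  N ^+ 2 / 4 * (2 * s) + fint (fun t => u (line p v t)) (- s) s.
Proof.
move=> /andP[s0 sr] v1 ch hs; have ss : - s <= s by lra.
have cV : scont (fun z => z^-1 * h (w + z)) p v (- s) s.
  move=> t ht; apply: contatM (ch t ht); apply: contatV (contat_id _).
  by rewrite -nm_gt0 (lt_le_trans s0)// hs.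
have N0 : 0 <= s * N by rewrite mulr_ge0 ?nm_ge0// ltW.
have := seg_nm_le cV; rewrite v1 mul1r => /(ler_wpM2r N0)/le_trans; apply.
have cn := scont_nm cV; have cu := within_sqr (scont_nm ch).
rewrite mulrC -fintZ//.
have -> : N ^+ 2 / 4 * (2 * s) = fint (fun=> N ^+ 2 / 4) (- s) s by rewrite fint_cst//; lra.
have cc : {within `[- s, s], continuous (fun=> N ^+ 2 / 4 : R)} by move=> t; exact: cvg_cst.
rewrite -fintD//; apply: fint_le.
- by move=> t; apply: cvgM; [exact: cvg_cst|exact: cn].
- by move=> t; apply: cvgD; [exact: cc|exact: cu].
move=> t ht; rewrite nmM nmV; set z := line p v t; rewrite /u.
have sz : s <= nm z by exact: hs.
have z0 : 0 < nm z by apply: lt_le_trans sz.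
have -> : s * N * ((nm z)^-1 * nm (h (w + z))) = (s / nm z) * (N * nm (h (w + z))) by ring.
apply: le_trans (_ : N * nm (h (w + z)) <= _).
  by rewrite ler_piMl ?mulr_ge0 ?nm_ge0// ler_pdivrMr// mul1r.
have := sqr_ge0 (N / 2 - nm (h (w + z))); lra.
Qed.

(** Cauchy's formula multiplied by [s * N] gives at least [4 * s * N ^+ 2]; the four sides lose
    [s * N ^+ 2 / 2] each in [side], so half of it remains. *)
Lemma submean_slice s : 0 < s <= r -> 2 * s * N ^+ 2 <=
  fint (fun t => u (t +i* (- s))) (- s) s + fint (fun t => u (s +i* t)) (- s) s +
  fint (fun t => u (t +i* s)) (- s) s + fint (fun t => u ((- s) +i* t)) (- s) s.
Proof.
move=> sr; have /andP[s0 sr'] := sr.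
have ss : - s <= s by lra.
have N0 : 0 <= s * N by rewrite mulr_ge0 ?nm_ge0// ltW.
have sum_bound (a1 a2 a3 a4 b1 b2 b3 b4 : R) : a1 * (s * N) <= N ^+ 2 / 4 * (2 * s) + b1 ->
    a2 * (s * N) <= N ^+ 2 / 4 * (2 * s) + b2 -> a3 * (s * N) <= N ^+ 2 / 4 * (2 * s) + b3 ->
    a4 * (s * N) <= N ^+ 2 / 4 * (2 * s) + b4 -> 4 * N * (s * N) <= (a1 + a2 + a3 + a4) * (s * N) ->
    2 * s * N ^+ 2 <= b1 + b2 + b3 + b4 by lra.
have ms : - s <= - s <= s by rewrite lexx ss.
have ps : - s <= s <= s by rewrite lexx ss.
have hD' z : nm z <= 2 * s -> hasder h (w + z) (dh (w + z)).
  by move=> hz; apply: hD; apply: le_trans hz _; lra.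
have cs x y : - s <= x <= s -> - s <= y <= s -> contat (fun z => h (w + z)) (x +i* y).
  by move=> hx hy; exact: hasder_contat (hasder_shift (hD' _ (sq_le hx hy))).
have S1 := @side s ('i * (- s)%:C) 1 sr (nm1 R).
have S2 := @side s s%:C 'i sr (nmi R).
have S3 := @side s ('i * s%:C) 1 sr (nm1 R).
have S4 := @side s (- s)%:C 'i sr (nmi R).
have c1 y t : - s <= y <= s -> - s <= t <= s ->
    contat (fun z => h (w + z)) (line ('i * y%:C) 1 t).
  by move=> hy ht; rewrite lineHE; exact: cs.
have c2 y t : - s <= y <= s -> - s <= t <= s ->
    contat (fun z => h (w + z)) (line y%:C 'i t).
  by move=> hy ht; rewrite lineVE; exact: cs.
have d1 y t : y = s \/ y = - s -> - s <= t <= s -> s <= nm (line ('i * y%:C) 1 t).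
  move=> hy ht; rewrite lineHE; apply: sqbnd_ge; first exact: ltW.
  by split=> //; case: hy => ->; rewrite ?eqxx ?orbT.
have d2 y t : y = s \/ y = - s -> - s <= t <= s -> s <= nm (line y%:C 'i t).
  move=> hy ht; rewrite lineVE; apply: sqbnd_ge; first exact: ltW.
  by split=> //; case: hy => ->; rewrite ?eqxx ?orbT.
have {}S1 := S1 (fun t => c1 _ t ms) (fun t => d1 _ t (or_intror erefl)).
have {}S2 := S2 (fun t => c2 _ t ps) (fun t => d2 _ t (or_introl erefl)).
have {}S3 := S3 (fun t => c1 _ t ps) (fun t => d1 _ t (or_introl erefl)).
have {}S4 := S4 (fun t => c2 _ t ms) (fun t => d2 _ t (or_intror erefl)).
have := cauchy0 s0 hD'; rewrite /Jc /J => E.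
have le4 : 4 * N <= nm (cc s * h w) by rewrite nmM ler_wpM2r ?nm_ge0// cc_ge4.
rewrite -E in le4.
have e1 (q : R) : (fun t => u (line ('i * q%:C) 1 t)) = (fun t => u (t +i* q)).
  by apply/funext => t; rewrite lineHE.
have e2 (q : R) : (fun t => u (line q%:C 'i t)) = (fun t => u (q +i* t)).
  by apply/funext => t; rewrite lineVE.
rewrite e1 in S1; rewrite e2 in S2; rewrite e1 in S3; rewrite e2 in S4.
move: S1 S2 S3 S4 le4; set g := (fun z => z^-1 * _).
set n1 := seg g _ _ _ _; set n2 := seg g _ _ _ _; set n3 := seg g _ _ _ _; set n4 := seg g _ _ _ _.
move=> S1 S2 S3 S4 le4.
have {}le4 : 4 * N <= nm n1 + nm n2 + nm n3 + nm n4.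
  apply: le_trans le4 _; apply: le_trans (nmB _ _) _; rewrite lerD2r.
  by apply: le_trans (nmB _ _) _; rewrite lerD2r nmD.
have {}le4 := ler_wpM2r N0 le4.
exact: sum_bound S1 S2 S3 S4 le4.
Qed.

End submean.

Section submean_area.
Variable R : realType.
Notation mu := (@lebesgue_measure R).
Notation mu2 := (mu \x mu)%E.

Lemma fint_EFin (u : R -> R) a b : {within `[a, b], continuous u} ->
  ((fint u a b)%:E = \int[mu]_(t in `[a, b]) (u t)%:E)%E.
Proof.
move=> /fint_integrable iu; rewrite /fint /Rintegral fineK//.
exact: integrable_fin_num.
Qed.

Definition csq (w : R[i]) (r : R) : set (R * R) :=
  [set p | `|p.1 - Re w| <= r /\ `|p.2 - Im w| <= r].

Lemma csq_measurable w r : measurable (csq w r).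
Proof.
rewrite (_ : csq w r = `[Re w - r, Re w + r] `*` `[Im w - r, Im w + r]).
  exact: measurableX.
apply/seteqP; split=> p; rewrite /csq /= !in_itv /= !ler_norml.
  by move=> [/andP[? ?] /andP[? ?]]; split; apply/andP; split; lra.
by move=> [/andP[? ?] /andP[? ?]]; split; apply/andP; split; lra.
Qed.

Lemma csq_nm w r p : 0 < r -> csq w r p -> nm (Z p - w) < 2 * r.
Proof.
move=> r0 [h1 h2]; suff : nm (Z p - w) ^+ 2 < (2 * r) ^+ 2.
  by rewrite ltr_pXn2r// nnegrE ?nm_ge0// mulr_ge0// ltW.
case: w h1 h2 => a b /= h1 h2; rewrite (sqr_nm (Z p - (a +i* b))) /=.
have s1 : (p.1 - a) ^+ 2 <= r ^+ 2 by rewrite -real_normK ?num_real// ler_pXn2r ?nnegrE// ltW.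
have s2 : (p.2 - b) ^+ 2 <= r ^+ 2 by rewrite -real_normK ?num_real// ler_pXn2r ?nnegrE// ltW.
have : 0 < r ^+ 2 by rewrite exprn_gt0.
rewrite exprMn; lra.
Qed.

Lemma ge0_integralD4 (a b c d : R -> \bar R) :
  measurable_fun setT a -> measurable_fun setT b ->
  measurable_fun setT c -> measurable_fun setT d ->
  (forall x, 0 <= a x)%E -> (forall x, 0 <= b x)%E -> (forall x, 0 <= c x)%E ->
  (forall x, 0 <= d x)%E ->
  (\int[mu]_x ((a x + b x) + (c x + d x)) =
   (\int[mu]_x a x + \int[mu]_x b x) + (\int[mu]_x c x + \int[mu]_x d x))%E.
Proof.
move=> *; rewrite -!ge0_integralD//.
- by move=> x _; apply: adde_ge0.
- exact: emeasurable_funD.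
- by move=> x _; apply: adde_ge0.
- exact: emeasurable_funD.
Qed.

(** Integrate [submean_slice] over [s] between [r / 2] and [r], bounding each side by the full slice
    of the square that contains it. By Tonelli each of the four families of slices integrates to the
    area integral, whence [r * N ^+ 2 * (r / 2)] is at most 4 times that integral, and the factor
    8. *)
Lemma submean_area (h dh : R[i] -> R[i]) (w : R[i]) (r : R) : 0 < r ->
  (forall z, nm (z - w) <= 2 * r -> hasder h z (dh z)) ->
  ((r ^+ 2 * nm (h w) ^+ 2)%:E <=
   8%:E * \int[mu2]_(p in csq w r) (nm (h (Z p)) ^+ 2)%:E)%E.
Proof.
move=> r0 hD0.
have hD z : nm z <= 2 * r -> hasder h (w + z) (dh (w + z)).
  by move=> hz; apply: hD0; rewrite addrC addKr.
pose u z : R := nm (h (w + z)) ^+ 2.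
pose N := nm (h w).
pose Phi : R * R -> \bar R := (fun p => (u (Z p))%:E) \_ (csq 0 r).
have Phi0 p : (0 <= Phi p)%E.
  by apply: erestrict_ge0 => q _; rewrite lee_fin sqr_ge0.
have mPhi : measurable_fun setT Phi.
  apply/(measurable_restrictT _ (csq_measurable 0 r)).
  apply: (@measurable_funS _ _ _ _ [set p | nm (Z p - 0) < 2 * r]).
  - exact: (open2_measurable (@open2_nm R _ _)).
  - by move=> p; exact: csq_nm.
  - apply: (@measurable_nm2 R _ (fun z => h (w + z))); first exact: open2_nm.
    move=> p; rewrite /mkset subr0 => hp; have K := hD (Z p) (ltW hp); have K2 := hasder_shift K; exact: (hasder_contat K2).
pose A x := (\int[mu]_t Phi (x, t))%E.
pose B y := (\int[mu]_t Phi (t, y))%E.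
have mA : measurable_fun setT A by exact: (measurable_fun_fubini_tonelli_F (m2 := mu) Phi mPhi Phi0).
have mB : measurable_fun setT B by exact: (measurable_fun_fubini_tonelli_G (m1 := mu) Phi mPhi Phi0).
have A0 x : (0 <= A x)%E by apply: integral_ge0.
have B0 x : (0 <= B x)%E by apply: integral_ge0.
have mA' : measurable_fun setT (fun x : R => A (- x)%R) by apply: (measurableT_comp mA); exact: oppr_measurable.
have mB' : measurable_fun setT (fun x : R => B (- x)%R) by apply: (measurableT_comp mB); exact: oppr_measurable.
have Phi_in x y : - r <= x <= r -> - r <= y <= r -> Phi (x, y) = (u (x +i* y))%:E.
  move=> hx hy; rewrite /Phi patchE mem_set//= /csq /=; rewrite !subr0 !ler_norml.
  by split.
have cg x y : - r <= x <= r -> - r <= y <= r -> contat (fun z => h (w + z)) (x +i* y).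
  by move=> hx hy; exact: hasder_contat (hasder_shift (hD _ (sq_le hx hy))).
have hA s x : 0 < s <= r -> - r <= x <= r -> ((fint (fun t => u (x +i* t)) (- s) s)%:E <= A x)%E.
  move=> /andP[s0 sr] hx.
  have cu : {within `[- s, s], continuous (fun t => u (x +i* t))}.
    rewrite (_ : (fun t => _) = (fun t => nm (h (w + line x%:C 'i t)) ^+ 2)).
      apply: within_sqr; apply: (scont_nm (g := fun z => h (w + z))) => t ht.
      by rewrite lineVE; apply: cg; lra.
    by apply/funext => t; rewrite lineVE.
  rewrite fint_EFin//.
  have -> : (\int[mu]_(t in `[(- s)%R, s]) (u (x +i* t))%:E = \int[mu]_(t in `[(- s)%R, s]) Phi (x, t))%E.
    by apply: eq_integral => t; rewrite inE /= in_itv /= => ht; rewrite Phi_in//; lra.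
  apply: ge0_subset_integral => //.
  exact: (measurableT_comp mPhi (pair1_measurable x)).
have hB s y : 0 < s <= r -> - r <= y <= r -> ((fint (fun t => u (t +i* y)) (- s) s)%:E <= B y)%E.
  move=> /andP[s0 sr] hy.
  have cu : {within `[- s, s], continuous (fun t => u (t +i* y))}.
    rewrite (_ : (fun t => _) = (fun t => nm (h (w + line ('i * y%:C) 1 t)) ^+ 2)).
      apply: within_sqr; apply: (scont_nm (g := fun z => h (w + z))) => t ht.
      by rewrite lineHE; apply: cg; lra.
    by apply/funext => t; rewrite lineHE.
  rewrite fint_EFin//.
  have -> : (\int[mu]_(t in `[(- s)%R, s]) (u (t +i* y))%:E = \int[mu]_(t in `[(- s)%R, s]) Phi (t, y))%E.
    by apply: eq_integral => t; rewrite inE /= in_itv /= => ht; rewrite Phi_in//; lra.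
  apply: ge0_subset_integral => //.
  exact: (measurableT_comp mPhi (pair2_measurable y)).
have slice s : r / 2 <= s <= r -> ((r * N ^+ 2)%:E <= (B (- s)%R + A s) + (B s + A (- s)%R))%E.
  move=> /andP[rs sr]; have s0 : 0 < s by lra.
  have ssr : 0 < s <= r by rewrite s0.
  apply: (@le_trans _ _ (2 * s * N ^+ 2)%:E).
    by rewrite lee_fin ler_wpM2r ?sqr_ge0//; lra.
  have := submean_slice hD ssr.
  rewrite -/N -lee_fin => /le_trans; apply.
  rewrite -addrA !EFinD -/u.
  by apply: leeD; apply: leeD; [apply: hB|apply: hA|apply: hB|apply: hA]; lra.
have tot : (\int[mu]_s ((B (- s)%R + A s) + (B s + A (- s)%R)) = 4%:E * \int[mu2]_p Phi p)%E.
  rewrite ge0_integralD4//.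
  rewrite (integral_oppr mA A0) (integral_oppr mB B0).
  have <- : (\int[mu2]_p Phi p = \int[mu]_x A x)%E by rewrite fubini_tonelli1.
  have <- : (\int[mu2]_p Phi p = \int[mu]_x B x)%E by rewrite fubini_tonelli2.
  have I0 : (0 <= \int[mu2]_p Phi p)%E by exact: integral_ge0.
  rewrite (_ : 4%:E = 1%:E + 1%:E + (1%:E + 1%:E))%E; last by rewrite -!EFinD; congr EFin; lra.
  by rewrite !ge0_muleDl ?mul1e// lee_fin.
have tr : (\int[mu2]_p Phi p = \int[mu2]_(p in csq w r) (nm (h (Z p)) ^+ 2)%:E)%E.
  rewrite [RHS]integral_mkcond; set Psi := _ \_ (csq w r).
  have mPsi : measurable_fun setT Psi.
    apply/(measurable_restrictT _ (csq_measurable w r)).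
    apply: (@measurable_funS _ _ _ _ [set p | nm (Z p - w) < 2 * r]).
    - exact: (open2_measurable (@open2_nm R _ _)).
    - by move=> p; exact: csq_nm.
    - apply: (@measurable_nm2 R _ h); first exact: open2_nm.
      by move=> p /= /ltW /hD0 /hasder_contat.
  rewrite -(integral2_translation (Re w, Im w) mPsi); last first.
    by move=> p; apply: erestrict_ge0 => q _; rewrite lee_fin sqr_ge0.
  apply: eq_integral => p _; rewrite /Phi /Psi !patchE.
  have -> : (p \in csq 0 r) = (((Re w, Im w).1 + p.1, (Re w, Im w).2 + p.2) \in csq w r).
    apply/idP/idP; rewrite !inE /csq /= !subr0 [_ + p.1]addrC [_ + p.2]addrC !addrK //.
  by rewrite /u; congr (if _ then (nm (h _) ^+ 2)%:E else _); rewrite /Z; case: (w).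
rewrite -tr.
have I1 : ((r * N ^+ 2 * (r / 2))%:E <= 4%:E * \int[mu2]_p Phi p)%E.
  pose S (s : R) := ((B (- s)%R + A s) + (B s + A (- s)%R))%E.
  rewrite -tot -[leRHS]/(\int[mu]_s S s)%E.
  have mS : measurable_fun setT S by apply: emeasurable_funD; exact: emeasurable_funD.
  have S0 s : (0 <= S s)%E by apply: adde_ge0; apply: adde_ge0.
  have le2 : (\int[mu]_(s in `[(r / 2)%R, r]) S s <= \int[mu]_s S s)%E.
    exact: ge0_subset_integral.
  apply: le_trans le2.
  have -> : (r * N ^+ 2 * (r / 2))%:E = (\int[mu]_(s in `[(r / 2)%R, r]) (cst (r * N ^+ 2)%:E s))%E.
    rewrite integral_cst//= lebesgue_measure_itv /= lte_fin ifT; last by lra.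
    by rewrite -EFinB -EFinM; congr EFin; lra.
  apply: ge0_le_integral => //=.
  - by move=> s _; rewrite lee_fin mulr_ge0 ?sqr_ge0// ltW.
  - exact: measurable_funS mS.
have e8 : (8 : R) = 2 * 4 by lra.
rewrite e8 [(2 * 4)%:E]EFinM -muleA; apply: le_trans (lee_wpmul2l _ I1); last by rewrite lee_fin.
by rewrite -EFinM lee_fin -/N; lra.
Qed.

End submean_area.

(** * Change of variables *)

Section local_surjectivity.
Variable R : realType.
Implicit Types (r : R) (f df : R[i] -> R[i]) (z w e : R[i]).

(** For each coordinate, the intervals of half-width [2 * d * 2^-1 ^+ n] about the [n]-th term are
    nested and share a point. *)
Lemma complex_cauchy (x : nat -> R[i]) (d : R) : 0 <= d ->
  (forall n, nm (x n.+1 - x n) <= d * 2^-1 ^+ n) ->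
  exists y, forall n, nm (y - x n) <= 4 * d * 2^-1 ^+ n.
Proof.
move=> d0 H; pose s n : R := 2^-1 ^+ n.
have sS n : s n = s n.+1 + s n.+1 by rewrite /s exprS; lra.
have s0 n : 0 < s n by rewrite exprn_gt0.
have dS n : d * s n = d * s n.+1 + d * s n.+1 by rewrite {1}sS mulrDr.
have d0' n : 0 <= d * s n by rewrite mulr_ge0// ltW.
have lim (k : R[i] -> R) : (forall z w, `|k z - k w| <= nm (z - w)) ->
    exists p, forall n, `|p - k (x n)| <= 2 * (d * s n).
  move=> kl; have step n : `|k (x n.+1) - k (x n)| <= d * s n by apply: le_trans (kl _ _) (H n).
  have [n|n|n|p Hp] := @nested_point R (fun n => k (x n) - 2 * (d * s n)) (fun n => 4 * (d * s n)).
  - by rewrite mulr_ge0.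
  - by have := step n; rewrite ler_norml => /andP[? ?]; have := dS n; lra.
  - by have := step n; rewrite ler_norml => /andP[? ?]; have := dS n; lra.
  exists p => n; have /andP[? ?] := Hp n; rewrite ler_norml; apply/andP; split; lra.
have [p Hp] := lim _ (@Re_lip R); have [q Hq] := lim _ (@Im_lip R).
exists (p +i* q) => n; apply: le_trans (nm_le_ReIm _) _.
have := Hp n; have := Hq n; case: (x n) => a b /= h1 h2.
by rewrite -mulrA -/(s n); lra.
Qed.

(** Newton's iteration with the derivative frozen at [z]: the map [T] contracts by 1/2 on the disc,
    and its first step is shorter than [r / 2], so the iterates stay in the disc and converge to a
    fixed point, which is a solution. *)
Lemma local_surj f df z r e : 0 < r -> df z != 0 ->
  (forall w, nm (w - z) < r -> hasder f w (df w) /\ nm (df w - df z) <= nm (df z) / 2) ->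
  nm (e - f z) < r * nm (df z) / 2 ->
  exists2 w, nm (w - z) < r & f w = e.
Proof.
move=> r0 dz H he; pose T w := w - (f w - e) / df z.
have dz0 : 0 < nm (df z) by rewrite nm_gt0.
have TL p q : nm (p - z) < r -> nm (q - z) < r -> nm (T q - T p) <= 2^-1 * nm (q - p).
  move=> hp hq; apply: (@lip_ball _ T (fun w => 1 - df w / df z) z r) => // w hw.
  have [fw dw] := H _ hw; split.
    have -> : 1 - df w / df z = 1 - (df z)^-1 * (df w - 0) by rewrite subr0 mulrC.
    have -> : T = (fun w => w - (df z)^-1 * (f w - e)) by apply/funext => u; rewrite /T mulrC.
    apply: hasderB (hasder_id _) (hasderZ _ _); apply: hasderB fw (hasder_cst _ _).
  have -> : 1 - df w / df z = (df z - df w) / df z by field.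
  by rewrite nmM nmV nm_distC ler_pdivrMr// mulrC.
pose d := nm (T z - z).
have dr : 2 * d < r.
  have -> : d = nm (e - f z) / nm (df z).
    by rewrite /d (_ : T z - z = (e - f z) / df z) ?nmM ?nmV// /T; ring.
  by rewrite mulrA ltr_pdivrMr//; lra.
have d0 : 0 <= d by exact: nm_ge0.
pose x n := iter n T z; pose s n : R := 2^-1 ^+ n.
have sS n : s n = s n.+1 + s n.+1 by rewrite /s exprS; lra.
have s0 n : 0 < s n by rewrite exprn_gt0.
have dS n : d * s n = d * s n.+1 + d * s n.+1 by rewrite {1}sS mulrDr.
have ds0 n : 0 <= d * s n by rewrite mulr_ge0// ltW.
have P n : nm (x n - z) <= 2 * d - 2 * (d * s n) /\ nm (x n.+1 - x n) <= d * s n.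
  elim: n => [|n [h1 h2]].
    by rewrite /x /= subrr nm0 /s expr0 mulr1; split; [lra|].
  have h3 : nm (x n.+1 - z) <= 2 * d - 2 * (d * s n.+1).
    by have := nm_tri (x n) (x n.+1) z; have := dS n; lra.
  split=> //; apply: (le_trans (TL (x n) (x n.+1) _ _)).
  - by have := ds0 n; lra.
  - by have := ds0 n.+1; lra.
  - by have := dS n; lra.
have [y Hy] := complex_cauchy d0 (fun n => (P n).2).
have small (a b : R) : (forall n, a <= b * s n) -> a <= 0.
  move=> ab; apply/ler_addgt0Pr => eps e0; rewrite add0r.
  have : (fun n => b * s n) @ \oo --> b * 0.
    apply: cvgM; first exact: cvg_cst.
    by apply: cvg_expr; rewrite ger0_norm//; lra.
  rewrite mulr0 => /cvgr0Pnorm_le /(_ _ e0)[n _ Hn].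
  have := Hn n (leqnn n) => /= h; apply: le_trans (ab n) _.
  exact: le_trans (ler_norm _) h.
have yr : nm (y - z) < r.
  apply: le_lt_trans dr; rewrite -subr_le0; apply: (small _ (4 * d)) => n.
  have := nm_tri (x n) y z; have := Hy n; have := (P n).1; have := ds0 n.
  rewrite -/(s n); lra.
have Ty : T y = y.
  apply/eqP; rewrite -subr_eq0 -nm_eq0; apply/eqP/le_anti; rewrite nm_ge0 andbT.
  apply: (small _ (6 * d)) => n.
  have h1 : nm (T y - T (x n)) <= 2^-1 * nm (y - x n).
    by apply: TL => //; have := (P n).1; have := ds0 n; lra.
  have h2 : nm (T (x n) - y) <= 4 * d * s n.+1.
    by rewrite nm_distC; exact: (Hy n.+1).
  have := nm_tri (T (x n)) (T y) y; have := Hy n; have := dS n; have := ds0 n.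
  rewrite -/(s n); lra.
exists y => //; move/eqP: Ty; rewrite /T -subr_eq0 addrAC subrr sub0r oppr_eq0.
by rewrite mulf_eq0 invr_eq0 (negbTE dz) orbF subr_eq0 => /eqP.
Qed.

End local_surjectivity.

Local Arguments ComplexField.Normc.normc : simpl never.

Section plane_sigma_finite.
Variable R : realType.
Notation mu := (@lebesgue_measure R).

Lemma plane_sigma_finite : sigma_finite setT (mu \x mu)%E.
Proof.
have /sigma_finiteP[F [TF ndF Foo]] := sigma_finiteT mu.
exists (fun n => F n `*` F n).
  rewrite -setXTT TF predeqE => -[x y]; split.
    move=> [/= [n _ Fnx] [k _ Fky]]; exists (maxn n k) => //; split.
    - by move: x Fnx; exact/subsetPset/ndF/leq_maxl.
    - by move: y Fky; exact/subsetPset/ndF/leq_maxr.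
  by move=> [n _ []/= ? ?]; split; exists n.
move=> k; have [? ?] := Foo k.
split; first exact: measurableX.
by rewrite product_measure1E// lte_mul_pinfty// ge0_fin_numE.
Qed.

Let plane_mixin := Measure_isSigmaFinite.Build _ _ _ (mu \x mu)%E plane_sigma_finite.

(** Packaged so that Tonelli's theorem applies to functions of two points of the plane. *)
Definition mu2s : {sigma_finite_measure set _ -> \bar R} :=
  HB.pack (mu \x mu)%E plane_mixin.

End plane_sigma_finite.

Section change_of_variables.
Variable R : realType.
Notation mu := (@lebesgue_measure R).
Notation mu2 := (mu \x mu)%E.

Definition D2 : set (R * R) := [set p | nm (Z p) < 1].

Lemma open2_D2 : open2 D2.
Proof.
rewrite /D2 (_ : [set p | _] = [set p | nm (Z p - 0) < 1]); first exact: (@open2_nm R _ _).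
by apply/funext => p; rewrite /mkset subr0.
Qed.

Lemma D2_measurable : measurable D2.
Proof. exact: (open2_measurable open2_D2). Qed.

Lemma measurable_le d (T : measurableType d) (f g : T -> R) :
  measurable_fun setT f -> measurable_fun setT g -> measurable [set x | f x <= g x].
Proof.
move=> mf mg; have := measurable_fun_ler mf mg measurableT (Y := [set true]).
by rewrite setTI; apply.
Qed.

Lemma csq_measure (w : R[i]) (r : R) : 0 < r -> (mu2 (csq w r) = (4 * r ^+ 2)%:E)%E.
Proof.
move=> r0; have -> : csq w r = `[Re w - r, Re w + r] `*` `[Im w - r, Im w + r].
  apply/seteqP; split=> p; rewrite /csq /= !in_itv /= !ler_norml.
    by move=> [/andP[? ?] /andP[? ?]]; split; apply/andP; split; lra.
  by move=> [/andP[? ?] /andP[? ?]]; split; apply/andP; split; lra.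
rewrite product_measure1E//= !lebesgue_measure_itv /= !lte_fin !ifT; [|lra|lra].
by rewrite -!EFinB -EFinM; congr EFin; ring.
Qed.

Variables (f df h dh : R[i] -> R[i]) (L : R).
Hypothesis fD : forall z, nm z < 1 -> hasder f z (df z).
Hypothesis f1 : forall z, nm z < 1 -> nm (f z) < 1.
Hypothesis finj : forall z w, nm z < 1 -> nm w < 1 -> f z = f w -> z = w.
Hypothesis L0 : 0 < L.
Hypothesis dfL : forall z w, nm z < 1 -> nm w < 1 -> nm (df z - df w) <= L * nm (z - w).
Hypothesis hD : forall z, nm z < 1 -> hasder h z (dh z).

Let dfc z : nm z < 1 -> contat df z.
Proof.
move=> z1; have [|w wz|e /hasder_contat//] := @der_hasder R f df z (1 - nm z).
  by rewrite subr_gt0.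
by apply: fD; rewrite -(subrK z w); apply: le_lt_trans (nmD _ _) _; lra.
Qed.

(** The points where [local_surj] applies with radius [r]: the disc of radius [r] stays in the unit
    disc and, [df] being [L]-Lipschitz, [df] varies there by less than half of its modulus at the
    centre. *)
Let U (r : R) : set (R * R) := [set p | nm (Z p) + r < 1 /\ 2 * L * r < nm (df (Z p))].

Let open2_U r : 0 < r -> open2 (U r).
Proof.
move=> r0 p [p1 p2].
have zp : nm (Z p) < 1 by lra.
have [d d0 Hd] := dfc zp (eps := nm (df (Z p)) - 2 * L * r) ltac:(lra).
exists (Num.min (d / 2) ((1 - r - nm (Z p)) / 2)); first by rewrite lt_min; apply/andP; split; lra.
move=> q; rewrite /sbox /= !lt_min => -[/andP[? ?] /andP[? ?]].
have := ZB p q => zq.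
have := Hd (Z q) ltac:(lra) => h1.
split.
  have := nm_lip (Z q) (Z p); rewrite ler_norml => /andP[_ ?]; lra.
by have := nm_lip (df (Z q)) (df (Z p)); rewrite ler_norml => /andP[? _]; lra.
Qed.

(** The constant of [submean_area] on a square of half-side [r / 8 * nm (df z)], with the factor
    [nm (df z) ^+ 2] left out. *)
Let k r : R := (r / 8) ^+ 2 / 8.

Let k_gt0 r : 0 < r -> 0 < k r.
Proof. by move=> r0; rewrite divr_gt0// exprn_gt0// divr_gt0. Qed.

(** The ratio of [4 * r ^+ 2], the area of a square of half-side [r], to [k r]. It does not depend
    on [r], which allows [r] to tend to 0. *)
Definition cvC : R := 4 * 8 ^+ 3.

(* Where [r] is small with respect to [df z], the image of the disc of radius [r] about [z]
   contains a square of size comparable with [r * |df z|] about [f z]. Averaging [|h|^2] over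
   these squares and exchanging the integrals, injectivity bounds the measure of the [z] whose
   square reaches a given point. *)
Let step r : 0 < r ->
  (\int[mu2]_(p in U r) (nm (h (f (Z p))) ^+ 2 * nm (df (Z p)) ^+ 2)%:E <=
   cvC%:E * \int[mu2]_(p in D2) (nm (h (Z p)) ^+ 2)%:E)%E.
Proof.
move=> r0; have mU : measurable (U r) := open2_measurable (open2_U r0).
have UD p : U r p -> D2 p by move=> [? _]; rewrite /D2 /mkset; lra.
pose H : R * R -> \bar R := (fun p => (nm (h (Z p)) ^+ 2)%:E) \_ D2.
have H0 p : (0 <= H p)%E by apply: erestrict_ge0 => q _; rewrite lee_fin sqr_ge0.
have mH : measurable_fun setT H.
  apply/(measurable_restrictT _ D2_measurable).
  apply: measurable_nm2; first exact: open2_D2.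
  by move=> p /hD /hasder_contat.
have contU p : U r p -> contat f (Z p) by move=> /UD /fD /hasder_contat.
(* The centre and the half-side of the square attached to a point are extended by 0 off [U r], so
   that [S] is measurable in the whole product. *)
pose a : R * R -> R := (fun p => Re (f (Z p))) \_ (U r).
pose b : R * R -> R := (fun p => Im (f (Z p))) \_ (U r).
pose c : R * R -> R := (fun p => r / 8 * nm (df (Z p))) \_ (U r).
have ma : measurable_fun setT a.
  apply/(measurable_restrictT _ mU); apply: cont2_measurable; first exact: open2_U.
  by move=> p /contU; apply: (contat_cont2 (k := @complex.Re R)); exact: Re_lip.
have mb : measurable_fun setT b.
  apply/(measurable_restrictT _ mU); apply: cont2_measurable; first exact: open2_U.
  by move=> p /contU; apply: (contat_cont2 (k := @complex.Im R)); exact: Im_lip.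
have mc : measurable_fun setT c.
  apply/(measurable_restrictT _ mU); apply: measurable_funM => //.
  apply: measurable_nm; first exact: open2_U.
  by move=> p /UD; exact: dfc.
pose S : set ((R * R) * (R * R)) := [set x | U r x.1 /\
  (`|x.2.1 - a x.1| <= c x.1 /\ `|x.2.2 - b x.1| <= c x.1)].
have mS : measurable S.
  have -> : S = (fst @^-1` U r) `&` ([set x | `|x.2.1 - a x.1| <= c x.1] `&`
      [set x | `|x.2.2 - b x.1| <= c x.1]) by [].
  apply: measurableI; first by rewrite -[X in measurable X]setTI; exact: measurable_fst.
  have m1 (g : R * R -> R) : measurable_fun setT g ->
    measurable_fun setT (fun x : (R * R) * (R * R) => g x.1) by move=> ?; exact: measurableT_comp.
  by apply: measurableI; apply: measurable_le; do ?exact: m1;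
    apply: measurableT_comp => //; apply: measurable_funB; do ?exact: m1;
    apply: measurableT_comp => //; exact: measurableT_comp.
pose G : (R * R) * (R * R) -> \bar R := (fun x => H x.2) \_ S.
have G0 x : (0 <= G x)%E by apply: erestrict_ge0.
have mG : measurable_fun setT G.
  apply/(measurable_restrictT _ mS); apply: measurable_funTS.
  exact: measurableT_comp.
have surj z e : U r z -> nm (e - f (Z z)) < r * nm (df (Z z)) / 2 ->
    exists2 w, nm (w - Z z) < r & f w = e.
  move=> [z1 z2]; apply: (local_surj (df := df)) => //.
    by rewrite -nm_gt0 (le_lt_trans _ z2)// !mulr_ge0// ltW.
  move=> w wz; have w1 : nm w < 1.
    by rewrite -(subrK (Z z) w); apply: le_lt_trans (nmD _ _) _; lra.
  split; first exact: fD.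
  apply: le_trans (dfL w1 _) _; first lra.
  apply: le_trans (_ : L * r <= _); last by lra.
  by rewrite ler_pM2l// ltW.
have lower z : U r z -> ((k r * (nm (h (f (Z z))) ^+ 2 * nm (df (Z z)) ^+ 2))%:E <=
    \int[mu2]_w G (z, w))%E.
  move=> Uz; have [z1 z2] := Uz.
  have df0 : 0 < nm (df (Z z)) by rewrite (le_lt_trans _ z2)// !mulr_ge0// ltW.
  pose rho := r / 8 * nm (df (Z z)).
  have rho0 : 0 < rho by rewrite mulr_gt0//; lra.
  (* [2 * rho] is a quarter of [r * nm (df (Z z))], so by [surj] this disc lies in the image under
     [f] of the disc of radius [r], hence in the unit disc, where [h] is holomorphic. *)
  have inD e : nm (e - f (Z z)) <= 2 * rho -> nm e < 1.
    move=> he; have [|w wz <-] := surj z e Uz.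
      apply: le_lt_trans he _; rewrite /rho.
      have : 0 < r * nm (df (Z z)) by rewrite mulr_gt0.
      lra.
    apply: f1; rewrite -(subrK (Z z) w); apply: le_lt_trans (nmD _ _) _; lra.
  have := submean_area rho0 (fun e he => hD (inD e he)).
  have -> : (\int[mu2]_w G (z, w) = \int[mu2]_(p in csq (f (Z z)) rho) (nm (h (Z p)) ^+ 2)%:E)%E.
    rewrite [RHS]integral_mkcond; apply: eq_integral => w _.
    rewrite /G !patchE.
    have -> : ((z, w) \in S) = (w \in csq (f (Z z)) rho).
      apply/idP/idP; rewrite !inE /S /csq /= /a /b /c !patchE mem_set//=.
      by move=> [].
    have [hw|//] := boolP (w \in csq (f (Z z)) rho).
    move: hw; rewrite inE => hw; rewrite /H patchE mem_set//.
    exact: inD (ltW (csq_nm rho0 hw)).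
  set I := (\int[mu2]_(p in _) _)%E => le1.
  have : ((8^-1)%:E * (rho ^+ 2 * nm (h (f (Z z))) ^+ 2)%:E <= (8^-1)%:E * (8%:E * I))%E.
    by apply: lee_wpmul2l => //; rewrite lee_fin invr_ge0.
  rewrite muleA -!EFinM mulVf ?pnatr_eq0// mul1e; apply: le_trans.
  rewrite lee_fin /rho /k exprMn.
  rewrite le_eqVlt; apply/orP; left; apply/eqP.
  by field.
have upper w : (\int[mu2]_z G (z, w) <= (4 * r ^+ 2)%:E * H w)%E.
  have [[z0 Sz0]|none] := pselect (exists z, S (z, w)); last first.
    have -> : (\int[mu2]_z G (z, w) = \int[mu2]_z cst 0%E z)%E.
      apply: eq_integral => q _; rewrite /G patchE memNset// => Sqw.
      exact: (none (ex_intro _ q Sqw)).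
    by rewrite integral_cst// mul0e mule_ge0// lee_fin mulr_ge0 ?sqr_ge0.
  have pre z : S (z, w) -> exists2 e, nm (e - Z z) < r & f e = Z w /\ nm e < 1.
    move=> [/= Uz]; rewrite /a /b /c !patchE mem_set// => hw.
    have [z1 z2] := Uz.
    have df0 : 0 < nm (df (Z z)) by rewrite (le_lt_trans _ z2)// !mulr_ge0// ltW.
    have rd : 0 < r * nm (df (Z z)) by rewrite mulr_gt0.
    have rho0 : 0 < r / 8 * nm (df (Z z)) by lra.
    have [|e ez fe] := surj z (Z w) Uz.
      by apply: lt_trans (csq_nm rho0 hw) _; lra.
    exists e => //; split => //.
    by rewrite -(subrK (Z z) e); apply: le_lt_trans (nmD _ _) _; lra.
  have [e0 _ [fe0 e01]] := pre _ Sz0.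
  have sub z : S (z, w) -> csq e0 r z.
    move=> /pre[e ez [fe e1]].
    have E : e = e0 by apply: finj => //; rewrite fe.
    rewrite -E; rewrite nm_distC in ez.
    by split; [apply: le_trans (Re_lip (Z z) e) (ltW ez)|apply: le_trans (Im_lip (Z z) e) (ltW ez)].
  apply: (@le_trans _ _ (\int[mu2]_(z in csq e0 r) (cst (H w)) z)%E); last first.
    rewrite integral_cst; last exact: csq_measurable.
    by rewrite [X in (_ * X)%E](csq_measure e0 r0) muleC.
  rewrite [leRHS]integral_mkcond; apply: ge0_le_integral => //=.
  - exact: (measurableT_comp mG (pair2_measurable w)).
  - by apply/(measurable_restrictT _ (csq_measurable e0 r)); exact: measurable_cst.
  - move=> z _; rewrite /G !patchE; case: ifPn => [|_].
      by rewrite inE => /sub ?; rewrite mem_set.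
    by case: ifPn => _ //; exact: H0.
have G1 : ((k r)%:E * \int[mu2]_(p in U r) (nm (h (f (Z p))) ^+ 2 * nm (df (Z p)) ^+ 2)%:E
    <= \int[mu2]_z \int[mu2]_w G (z, w))%E.
  have mI : measurable_fun (U r) (fun p => (nm (h (f (Z p))) ^+ 2 * nm (df (Z p)) ^+ 2)%:E).
    apply/measurable_EFinP; apply: measurable_funM; apply: measurable_funX.
      apply: (@measurable_nm R _ (h \o f)); first exact: open2_U.
      move=> p /UD Dp; apply: contat_comp (hasder_contat (fD Dp)) _.
      exact: hasder_contat (hD (f1 Dp)).
    by apply: measurable_nm; [exact: open2_U|move=> p /UD; exact: dfc].
  rewrite -ge0_integralZl_EFin//; last 2 first.
  - by move=> p _; rewrite lee_fin mulr_ge0 ?sqr_ge0.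
  - exact: ltW (k_gt0 r0).
  have mF : measurable_fun setT (fun z : R * R => \int[mu2]_w G (z, w))%E.
    exact: (measurable_fun_fubini_tonelli_F (m2 := mu2s R) G mG G0).
  have F0 z : (0 <= \int[mu2]_w G (z, w))%E by apply: integral_ge0.
  apply: (@le_trans _ _ (\int[mu2]_(z in U r) \int[mu2]_w G (z, w))%E).
    apply: ge0_le_integral; first exact: mU.
    - move=> p _; rewrite -EFinM lee_fin; apply: mulr_ge0; first exact: ltW (k_gt0 r0).
      by rewrite mulr_ge0 ?sqr_ge0.
    - exact: measurable_funeM.
    - exact: measurable_funTS mF.
    - by move=> p Up; rewrite -EFinM; exact: lower.
  apply: ge0_subset_integral; [exact: mU|exact: measurableT|exact: mF|by []|by []].
have G2 : (\int[mu2]_z \int[mu2]_w G (z, w) <= (4 * r ^+ 2)%:E * \int[mu2]_w H w)%E.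
  rewrite (fubini_tonelli (m1 := mu2s R) (m2 := mu2s R) G mG G0).
  rewrite -ge0_integralZl_EFin//; last by rewrite mulr_ge0 ?sqr_ge0.
  apply: ge0_le_integral => //.
  - by move=> w _; apply: integral_ge0.
  - exact: (measurable_fun_fubini_tonelli_G (m1 := mu2s R) G mG G0).
  - exact: measurable_funeM.
have HE : (\int[mu2]_w H w = \int[mu2]_(p in D2) (nm (h (Z p)) ^+ 2)%:E)%E.
  by rewrite [RHS]integral_mkcond.
have k0 : 0 <= (k r)^-1 by rewrite invr_ge0 ltW// k_gt0.
have := lee_wpmul2l (x := (k r)^-1%:E) k0 (le_trans G1 G2).
rewrite HE !muleA -!EFinM mulVf ?gt_eqF ?k_gt0//.
have -> : (k r)^-1 * (4 * r ^+ 2) = cvC by rewrite /k /cvC; field; rewrite gt_eqF.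
by rewrite mul1e.
Qed.

(** As [r] decreases to 0 the sets [U r] exhaust the points of the disc where [df] is nonzero, and
    elsewhere the integrand vanishes; [step] passes to the limit by monotone convergence. *)
Lemma change_of_variables_le :
  (\int[mu2]_(p in D2) (nm (h (f (Z p))) ^+ 2 * nm (df (Z p)) ^+ 2)%:E <=
   cvC%:E * \int[mu2]_(p in D2) (nm (h (Z p)) ^+ 2)%:E)%E.
Proof.
set F := fun p => (_ * _)%:E.
have F0 p : (0 <= F p)%E by rewrite lee_fin mulr_ge0 ?sqr_ge0.
have mF : measurable_fun D2 F.
  apply/measurable_EFinP; apply: measurable_funM; apply: measurable_funX.
    apply: (@measurable_nm R _ (h \o f)); first exact: open2_D2.
    move=> p Dp; apply: contat_comp (hasder_contat (fD Dp)) _.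
    exact: hasder_contat (hD (f1 Dp)).
  by apply: measurable_nm; [exact: open2_D2|move=> p; exact: dfc].
pose e (n : nat) : R := n.+1%:R^-1.
have e0 n : 0 < e n by rewrite invr_gt0 ltr0n.
have eS n m : (n <= m)%N -> e m <= e n.
  by move=> nm_; rewrite lef_pV2 ?posrE ?ltr0n// ler_nat ltnS.
have UD n : U (e n) `<=` D2.
  by move=> p [? _]; have := e0 n; rewrite /D2 /mkset; lra.
have mU n : measurable (U (e n)) := open2_measurable (open2_U (e0 n)).
have -> : (\int[mu2]_(p in D2) F p = \int[mu2]_(p in \bigcup_n U (e n)) F p)%E.
  rewrite integral_mkcond [RHS]integral_mkcond; apply: eq_integral => p _.
  rewrite !patchE; case: ifPn => [|nD].
    rewrite inE => Dp; case: ifPn => // nU.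
    rewrite /F; have [->|dz] := eqVneq (df (Z p)) 0; first by rewrite nm0 expr0n mulr0.
    exfalso; move: nU; rewrite notin_setE; apply.
    have dz0 : 0 < nm (df (Z p)) by rewrite nm_gt0.
    pose m := Num.min (1 - nm (Z p)) (nm (df (Z p)) / (2 * L)).
    have m0 : 0 < m by rewrite lt_min subr_gt0 Dp divr_gt0// mulr_gt0.
    have [n _ /(_ n (leqnn n)) /= Hn] := near_infty_natSinv_lt (PosNum m0).
    exists n => //; move: Hn; rewrite lt_min => /andP[h1 h2]; split.
      by rewrite -/(e n) in h1; lra.
    rewrite -/(e n) ltr_pdivlMr ?mulr_gt0// in h2; lra.
  case: ifPn => //; rewrite inE => -[n _ /UD Dp].
  by move: nD; rewrite notin_setE.
have nd : {homo (fun n => U (e n)) : n m / (n <= m)%N >-> (n <= m)%O}.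
  move=> n m nm_; apply/subsetPset => p [p1 p2]; have := eS _ _ nm_ => em; split; first lra.
  by apply: le_lt_trans p2; rewrite ler_pM2l ?mulr_gt0.
have cv := ge0_nondecreasing_set_cvg_integral (mu := mu2) nd mU
   (fun n => measurable_funS D2_measurable (UD n) mF) (fun n p _ => F0 p).
rewrite -(cvg_lim _ cv)//; apply: lime_le; first by apply/cvg_ex; eexists; exact: cv.
by apply: nearW => n; apply: step.
Qed.

End change_of_variables.

(** * The energy and a Poincare inequality *)

Section energy.
Variable R : realType.
Notation mu := (@lebesgue_measure R).
Notation mu2 := (mu \x mu)%E.

Implicit Types (a b r s x y t : R) (f df k dk : R[i] -> R[i]) (p v z w : R[i]).

Definition holo (f df : R[i] -> R[i]) := forall z, nm z < 1 -> hasder f z (df z).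

Lemma holo_der f df z : holo f df -> nm z < 1 -> exists e, hasder df z e.
Proof.
move=> fD z1; apply: (@der_hasder R f df z (1 - nm z)); first by rewrite subr_gt0.
by move=> w wz; apply: fD; rewrite -(subrK z w); apply: le_lt_trans (nmD _ _) _; lra.
Qed.

Lemma holo_dcont f df z : holo f df -> nm z < 1 -> contat df z.
Proof. by move=> fD /(holo_der fD)[e /hasder_contat]. Qed.

(** Cauchy-Schwarz against the constant 1, by integrating [(u - m) ^+ 2 >= 0] for the mean [m] of
    [u]. *)
Lemma fint_CS (u : R -> R) a b : a < b -> {within `[a, b], continuous u} ->
  (fint u a b) ^+ 2 <= (b - a) * fint (fun t => u t ^+ 2) a b.
Proof.
move=> ab cu; pose m := fint u a b / (b - a).
have ba : 0 < b - a by rewrite subr_gt0.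
have cu2 := within_sqr cu.
have cm : {within `[a, b], continuous (fun=> m ^+ 2 : R)} by move=> t; exact: cvg_cst.
have cmu : {within `[a, b], continuous (fun t => (- (2 * m)) * u t)}.
  by move=> t; apply: cvgM; [exact: cvg_cst|exact: cu].
have c0 : {within `[a, b], continuous (fun=> 0 : R)} by move=> t; exact: cvg_cst.
have cs : {within `[a, b], continuous (fun t => u t ^+ 2 + (- (2 * m)) * u t)}.
  by move=> t; apply: cvgD; [exact: cu2|exact: cmu].
have : fint (fun=> 0) a b <= fint (fun t => (u t ^+ 2 + (- (2 * m)) * u t) + m ^+ 2) a b.
  apply: fint_le => //; first by move=> t; apply: cvgD; [exact: cs|exact: cm].
  by move=> t _; have := sqr_ge0 (u t - m); lra.
rewrite fintD// fintD// fintZ// (fint_cst 0 (ltW ab)) (fint_cst (m ^+ 2) (ltW ab)) mul0r.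
have mE : m * (b - a) = fint u a b by rewrite /m divfK// gt_eqF.
move=> h; have := ler_wpM2l (ltW ba) h; rewrite mulr0 -mE; nra.
Qed.

Lemma seg_energy k dk p v a b : a < b -> nm v = 1 -> scont dk p v a b ->
  (forall t, a <= t <= b -> hasder k (line p v t) (dk (line p v t))) ->
  nm (k (line p v b) - k (line p v a)) ^+ 2 <=
  (b - a) * fint (fun t => nm (dk (line p v t)) ^+ 2) a b.
Proof.
move=> ab v1 ck kD; rewrite -(seg_ftc ab ck kD).
apply: le_trans (fint_CS ab (scont_nm ck)).
have key := seg_nm_le ck; rewrite v1 mul1r in key.
by rewrite ler_pXn2r ?nnegrE ?nm_ge0// (le_trans (nm_ge0 _) key).
Qed.

Definition energy (dk : R[i] -> R[i]) : \bar R :=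
  (\int[mu2]_(p in @D2 R) (nm (dk (Z p)) ^+ 2)%:E)%E.

Definition density (dk : R[i] -> R[i]) : R * R -> \bar R :=
  (fun p : R * R => (nm (dk (Z p)) ^+ 2)%:E) \_ (@D2 R).

(** The energy carried by a whole horizontal line, [density] being 0 off the disc. These slices
    integrate to the energy, and each of them bounds the variation of a primitive along every
    segment of its chord. *)
Definition hslice dk (y : R) : \bar R := (\int[mu]_t density dk (t, y))%E.
Definition vslice dk (x : R) : \bar R := (\int[mu]_t density dk (x, t))%E.

Lemma density_ge0 dk (p : R * R) : (0 <= density dk p)%E.
Proof. by apply: erestrict_ge0 => q _; rewrite lee_fin sqr_ge0. Qed.

Section slices.
Variable dk : R[i] -> R[i].
Hypothesis cdk : forall z, nm z < 1 -> contat dk z.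

Lemma measurable_density : measurable_fun setT (density dk).
Proof.
apply/(measurable_restrictT _ (@D2_measurable R)); apply: measurable_nm2; first exact: open2_D2.
by move=> p; exact: cdk.
Qed.

Lemma measurable_hslice : measurable_fun setT (hslice dk).
Proof.
exact: (measurable_fun_fubini_tonelli_G (m1 := mu) _ measurable_density (density_ge0 dk)).
Qed.

Lemma measurable_vslice : measurable_fun setT (vslice dk).
Proof.
exact: (measurable_fun_fubini_tonelli_F (m2 := mu) _ measurable_density (density_ge0 dk)).
Qed.

Lemma hslice_ge0 y : (0 <= hslice dk y)%E.
Proof. by apply: integral_ge0 => x _; exact: density_ge0. Qed.

Lemma vslice_ge0 x : (0 <= vslice dk x)%E.
Proof. by apply: integral_ge0 => y _; exact: density_ge0. Qed.

Lemma energyE : (energy dk = \int[mu2]_p density dk p)%E.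
Proof. by rewrite /energy integral_mkcond. Qed.

Lemma energy_ge0 : (0 <= energy dk)%E.
Proof. by rewrite energyE; apply: integral_ge0 => x _; exact: density_ge0. Qed.

Lemma integral_hslice : (\int[mu]_y hslice dk y = energy dk)%E.
Proof.
rewrite energyE; apply/esym.
exact: (fubini_tonelli2 (m1 := mu) (m2 := mu) _ measurable_density (density_ge0 dk)).
Qed.

Lemma integral_vslice : (\int[mu]_x vslice dk x = energy dk)%E.
Proof.
rewrite energyE; apply/esym.
exact: (fubini_tonelli1 (m1 := mu) (m2 := mu) _ measurable_density (density_ge0 dk)).
Qed.

Lemma fint_hslice a b y :
  (forall t, a <= t <= b -> nm (t +i* y : R[i]) < 1) ->
  ((fint (fun t => nm (dk (line ('i * y%:C) 1 t)) ^+ 2) a b)%:E <= hslice dk y)%E.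
Proof.
move=> ht.
have cu : {within `[a, b], continuous (fun t => nm (dk (line ('i * y%:C) 1 t)) ^+ 2)}.
  by apply/within_sqr/scont_nm => t /ht; rewrite lineHE; exact: cdk.
rewrite fint_EFin//.
have -> : (\int[mu]_(t in `[a, b]) (nm (dk (line ('i * y%:C) 1 t)) ^+ 2)%:E =
   \int[mu]_(t in `[a, b]) density dk (t, y))%E.
  apply: eq_integral => t; rewrite inE /= in_itv /= => /ht t1.
  by rewrite /density patchE mem_set// lineHE.
apply: ge0_subset_integral => //.
- exact: (measurableT_comp measurable_density (pair2_measurable y)).
- by move=> t _; exact: density_ge0.
Qed.

Lemma fint_vslice a b x :
  (forall t, a <= t <= b -> nm (x +i* t : R[i]) < 1) ->
  ((fint (fun t => nm (dk (line x%:C 'i t)) ^+ 2) a b)%:E <= vslice dk x)%E.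
Proof.
move=> ht.
have cu : {within `[a, b], continuous (fun t => nm (dk (line x%:C 'i t)) ^+ 2)}.
  by apply/within_sqr/scont_nm => t /ht; rewrite lineVE; exact: cdk.
rewrite fint_EFin//.
have -> : (\int[mu]_(t in `[a, b]) (nm (dk (line x%:C 'i t)) ^+ 2)%:E =
   \int[mu]_(t in `[a, b]) density dk (x, t))%E.
  apply: eq_integral => t; rewrite inE /= in_itv /= => /ht t1.
  by rewrite /density patchE mem_set// lineVE.
apply: ge0_subset_integral => //.
- exact: (measurableT_comp measurable_density (pair1_measurable x)).
- by move=> t _; exact: density_ge0.
Qed.

End slices.

Lemma nm_lt1 (x y : R) : (nm (x +i* y : R[i]) < 1) = (x ^+ 2 + y ^+ 2 < 1).
Proof.
by rewrite -[x ^+ 2 + y ^+ 2](sqr_nm (x +i* y)) expr_lt1// nm_ge0.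
Qed.

(** Fundamental theorem of calculus and Cauchy-Schwarz on the segment. The case [a = b] is kept
    because a coordinate equal to 0 does not move when it is shrunk. *)
Lemma hslice_diff k dk a b y : holo k dk -> a <= b ->
  (forall t, a <= t <= b -> nm (t +i* y : R[i]) < 1) ->
  ((nm (k (b +i* y) - k (a +i* y)) ^+ 2)%:E <= (b - a)%:E * hslice dk y)%E.
Proof.
move=> kD; rewrite le_eqVlt => /predU1P[->|ab] ht.
  by rewrite !subrr nm0 expr0n mul0e.
have cdk z : nm z < 1 -> contat dk z by exact: holo_dcont kD.
apply: (@le_trans _ _ ((b - a)%:E * (fint (fun t => nm (dk (line ('i * y%:C) 1 t)) ^+ 2) a b)%:E)%E).
  rewrite -EFinM lee_fin -(lineHE y b) -(lineHE y a); apply: seg_energy => //; first exact: nm1.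
    by move=> t /ht; rewrite lineHE; exact: cdk.
  by move=> t /ht t1; rewrite lineHE; exact: kD.
apply: lee_wpmul2l; first by rewrite lee_fin subr_ge0 ltW.
exact: fint_hslice.
Qed.

Lemma vslice_diff k dk a b x : holo k dk -> a <= b ->
  (forall t, a <= t <= b -> nm (x +i* t : R[i]) < 1) ->
  ((nm (k (x +i* b) - k (x +i* a)) ^+ 2)%:E <= (b - a)%:E * vslice dk x)%E.
Proof.
move=> kD; rewrite le_eqVlt => /predU1P[->|ab] ht.
  by rewrite !subrr nm0 expr0n mul0e.
have cdk z : nm z < 1 -> contat dk z by exact: holo_dcont kD.
apply: (@le_trans _ _ ((b - a)%:E * (fint (fun t => nm (dk (line x%:C 'i t)) ^+ 2) a b)%:E)%E).
  rewrite -EFinM lee_fin -(lineVE x b) -(lineVE x a); apply: seg_energy => //; first exact: nmi.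
    by move=> t /ht; rewrite lineVE; exact: cdk.
  by move=> t /ht t1; rewrite lineVE; exact: kD.
apply: lee_wpmul2l; first by rewrite lee_fin subr_ge0 ltW.
exact: fint_vslice.
Qed.

End energy.

Section poincare.
Variable R : realType.
Notation mu := (@lebesgue_measure R).
Notation mu2 := (mu \x mu)%E.
Implicit Types (a b r s x y t : R) (k dk : R[i] -> R[i]) (v z w : R[i]).

Lemma sqr_nm_le z w : nm z ^+ 2 <= 2 * nm w ^+ 2 + 2 * nm (z - w) ^+ 2.
Proof.
have h : nm z <= nm w + nm (z - w) by rewrite -{1}(subrK w z) addrC nmD.
have := nm_ge0 z; have := nm_ge0 w; have := nm_ge0 (z - w).
have := sqr_ge0 (nm w - nm (z - w)); nra.
Qed.

(** The factor 2 is the side of the box in the direction on which the integrand does not depend. *)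
Lemma box_slice2 (j : R -> \bar R) : measurable_fun setT j -> (forall y, 0 <= j y)%E ->
  (\int[mu2]_(p in csq 0%R 1%R) j p.2 <= 2%:E * \int[mu]_y j y)%E.
Proof.
move=> mj j0; rewrite integral_mkcond.
set F := _ \_ _.
have F0 p : (0 <= F p)%E by apply: erestrict_ge0.
have mF : measurable_fun setT F.
  apply/(measurable_restrictT _ (csq_measurable 0 1)); apply: measurable_funTS.
  exact: measurableT_comp.
have I0 : (0 <= \int[mu]_y j y)%E by apply: integral_ge0.
rewrite (fubini_tonelli1 (m1 := mu) (m2 := mu) F mF F0).
have -> : (2%:E * \int[mu]_y j y = \int[mu]_(x in `[(- 1)%R, 1%R]) (cst (\int[mu]_y j y) x))%E.
  rewrite integral_cst//= lebesgue_measure_itv /= lte_fin ifT; last by lra.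
  by rewrite -EFinB muleC; congr (_ * _%:E)%E; lra.
rewrite [leRHS]integral_mkcond.
apply: ge0_le_integral => //.
- by move=> x _; apply: integral_ge0.
- exact: (measurable_fun_fubini_tonelli_F (m2 := mu) F mF F0).
- by apply/(measurable_restrictT _ (measurable_itv _)); exact: measurable_cst.
move=> x _; rewrite /fubini_F patchE; case: ifPn => [_|xn].
  apply: ge0_le_integral => //.
  - exact: (measurableT_comp mF (pair1_measurable x)).
  - by move=> y _; rewrite /F patchE; case: ifPn.
rewrite integral0_eq// => y _; rewrite /F patchE memNset// => -[h _].
move: xn; rewrite notin_setE; apply; rewrite /= in_itv /=.
by move: h; rewrite /= subr0 ler_norml.
Qed.

Lemma box_slice1 (j : R -> \bar R) : measurable_fun setT j -> (forall y, 0 <= j y)%E ->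
  (\int[mu2]_(p in csq 0%R 1%R) j p.1 <= 2%:E * \int[mu]_y j y)%E.
Proof.
move=> mj j0; rewrite integral_mkcond.
set F := _ \_ _.
have F0 p : (0 <= F p)%E by apply: erestrict_ge0.
have mF : measurable_fun setT F.
  apply/(measurable_restrictT _ (csq_measurable 0 1)); apply: measurable_funTS.
  exact: measurableT_comp.
have I0 : (0 <= \int[mu]_y j y)%E by apply: integral_ge0.
rewrite (fubini_tonelli2 (m1 := mu) (m2 := mu) F mF F0).
have -> : (2%:E * \int[mu]_y j y = \int[mu]_(x in `[(- 1)%R, 1%R]) (cst (\int[mu]_y j y) x))%E.
  rewrite integral_cst//= lebesgue_measure_itv /= lte_fin ifT; last by lra.
  by rewrite -EFinB muleC; congr (_ * _%:E)%E; lra.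
rewrite [leRHS]integral_mkcond.
apply: ge0_le_integral => //.
- by move=> x _; apply: integral_ge0.
- exact: (measurable_fun_fubini_tonelli_G (m1 := mu) F mF F0).
- by apply/(measurable_restrictT _ (measurable_itv _)); exact: measurable_cst.
move=> x _; rewrite /fubini_G patchE; case: ifPn => [_|xn].
  apply: ge0_le_integral => //.
  - exact: (measurableT_comp mF (pair2_measurable x)).
  - by move=> y _; rewrite /F patchE; case: ifPn.
rewrite integral0_eq// => y _; rewrite /F patchE memNset// => -[_ h].
move: xn; rewrite notin_setE; apply; rewrite /= in_itv /=.
by move: h; rewrite /= subr0 ler_norml.
Qed.

Lemma nm_le_r x y r : 0 <= r -> x ^+ 2 + y ^+ 2 <= r ^+ 2 -> nm (x +i* y : R[i]) <= r.
Proof.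
move=> r0 h; rewrite -(@ler_pXn2r _ 2)// ?nnegrE ?nm_ge0//.
by rewrite (sqr_nm (x +i* y)).
Qed.

(* Each point of the disc moves into a smaller disc by shrinking one of its coordinates by the
   factor [1 - th]; the variation of [k] along that segment is controlled by Cauchy-Schwarz. *)
Lemma poincare (th : R) : 0 < th < 1 ->
  exists2 rho : R, 0 < rho < 1 & forall k dk s, holo k dk -> 0 <= s ->
   (forall z, nm z <= rho -> nm (k z) <= s) ->
   (\int[mu2]_(p in @D2 R) (nm (k (Z p)) ^+ 2)%:E <=
     (8 * s ^+ 2)%:E + (8 * th)%:E * energy dk)%E.
Proof.
move=> /andP[th0 th1]; pose q := 2 * th - th ^+ 2.
have q0 : 0 < q by rewrite /q; nra.
have q1 : q < 1 by rewrite /q; nra.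
(* Here [1 - q = (1 - th) ^+ 2]. If the coordinate left alone is at most 4/5, the moved point has
   squared modulus at most [(1 - q) + q * (16 / 25) = 1 - q * (9 / 25)], which is at most
   [rho ^+ 2]. *)
pose rho := 1 - q * (9 / 50).
have rho1 : 0 < rho < 1 by rewrite /rho; apply/andP; split; lra.
exists rho => // k dk s kD s0 ks.
have cdk z : nm z < 1 -> contat dk z by exact: holo_dcont kD.
have inner x y : x ^+ 2 + y ^+ 2 < 1 -> `|y| <= 4 / 5 ->
    ((1 - th) * x) ^+ 2 + y ^+ 2 <= rho ^+ 2.
  move=> h1; rewrite ler_norml => /andP[y1 y2].
  have y3 : y ^+ 2 <= 16 / 25 by nra.
  have -> : ((1 - th) * x) ^+ 2 + y ^+ 2 = (1 - q) * (x ^+ 2 + y ^+ 2) + q * y ^+ 2.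
    by rewrite /q; ring.
  apply: (@le_trans _ _ ((1 - q) * 1 + q * (16 / 25))).
    by apply: lerD; rewrite ler_pM2l// ?subr_gt0// ltW.
  have := sqr_ge0 (q * (9 / 50)); rewrite /rho; lra.
have between x t : (x <= t <= (1 - th) * x) || ((1 - th) * x <= t <= x) -> t ^+ 2 <= x ^+ 2.
  move=> h; have h' : `|t| <= `|x|.
    by case/orP: h => /andP[h1 h2]; have [x0|x0] := leP 0 x;
      rewrite ?(ger0_norm x0) ?(ltr0_norm x0) ler_norml; apply/andP; split; nra.
  by rewrite -(real_normK (num_real t)) -(real_normK (num_real x)) ler_pXn2r.
have absx x y : x ^+ 2 + y ^+ 2 < 1 -> -1 < x < 1 by move=> h; apply/andP; split; nra.
have ptw x y : x ^+ 2 + y ^+ 2 < 1 ->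
   ((nm (k (x +i* y)) ^+ 2)%:E <= (2 * s ^+ 2)%:E + (2 * th)%:E * (hslice dk y + vslice dk x))%E.
  move=> h.
  have J0 := hslice_ge0 dk y; have J'0 := vslice_ge0 dk x.
  suff [w [ws wd]] : exists w, nm (k w) <= s /\
      ((nm (k (x +i* y) - k w) ^+ 2)%:E <= th%:E * (hslice dk y + vslice dk x))%E.
    have h1 : (2%:E * (nm (k (x +i* y) - k w) ^+ 2)%:E <=
        2%:E * (th%:E * (hslice dk y + vslice dk x)))%E by apply: lee_wpmul2l.
    rewrite muleA -!EFinM in h1.
    apply: (@le_trans _ _ ((2 * s ^+ 2)%:E + (2 * nm (k (x +i* y) - k w) ^+ 2)%:E)%E); last first.
      by apply: leeD.
    rewrite -EFinD lee_fin; apply: le_trans (sqr_nm_le _ (k w)) _.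
    by rewrite lerD2r ler_pM2l// ler_pXn2r ?nnegrE ?nm_ge0.
  have x1 := absx _ _ h; have y1 : -1 < y < 1 by apply: (absx y x); rewrite addrC.
  (* One of the coordinates is at most 4/5 in absolute value, as [2 * (16 / 25) > 1]; the other one
     is shrunk. *)
  have [hy|hy] := leP `|y| (4 / 5).
    exists (((1 - th) * x) +i* y); split.
      apply: ks; apply: nm_le_r; [lra|exact: inner].
    apply: (@le_trans _ _ (th%:E * hslice dk y)%E); last first.
      by apply: lee_wpmul2l; [rewrite lee_fin ltW|rewrite leeDl].
    have [x0|x0] := leP 0 x.
      apply: le_trans (hslice_diff (a := (1 - th) * x) kD _ _) _; [nra| |].
        by move=> t ht; rewrite nm_lt1; have := between x t; rewrite ht orbT => /(_ isT); lra.
      by apply: lee_wpmul2r => //; rewrite lee_fin; nra.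
    rewrite nm_distC.
    apply: le_trans (hslice_diff (b := (1 - th) * x) kD _ _) _; [nra| |].
      by move=> t ht; rewrite nm_lt1; have := between x t; rewrite ht => /(_ isT); lra.
    by apply: lee_wpmul2r => //; rewrite lee_fin; nra.
  have hx : `|x| <= 4 / 5.
    rewrite leNgt; apply/negP => hx.
    have e1 := real_normK (num_real x); have e2 := real_normK (num_real y); nra.
  have h' : y ^+ 2 + x ^+ 2 < 1 by rewrite addrC.
  exists (x +i* ((1 - th) * y)); split.
    apply: ks; apply: nm_le_r; [lra|rewrite addrC; exact: inner].
  apply: (@le_trans _ _ (th%:E * vslice dk x)%E); last first.
    by apply: lee_wpmul2l; [rewrite lee_fin ltW|rewrite leeDr].
  have [y0|y0] := leP 0 y.
    apply: le_trans (vslice_diff (a := (1 - th) * y) kD _ _) _; [nra| |].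
      by move=> t ht; rewrite nm_lt1; have := between y t; rewrite ht orbT => /(_ isT); lra.
    by apply: lee_wpmul2r => //; rewrite lee_fin; nra.
  rewrite nm_distC.
  apply: le_trans (vslice_diff (b := (1 - th) * y) kD _ _) _; [nra| |].
    by move=> t ht; rewrite nm_lt1; have := between y t; rewrite ht => /(_ isT); lra.
  by apply: lee_wpmul2r => //; rewrite lee_fin; nra.
have mh := measurable_hslice cdk; have mv := measurable_vslice cdk.
have h0 := hslice_ge0 dk; have v0 := vslice_ge0 dk.
have mh2 : measurable_fun setT (fun p : R * R => hslice dk p.2) by exact: measurableT_comp.
have mv1 : measurable_fun setT (fun p : R * R => vslice dk p.1) by exact: measurableT_comp.
pose g2 (p : R * R) := (hslice dk p.2 + vslice dk p.1)%E.
have mg2 : measurable_fun setT g2 by exact: emeasurable_funD.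
have g20 p : (0 <= g2 p)%E by exact: adde_ge0.
pose g (p : R * R) := ((2 * s ^+ 2)%:E + (2 * th)%:E * g2 p)%E.
have mg3 : measurable_fun setT (fun p => (2 * th)%:E * g2 p)%E by exact: measurable_funeM.
have g30 p : (0 <= (2 * th)%:E * g2 p)%E by rewrite mule_ge0// lee_fin mulr_ge0// ltW.
have mg : measurable_fun setT g by exact: emeasurable_funD.
have g0 p : (0 <= g p)%E by rewrite adde_ge0// lee_fin mulr_ge0 ?sqr_ge0.
have mbox := csq_measurable (0 : R[i]) (1 : R).
apply: (@le_trans _ _ (\int[mu2]_(p in @D2 R) g p)%E).
  apply: ge0_le_integral; first exact: D2_measurable.
  - by move=> p _; rewrite lee_fin sqr_ge0.
  - apply: measurable_nm2; first exact: open2_D2.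
    by move=> p Dp; exact: hasder_contat (kD _ Dp).
  - exact: measurable_funTS mg.
  - by move=> p Dp; apply: ptw; rewrite -nm_lt1.
apply: (@le_trans _ _ (\int[mu2]_(p in csq 0%R 1%R) g p)%E).
  apply: ge0_subset_integral; [exact: D2_measurable|exact: mbox|exact: measurable_funTS mg|by []|].
  move=> p Dp; rewrite /D2 /mkset in Dp; rewrite /csq /mkset /= !subr0; split.
    exact: le_trans (Re_le_nm (Z p)) (ltW Dp).
  exact: le_trans (Im_le_nm (Z p)) (ltW Dp).
rewrite ge0_integralD; last 5 first.
- exact: mbox.
- by move=> p _; rewrite lee_fin mulr_ge0 ?sqr_ge0.
- exact: measurable_cst.
- by move=> p _; exact: g30.
- exact: measurable_funTS mg3.
apply: leeD.
  rewrite -[X in (X <= _)%E]/(\int[mu2]_(p in csq 0%R 1%R) (cst (2 * s ^+ 2)%:E p))%E.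
  rewrite integral_cst; last exact: mbox.
  rewrite [X in (_ * X)%E](csq_measure _ ltr01) -EFinM lee_fin.
  by rewrite expr1n mulr1; lra.
rewrite ge0_integralZl_EFin; last 4 first.
- exact: mbox.
- by move=> p _; exact: g20.
- exact: measurable_funTS mg2.
- by rewrite mulr_ge0// ltW.
have -> : 8 * th = (2 * th) * 4 by ring.
rewrite (EFinM (2 * th)) -muleA; apply: lee_wpmul2l; first by rewrite lee_fin mulr_ge0// ltW.
rewrite ge0_integralD; last 5 first.
- exact: mbox.
- by move=> p _; exact: h0.
- exact: measurable_funTS mh2.
- by move=> p _; exact: v0.
- exact: measurable_funTS mv1.
have E0 := energy_ge0 dk.
have -> : (4%:E * energy dk = 2%:E * energy dk + 2%:E * energy dk)%E.
  by rewrite -ge0_muleDl ?lee_fin// -EFinD; congr (_%:E * _)%E; lra.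
apply: leeD.
  by rewrite -(integral_hslice cdk); exact: box_slice2.
by rewrite -(integral_vslice cdk); exact: box_slice1.
Qed.

End poincare.

(** * Circular means *)

Section circle.
Variable R : realType.
Notation mu := (@lebesgue_measure R).
Notation mu2 := (mu \x mu)%E.
Implicit Types (a b r s x y t : R) (k dk : R[i] -> R[i]) (v z w : R[i]).

Lemma eps_continuous (u : R -> R) t : {for t, continuous u} -> forall e, 0 < e ->
  exists2 d, 0 < d & forall x, `|x - t| < d -> `|u x - u t| < e.
Proof.
move=> /cvgrPdist_lt H e e0; have /nbhs_ballP[d /= d0 Hd] := H _ e0.
by exists d => // x xt; rewrite distrC; apply: Hd; rewrite /ball /= distrC.
Qed.

Definition pcont (p : R -> R[i]) t := forall e, 0 < e -> exists2 d, 0 < d &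
  forall x, `|x - t| < d -> nm (p x - p t) < e.

Lemma pcont_pair (u v : R -> R) t : {for t, continuous u} -> {for t, continuous v} ->
  pcont (fun x => u x +i* v x) t.
Proof.
move=> cu cv e e0; have e2 : 0 < e / 2 by lra.
have [d1 d10 H1] := eps_continuous cu e2; have [d2 d20 H2] := eps_continuous cv e2.
exists (Num.min d1 d2); first by rewrite lt_min d10.
move=> x; rewrite lt_min => /andP[/H1 h1 /H2 h2].
by apply: le_lt_trans (nm_le_ReIm _) _; rewrite /=; lra.
Qed.

Lemma pcont_comp k p t : pcont p t -> contat k (p t) -> pcont (fun x => k (p x)) t.
Proof.
move=> cp ck e e0; have [d d0 H] := ck _ e0; have [d1 d10 H1] := cp _ d0.
by exists d1 => // x /H1 /H.
Qed.

Lemma pcontB p1 p2 t : pcont p1 t -> pcont p2 t -> pcont (fun x => p1 x - p2 x) t.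
Proof.
move=> c1 c2 e e0; have e2 : 0 < e / 2 by lra.
have [d1 d10 H1] := c1 _ e2; have [d2 d20 H2] := c2 _ e2.
exists (Num.min d1 d2); first by rewrite lt_min d10.
move=> x; rewrite lt_min => /andP[/H1 h1 /H2 h2].
rewrite (_ : _ - _ = (p1 x - p1 t) - (p2 x - p2 t)); last by ring.
by apply: le_lt_trans (nmB _ _) _; lra.
Qed.

Lemma pcont_within p a b : (forall t, a <= t <= b -> pcont p t) ->
  {within `[a, b], continuous (fun t => nm (p t) ^+ 2)}.
Proof.
move=> H; apply: within_sqr; apply: within_eps => t /H ct e /ct[d d0 Hd].
by exists d => // x _ /Hd; apply: le_lt_trans; exact: nm_lip.
Qed.

Definition circ r t : R[i] := (r * cos t) +i* (r * sin t).

Lemma nm_circ r t : 0 <= r -> nm (circ r t) = r.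
Proof.
move=> r0; apply/eqP; rewrite -(@eqrXn2 _ 2) ?nm_ge0//.
by rewrite (sqr_nm (circ r t)) /= !exprMn -mulrDr cos2Dsin2 mulr1.
Qed.

Lemma pcont_circ r t : pcont (circ r) t.
Proof.
apply: pcont_pair; apply: cvgM; do ?exact: cvg_cst; [exact: continuous_cos|exact: continuous_sin].
Qed.

Lemma cos_quarter : cos (pi / 4 : R) ^+ 2 = 2^-1.
Proof.
have := cos_mulr2n (pi / 4 : R); rewrite (_ : pi / 4 *+ 2 = pi / 2); last by rewrite mulr2n; lra.
by rewrite cos_pihalf mulr2n => h; lra.
Qed.

Lemma cos_ge_quarter t : `|t| <= pi / 4 -> 2^-1 <= cos t ^+ 2 /\ 2^-1 <= cos t.
Proof.
move=> ht; have p0 := pi_gt0 R.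
have c0 : 0 < cos (pi / 4 : R) by apply: cos_gt0_pihalf; apply/andP; split; lra.
have : cos (pi / 4 : R) <= cos t.
  rewrite -(cos_norm t) leNgt ltr_cos ?in_itv /=; first by rewrite -leNgt.
    by apply/andP; split; lra.
  by apply/andP; split; [exact: normr_ge0|lra].
have := cos_quarter => h1 h2; split; nra.
Qed.

Lemma fint_shift (u : R -> R) c a b : {within `[c + a, c + b], continuous u} ->
  {within `[a, b], continuous (fun t => u (c + t))} ->
  (forall t, 0 <= u t) ->
  fint u (c + a) (c + b) = fint (fun t => u (c + t)) a b.
Proof.
move=> cu cu' u0; apply: EFin_inj; rewrite !fint_EFin// integral_mkcond [RHS]integral_mkcond.
rewrite -(integral_translation c); last 2 first.
- apply/(measurable_restrictT _ (measurable_itv _)); apply/measurable_EFinP.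
  exact: subspace_continuous_measurable_fun.
- by move=> x; apply: erestrict_ge0 => t _; rewrite lee_fin.
apply: eq_integral => x _; rewrite !patchE.
by congr (if _ then _ else _); apply/idP/idP; rewrite !inE /= !in_itv /= !lerD2l.
Qed.

(* The arc [|t| <= pi / 4] is a graph over the vertical axis: compare [k] with its values on the
   vertical axis along horizontal segments, and substitute [y = r sin t]. *)
Lemma arc_bound k dk s E r : holo k dk -> 0 <= s ->
  (forall z, nm z <= 9 / 10 -> nm (k z) <= s) ->
  (energy dk <= E%:E)%E -> 2^-1 <= r < 1 ->
  fint (fun t => nm (k (circ r t)) ^+ 2) (- (pi / 4)) (pi / 4) <= pi * s ^+ 2 + 8 * E.
Proof.
move=> kD s0 ks HE /andP[r2 r1]; have p0 := pi_gt0 R.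
set q := pi / 4; have q0 : 0 < q by rewrite /q; lra.
have qq : - q <= q by lra.
have cdk z : nm z < 1 -> contat dk z by exact: holo_dcont kD.
(* The squared variation of [k] along the horizontal segment from the vertical axis to the circle at
   height [y]; that segment is shorter than 1, so [hslice dk y] bounds it. *)
pose A y := nm (k (Num.sqrt (r ^+ 2 - y ^+ 2) +i* y) - k (0 +i* y)) ^+ 2.
pose F t := r * sin t.
have dF t : is_derive t 1 F (r * cos t) by exact: is_deriveZ.
have F' : F^`() = (fun t => r * cos t).
  by apply/funext => t; rewrite derive1E; have [_ ->] := dF t.
have ct t : - q <= t <= q -> 2^-1 <= cos t ^+ 2 /\ 2^-1 <= cos t.
  by move=> ht; apply: cos_ge_quarter; rewrite ler_norml.
have r0 : 0 < r by lra.
have sq1 y : y ^+ 2 < r ^+ 2 -> nm (Num.sqrt (r ^+ 2 - y ^+ 2) +i* y : R[i]) < 1 /\ nm (0 +i* y : R[i]) < 1.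
  move=> h; rewrite !nm_lt1 sqr_sqrtr ?subr_ge0 ?ltW// expr0n subrK add0r.
  by split; nra.
have Fq y : F (- q) <= y <= F q -> y ^+ 2 < r ^+ 2.
  rewrite /F sinN mulrN => /andP[h1 h2]; have [c1 _] := ct q ltac:(lra).
  have := cos2Dsin2 q => e; have : `|y| <= `|r * sin q|.
    by rewrite ler_norml; apply/andP; split; have := ler_norm (r * sin q); lra.
  rewrite -(@ler_pXn2r _ 2)// ?nnegrE// !real_normK ?num_real// exprMn => h.
  apply: le_lt_trans h _; rewrite gtr_pMr ?exprn_gt0//; lra.
have cA : {within `[F (- q), F q], continuous A}.
  apply: (pcont_within (p := fun y => k (Num.sqrt (r ^+ 2 - y ^+ 2) +i* y) - k (0 +i* y))).
  move=> y /Fq /sq1 [h1 h2]; apply: pcontB.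
    apply: (pcont_comp (p := fun y => Num.sqrt (r ^+ 2 - y ^+ 2) +i* y)).
      apply: pcont_pair; last exact: cvg_id.
      apply: (@continuous_comp _ _ _ (fun y => r ^+ 2 - y ^+ 2) Num.sqrt).
        by apply: cvgB; [exact: cvg_cst|apply: exprn_continuous].
      exact: sqrt_continuous.
    exact: hasder_contat (kD _ h1).
  apply: (pcont_comp (p := fun y => 0 +i* y)).
    by apply: pcont_pair; [exact: cvg_cst|exact: cvg_id].
  exact: hasder_contat (kD _ h2).
have incF : {in `[- q, q]%R &, {homo F : x y / x < y}}.
  have sub t : t \in `[- q, q]%R -> t \in `[- (pi / 2), pi / 2]%R.
    by rewrite !in_itv /= /q => /andP[? ?]; apply/andP; split; lra.
  by move=> x y /sub hx /sub hy xy; rewrite /F ltr_pM2l// ltr_sin.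
have cF t : {for t, continuous F}.
  by apply: differentiable_continuous; apply/derivable1_diffP; have [] := dF t.
have cF' t : {for t, continuous (fun t => r * cos t)}.
  by apply: cvgM; [exact: cvg_cst|exact: continuous_cos].
have sub := @integration_by_substitution_increasing R F A (- q) q qq incF.
have {}sub : (\int[mu]_(x in `[F (- q)%R, F q]) (A x)%:E =
    \int[mu]_(x in `[(- q)%R, q]) (((A \o F) * F^`()%classic) x)%:E)%E.
  apply: sub => //.
  - by rewrite F' => t _; exact: cF'.
  - by rewrite F'; apply/cvg_ex; exists (r * cos (- q)); exact: cvg_at_right_filter (cF' _).
  - by rewrite F'; apply/cvg_ex; exists (r * cos q); exact: cvg_at_left_filter (cF' _).
  - split.
    + by move=> t _; have [] := dF t.
    + exact: cvg_at_right_filter (cF _).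
    + exact: cvg_at_left_filter (cF _).
have areaA : (\int[mu]_(x in `[F (- q)%R, F q]) (A x)%:E <= E%:E)%E.
  apply: le_trans HE; rewrite -(integral_hslice cdk).
  apply: (@le_trans _ _ (\int[mu]_(x in `[F (- q)%R, F q]) hslice dk x)%E); last first.
    apply: ge0_subset_integral => //; first exact: (measurable_hslice cdk).
    by move=> y _; exact: hslice_ge0.
  apply: ge0_le_integral => //.
  - by move=> y _; rewrite lee_fin sqr_ge0.
  - by apply/measurable_EFinP; exact: subspace_continuous_measurable_fun.
  - exact: measurable_funTS (measurable_hslice cdk).
  - move=> y; rewrite /= in_itv /= => /Fq yr.
    have s1 : Num.sqrt (r ^+ 2 - y ^+ 2) <= 1.
      rewrite -[leRHS]sqrtr1 ler_wsqrtr//; nra.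
    apply: le_trans (hslice_diff kD (sqrtr_ge0 _) _) _.
      move=> t /andP[t0 t1]; rewrite nm_lt1.
      have : t ^+ 2 <= r ^+ 2 - y ^+ 2.
        have h : 0 <= r ^+ 2 - y ^+ 2 by rewrite subr_ge0 ltW.
        by rewrite -(sqr_sqrtr h) ler_pXn2r ?nnegrE ?sqrtr_ge0.
      nra.
    rewrite subr0 -[leRHS]mul1e; apply: lee_wpmul2r; first exact: hslice_ge0.
    by rewrite lee_fin.
pose B t := nm (k (circ r t) - k (0 +i* F t)) ^+ 2.
have circ1 t : nm (circ r t) < 1 by rewrite nm_circ// ltW.
(* The second bound puts the points [0 +i* F t] of the axis within the disc of radius 9/10, where
   [s] bounds [k]. *)
have Flt t : - q <= t <= q -> F t ^+ 2 < r ^+ 2 /\ F t ^+ 2 <= 2^-1.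
  move=> /ct[c1 _]; have := cos2Dsin2 t; rewrite /F exprMn => e.
  have s2 : sin t ^+ 2 <= 2^-1 by lra.
  have := sqr_ge0 (sin t); split; last by nra.
  by rewrite gtr_pMr ?exprn_gt0//; lra.
have cP : {within `[- q, q], continuous (fun t => nm (k (circ r t)) ^+ 2)}.
  apply: (pcont_within (p := fun t => k (circ r t))) => t _.
  by apply: pcont_comp (pcont_circ r t) _; exact: hasder_contat (kD _ (circ1 t)).
have cB : {within `[- q, q], continuous B}.
  apply: (pcont_within (p := fun t => k (circ r t) - k (0 +i* F t))) => t ht.
  apply: pcontB.
    by apply: pcont_comp (pcont_circ r t) _; exact: hasder_contat (kD _ (circ1 t)).
  apply: (pcont_comp (p := fun t => 0 +i* F t)).
    by apply: pcont_pair; [exact: cvg_cst|exact: cF].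
  by have [_ ?] := sq1 _ (Flt _ ht).1; exact: hasder_contat (kD _ _).
have cBc : {within `[- q, q], continuous (fun t => B t * (r * cos t))}.
  move=> t; apply: cvgM; first exact: cB.
  by apply: (continuous_subspaceT (f := fun t => r * cos t)); exact: cF'.
have Bint : fint (fun t => B t * (r * cos t)) (- q) q <= E.
  rewrite -lee_fin fint_EFin//; apply: le_trans areaA; rewrite sub.
  rewrite le_eqVlt; apply/orP; left; apply/eqP; apply: eq_integral => t.
  rewrite inE /= in_itv /= => ht; rewrite F'; congr EFin; rewrite !fctE; congr (_ * _).
  have [_ c2] := ct _ ht; rewrite /B /A; congr (nm (k _ - _) ^+ 2); congr (_ +i* _).
  rewrite /F exprMn -{1}(mulr1 (r ^+ 2)) -(cos2Dsin2 t) mulrDr addrK -exprMn sqrtr_sqr.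
  by rewrite ger0_norm// mulr_ge0//; lra.
have c2s : {within `[- q, q], continuous (fun=> 2 * s ^+ 2 : R)} by move=> t; exact: cvg_cst.
have c8 : {within `[- q, q], continuous (fun t => 8 * (B t * (r * cos t)))}.
  by move=> t; apply: cvgM; [exact: cvg_cst|exact: cBc].
(* Both [r] and [cos t] are at least 1/2, so the Jacobian [r * cos t] of the substitution is at
   least 1/4 and [2 * B t <= 8 * (B t * (r * cos t))]. *)
apply: (@le_trans _ _ (fint (fun t => 2 * s ^+ 2 + 8 * (B t * (r * cos t))) (- q) q)).
  apply: fint_le => //; first by move=> t; apply: cvgD; [exact: c2s|exact: c8].
  move=> t ht; apply: le_trans (sqr_nm_le _ (k (0 +i* F t))) _; apply: lerD.
    rewrite ler_pM2l// ler_pXn2r ?nnegrE ?nm_ge0//; apply: ks.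
    apply: nm_le_r; first lra.
    by have [_ h] := Flt _ ht; rewrite expr0n add0r; lra.
  rewrite -/(B t); have [_ c2] := ct _ ht; have : 0 <= B t by exact: sqr_ge0.
  move=> B0; have h4 : 1 <= 4 * (r * cos t) by nra.
  by have := ler_wpM2l B0 h4; lra.
rewrite fintD// (fint_cst (2 * s ^+ 2) qq) fintZ//; apply: lerD; last by rewrite ler_pM2l.
by rewrite /q le_eqVlt; apply/orP; left; apply/eqP; field.
Qed.

End circle.

Section hardy.
Variable R : realType.
Notation mu := (@lebesgue_measure R).
Notation mu2 := (mu \x mu)%E.
Implicit Types (a b r s x y t : R) (k dk : R[i] -> R[i]) (v z w : R[i]).

Lemma holo_der_fun f df : @holo R f df -> exists ddf, holo df ddf.
Proof.
move=> fD; have /choice[ddf H] : forall z, exists e, nm z < 1 -> hasder df z e.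
  move=> z; have [/(holo_der fD)[e ?]|nz] := pselect (nm z < 1); first by exists e.
  by exists 0.
by exists ddf.
Qed.

Lemma cvC_ge0 : 0 <= cvC R.
Proof. by rewrite /cvC mulr_ge0// exprn_ge0. Qed.

(** A rotation is injective with constant derivative, so [change_of_variables_le] applies to it;
    losing the factor [cvC R] is harmless. *)
Lemma rotation k dk w : holo k dk -> nm w = 1 ->
  holo (fun z => k (w * z)) (fun z => w * dk (w * z)) /\
  (energy (fun z => (w * dk (w * z))%R)  <= (cvC R)%:E * energy dk)%E.
Proof.
move=> kD w1.
have wD z : nm z < 1 -> hasder (fun z => w * z) z w.
  by move=> _; have := hasderZ w (hasder_id z); rewrite mulr1.
have wz z : nm z < 1 -> nm (w * z) < 1 by rewrite nmM w1 mul1r.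
split.
  by move=> z z1; rewrite mulrC; exact: hasder_comp (wD z z1) (kD _ (wz _ z1)).
have [ddk dkD] := holo_der_fun kD.
have w0 : w != 0 by rewrite -nm_gt0 w1.
have inj z1 z2 : nm z1 < 1 -> nm z2 < 1 -> w * z1 = w * z2 -> z1 = z2.
  by move=> _ _; apply: mulfI.
have lip z1 z2 : nm z1 < 1 -> nm z2 < 1 -> nm (w - w) <= 1 * nm (z1 - z2).
  by move=> _ _; rewrite subrr nm0 mul1r nm_ge0.
apply: le_trans (change_of_variables_le wD wz inj ltr01 lip dkD).
rewrite /energy le_eqVlt; apply/orP; left; apply/eqP.
by apply: eq_integral => p _; rewrite w1 expr1n mulr1 nmM w1 mul1r.
Qed.

Lemma circ_rot r (j : nat) t : circ r (j%:R * (pi / 2) + t) = 'i ^+ j * circ r t.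
Proof.
elim: j t => [|j IH] t; first by rewrite mul0r add0r expr0 mul1r.
have -> : j.+1%:R * (pi / 2) + t = j%:R * (pi / 2) + (t + pi / 2).
  by rewrite -natr1; ring.
rewrite IH exprSr -mulrA; congr (_ * _).
rewrite /circ cosDpihalf sinDpihalf.
by apply/eqP; rewrite eq_complex /=; apply/andP; split; apply/eqP; ring.
Qed.

(** A circle of radius below 1/2 lies where [s] bounds [k]. A larger one is covered by five quarter
    arcs centred at the multiples of [pi / 2] from 0 to [2 * pi], each a rotated copy of the arc of
    [arc_bound]; [pi >= 2] then absorbs [5 * 8] into [2 * pi * 10]. *)
Lemma circle_bound k dk s E r : holo k dk -> 0 <= s ->
  (forall z, nm z <= 9 / 10 -> nm (k z) <= s) -> 0 <= E ->
  (energy dk <= E%:E)%E -> 0 <= r < 1 ->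
  fint (fun t => nm (k (circ r t)) ^+ 2) 0 (2 * pi) <= 2 * pi * (3 * s ^+ 2 + 10 * (cvC R * E)).
Proof.
move=> kD s0 ks E0 HE /andP[r0 r1]; have p0 := pi_gt0 R; have p2 := pi_ge2 R.
pose P t := nm (k (circ r t)) ^+ 2.
have circ1 t : nm (circ r t) < 1 by rewrite nm_circ.
have cP a b : {within `[a, b], continuous P}.
  apply: (pcont_within (p := fun t => k (circ r t))) => t _.
  by apply: pcont_comp (pcont_circ r t) _; exact: hasder_contat (kD _ (circ1 t)).
have P0 t : 0 <= P t by exact: sqr_ge0.
have fint0 a b : a <= b -> 0 <= fint P a b.
  move=> ab; have <- : fint (fun=> 0) a b = 0 by rewrite fint_cst// mul0r.
  by apply: fint_le => // t; exact: cvg_cst.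
have CE : 0 <= cvC R * E by rewrite mulr_ge0// cvC_ge0.
have s20 := sqr_ge0 s.
have [r2|r2] := ltP r 2^-1.
  apply: (@le_trans _ _ (fint (fun=> s ^+ 2) 0 (2 * pi))).
    apply: fint_le; [exact: cP|by move=> t; exact: cvg_cst|move=> t _].
    by rewrite ler_pXn2r ?nnegrE ?nm_ge0// ks// nm_circ//; lra.
  rewrite fint_cst; last by lra.
  by rewrite subr0 mulrC ler_pM2l; [lra|lra].
pose q : R := pi / 4.
have piece (j : nat) : fint P (j%:R * (pi / 2) + - q) (j%:R * (pi / 2) + q) <=
    pi * s ^+ 2 + 8 * (cvC R * E).
  have wj : nm ('i ^+ j : R[i]) = 1 by rewrite nmX nmi expr1n.
  have [kjD Ej] := rotation kD wj.
  have PE t : P (j%:R * (pi / 2) + t) = nm (k ('i ^+ j * circ r t)) ^+ 2 by rewrite /P circ_rot.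
  rewrite fint_shift//; last first.
    rewrite (_ : (fun t => _) = (fun t => nm (k ('i ^+ j * circ r t)) ^+ 2)); last exact/funext.
    apply: (pcont_within (p := fun t => k ('i ^+ j * circ r t))) => t _.
    apply: (pcont_comp (k := fun z => k ('i ^+ j * z))) (pcont_circ r t) _.
    exact: hasder_contat (kjD _ (circ1 t)).
  rewrite (_ : (fun t => _) = (fun t => nm (k ('i ^+ j * circ r t)) ^+ 2)); last exact/funext.
  apply: (arc_bound (k := fun z => k ('i ^+ j * z)) kjD) => //.
  - by move=> z hz; apply: ks; rewrite nmM wj mul1r.
  - have c0 : (0 <= (cvC R)%:E)%E by rewrite lee_fin cvC_ge0.
    exact: le_trans Ej (lee_wpmul2l c0 HE).
  - by rewrite r2.
have S (j : nat) : fint P (- q) (j%:R * (pi / 2) + q) <=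
    j.+1%:R * (pi * s ^+ 2 + 8 * (cvC R * E)).
  elim: j => [|j IH].
    by have := piece 0%N; rewrite !mul0r !add0r mul1r.
  have jp : 0 <= j%:R * (pi / 2) :> R by rewrite mulr_ge0//; lra.
  rewrite (@fint_split R P _ (j%:R * (pi / 2) + q)); last 3 first.
  - by rewrite /q; lra.
  - by rewrite /q -(natr1 j); lra.
  - exact: cP.
  have -> : j.+2%:R * (pi * s ^+ 2 + 8 * (cvC R * E)) =
      j.+1%:R * (pi * s ^+ 2 + 8 * (cvC R * E)) + (pi * s ^+ 2 + 8 * (cvC R * E)).
    by rewrite -(natr1 j.+1); ring.
  apply: lerD => //.
  have := piece j.+1; rewrite (_ : j.+1%:R * (pi / 2) + - q = j%:R * (pi / 2) + q)//.
  by rewrite /q -(natr1 j); lra.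
have S4 := S 4%N.
have h1 : fint P 0 (2 * pi) <= fint P (- q) (4%:R * (pi / 2) + q).
  rewrite (@fint_split R P (- q) 0); [|by rewrite /q; lra|by rewrite /q; lra|exact: cP].
  rewrite (@fint_split R P 0 (2 * pi) (4%:R * (pi / 2) + q)); [|by lra|by rewrite /q; lra|exact: cP].
  have a1 := fint0 (- q) 0 ltac:(by rewrite /q; lra).
  have a2 := fint0 (2 * pi) (4 * (pi / 2) + q) ltac:(by rewrite /q; lra).
  lra.
apply: le_trans h1 (le_trans S4 _).
have := mulr_ge0 (ltW p0) s20; have : 0 <= (pi - 2) * (cvC R * E) by rewrite mulr_ge0// subr_ge0.
lra.
Qed.

Lemma hardy_bound k dk s E : holo k dk -> 0 <= s ->
  (forall z, nm z <= 9 / 10 -> nm (k z) <= s) -> 0 <= E -> (energy dk <= E%:E)%E ->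
  (hardy_norm2 (k : CC R -> CC R) <= (3 * s ^+ 2 + 10 * (cvC R * E))%:E)%E.
Proof.
move=> kD s0 ks E0 HE; have p0 := pi_gt0 R.
apply: ge_ereal_sup => y [r]; rewrite /= in_itv /= => /andP[r0 r1] <-.
have cP : {within `[0, 2 * pi], continuous (fun t => nm (k (circ r t)) ^+ 2)}.
  apply: (pcont_within (p := fun t => k (circ r t))) => t _.
  apply: pcont_comp (pcont_circ r t) _; apply: hasder_contat (kD _ _).
  by rewrite nm_circ.
have h := circle_bound kD s0 ks E0 HE (r := r) ltac:(by rewrite r0).
rewrite -lee_fin fint_EFin// in h.
have i0 : (0 <= ((2 * pi : R)^-1)%:E)%E by rewrite lee_fin invr_ge0 mulr_ge0// ltW.
apply: le_trans (lee_wpmul2l i0 h) _.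
by rewrite -EFinM lee_fin mulKf// gt_eqF// mulr_gt0.
Qed.

End hardy.

(** * Interior estimates and Montel *)

Section interior.
Variable R : realType.
Notation mu := (@lebesgue_measure R).
Notation mu2 := (mu \x mu)%E.
Implicit Types (r s rho E : R) (k dk : R[i] -> R[i]) (v z w : R[i]).

(** What [submean_area] yields for [dk] on a square of half-side [(1 - rho) / 4]: about a centre of
    modulus at most [rho], the disc of twice that radius remains inside the unit disc. *)
Definition gradbound E rho := Num.sqrt (8 * E / ((1 - rho) / 4) ^+ 2).

Lemma gradbound_ge0 E rho : 0 <= gradbound E rho. Proof. exact: sqrtr_ge0. Qed.

Lemma energy_gradbound k dk E rho z : holo k dk -> 0 <= E -> (energy dk <= E%:E)%E ->
  rho < 1 -> nm z <= rho -> nm (dk z) <= gradbound E rho.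
Proof.
move=> kD E0 HE rho1 zr; have [ddk dkD] := holo_der_fun kD.
pose r := (1 - rho) / 4; have r0 : 0 < r by rewrite /r; lra.
have near w : nm (w - z) <= 2 * r -> nm w < 1.
  by move=> h; rewrite -(subrK z w); apply: le_lt_trans (nmD _ _) _; rewrite /r in h; lra.
have h := submean_area r0 (fun w h => dkD w (near w h)).
pose I := (\int[mu2]_(p in csq z r) (nm (dk (Z p)) ^+ 2)%:E)%E.
have IE : (I <= E%:E)%E.
  apply: le_trans HE; apply: ge0_subset_integral; [exact: csq_measurable|exact: D2_measurable| | |].
    apply: measurable_nm2; first exact: open2_D2.
    by move=> p Dp; exact: hasder_contat (dkD _ Dp).
    by move=> p _; rewrite lee_fin sqr_ge0.
  by move=> p /(csq_nm r0)/ltW/near.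
have h1 : (8%:E * I <= 8%:E * E%:E)%E by apply: lee_wpmul2l; rewrite ?lee_fin.
have h2 := le_trans h h1; rewrite -EFinM lee_fin in h2.
have -> : nm (dk z) = Num.sqrt (nm (dk z) ^+ 2) by rewrite sqrtr_sqr ger0_norm// nm_ge0.
by rewrite ler_wsqrtr// -/r ler_pdivlMr ?exprn_gt0// mulrC.
Qed.

Lemma energy_bound0 k dk E rho z : holo k dk -> 0 <= E -> (energy dk <= E%:E)%E ->
  rho < 1 -> nm z <= rho -> nm (k z) <= nm (k 0) + gradbound E rho.
Proof.
move=> kD E0 HE rho1 zr.
have h : nm (k z - k 0) <= gradbound E rho * nm (z - 0).
  apply: (@mean_value_ineq R k dk) => t /andP[t0 t1].
  have lt : nm (line 0 (z - 0) t) <= rho.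
    rewrite /line add0r subr0 nmM nmR ger0_norm//.
    by apply: le_trans zr; rewrite ler_piMr// nm_ge0.
  split; first by apply: kD; exact: le_lt_trans lt rho1.
  exact: energy_gradbound kD E0 HE rho1 lt.
have h1 := nmD (k z - k 0) (k 0); rewrite subrK in h1.
apply: le_trans h1 _; rewrite addrC lerD2l (le_trans h)//.
by rewrite subr0 ler_piMr ?gradbound_ge0// (le_trans zr)// ltW.
Qed.

(** The point is that [d] and [K] depend only on [E] and [z0]: this is equicontinuity of the
    functions and of their derivatives, with a uniform quadratic remainder, for the whole family of
    energy at most [E]. *)
Lemma local_control E z0 : 0 <= E -> nm z0 < 1 ->
  exists d K : R, [/\ 0 < d, 0 <= K & forall k dk, holo k dk -> (energy dk <= E%:E)%E ->
    forall q, nm (q - z0) < d -> [/\ nm q < 1, nm (k q - k z0) <= K * nm (q - z0),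
      nm (dk q - dk z0) <= K * nm (q - z0) &
      nm (k q - k z0 - dk z0 * (q - z0)) <= K * nm (q - z0) ^+ 2]].
Proof.
move=> E0 z01; pose a := 1 - nm z0; have a0 : 0 < a by rewrite subr_gt0.
pose L := gradbound E (1 - a / 2); have L0 : 0 <= L by exact: gradbound_ge0.
have s0 : 0 < a / 8 by rewrite divr_gt0.
pose K1 := 2 * L / (a / 8); have K10 : 0 <= K1 by rewrite /K1 divr_ge0 ?mulr_ge0// ltW.
exists (a / 8), (L + K1); split; [by []|exact: addr_ge0|] => k dk kD HE q qz.
have inb z : nm (z - z0) < a / 2 -> nm z < 1 - a / 2.
  by move=> h; rewrite -(subrK z0 z); apply: le_lt_trans (nmD _ _) _; rewrite /a in h *; lra.
have H z : nm (z - z0) < a / 2 -> hasder k z (dk z) /\ nm (dk z) <= L.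
  move=> /inb h; split; first by apply: kD; lra.
  by apply: energy_gradbound kD E0 HE _ (ltW h); lra.
have D z : nm (z - z0) < a / 8 -> nm (dk z - dk z0) <= K1 * nm (z - z0).
  by move=> h; apply: (der_lip s0 H); rewrite subrr nm0; lra.
have n0 := nm_ge0 (q - z0).
have le1 (x y : R) : 0 <= y -> x <= L * y -> x <= (L + K1) * y.
  by move=> y0 h; have := mulr_ge0 K10 y0; lra.
have le2 (x y : R) : 0 <= y -> x <= K1 * y -> x <= (L + K1) * y.
  by move=> y0 h; have := mulr_ge0 L0 y0; lra.
split.
- have := inb q ltac:(lra); lra.
- by apply: le1 => //; apply: lip_ball H _ _; rewrite ?subrr ?nm0; lra.
- exact: le2 (D q qz).
- apply: le2; first by rewrite sqr_ge0.
  have -> : k q - k z0 - dk z0 * (q - z0) = (k q - dk z0 * q) - (k z0 - dk z0 * z0) by ring.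
  rewrite expr2 mulrA.
  apply: (@mean_value_ineq R (fun z => k z - dk z0 * z) (fun z => dk z - dk z0)) => t t01.
  have lb r : nm (q - z0) < r -> nm (line z0 (q - z0) t - z0) < r.
    move=> h; apply: line_ball => //; rewrite subrr nm0; lra.
  split.
    apply: hasderB; first by have [] := H (line z0 (q - z0) t) ltac:(apply: lb; lra).
    have := hasderZ (dk z0) (hasder_id (line z0 (q - z0) t)); rewrite mulr1; exact.
  apply: le_trans (D _ (lb _ qz)) _; rewrite ler_wpM2l//.
  case/andP: t01 => t0 t1; rewrite /line addrAC subrr add0r nmM nmR ger0_norm//.
  by rewrite ler_piMr.
Qed.

End interior.

(** * Limits of bounded sequences along an ultrafilter *)

Section ultralimit.
Variables (R : realType) (U : set_system nat).
Context {UU : UltraFilter U}.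
Implicit Types (x : nat -> R) (z : nat -> R[i]).

(** Compactness of the segment gives a cluster point. If the indices close to it were not in [U],
    their complement would be, against clustering. *)
Lemma ulim_real x (M : R) : U [set n | `|x n| <= M] ->
  exists l : R, forall eps : R, 0 < eps -> U [set n | `|x n - l| < eps].
Proof.
move=> xM; have PU : ProperFilter U by exact: ultra_proper.
have : (x @ U) `[- M, M]%classic.
  rewrite /nbhs /=; apply: (filterS (F := U)) xM => n h; rewrite /preimage /mkset /= in_itv /= -ler_norml; exact: h.
move=> /(segment_compact (F := x @ U))[l [_ cl]]; exists l => eps eps0.
have [//|nU] := in_ultra_setVsetC [set n | `|x n - l| < eps] UU.
have [] := cl (~` [set y | `|y - l| < eps]) [set y | `|y - l| < eps].
- exact: nU.
- by apply/nbhs_ballP; exists eps => // y; rewrite /ball /= distrC.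
by move=> y [].
Qed.

Lemma ulim z (M : R) : U [set n | nm (z n) <= M] ->
  exists2 l, nm l <= M & forall eps, 0 < eps -> U [set n | nm (z n - l) < eps].
Proof.
move=> zM; have PU : ProperFilter U by exact: ultra_proper.
have [a Ha] := @ulim_real (fun n => Re (z n)) M
  ltac:(by apply: filterS zM => n /=; apply: le_trans; exact: Re_le_nm).
have [b Hb] := @ulim_real (fun n => Im (z n)) M
  ltac:(by apply: filterS zM => n /=; apply: le_trans; exact: Im_le_nm).
have H eps : 0 < eps -> U [set n | nm (z n - (a +i* b)) < eps].
  move=> e0; have e2 : 0 < eps / 2 by rewrite divr_gt0.
  apply: filterS2 (Ha _ e2) (Hb _ e2) => n h1 h2.
  rewrite /mkset; apply: le_lt_trans (nm_le_ReIm _) _.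
  by move: h1 h2; rewrite /mkset; case: (z n) => c d /=; lra.
exists (a +i* b) => //; apply/ler_addgt0Pr => e e0.
have [n [h1 h2]] := filter_ex (filterI zM (H e e0)).
rewrite /mkset in h1 h2; apply: le_trans (_ : nm (z n) + e <= _); last by rewrite lerD2r.
by rewrite addrC -lerBlDr; apply: le_trans (nm_subl _ _) _; rewrite nm_distC ltW.
Qed.

End ultralimit.

Lemma free_ultrafilter :
  exists2 U : set_system nat, UltraFilter U & forall N, U [set n | (N <= n)%N].
Proof.
have [U [UU oU]] := ultraFilterLemma (F := \oo) _.
by exists U => // N; apply: oU; exists N.
Qed.

Section montel.
Variable R : realType.
Notation mu := (@lebesgue_measure R).
Notation mu2 := (mu \x mu)%E.
Implicit Types (r s rho E : R) (k dk : R[i] -> R[i]) (v z w : R[i]).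

Lemma energy_fatou (df : nat -> R[i] -> R[i]) dg E :
  (forall n z, nm z < 1 -> contat (df n) z) ->
  (forall n, (energy (df n) <= E%:E)%E) ->
  (forall z, nm z < 1 -> forall eps : R, 0 < eps ->
     exists N, forall n, (N <= n)%N -> nm (df n z - dg z) <= eps) ->
  (energy dg <= E%:E)%E.
Proof.
move=> cdf HE lim.
pose F n (p : R * R) := (nm (df n (Z p)) ^+ 2)%:E.
have mF n : measurable_fun (@D2 R) (F n).
  by apply: measurable_nm2; [exact: open2_D2|move=> p; exact: cdf].
have F0 n p : (@D2 R) p -> (0 <= F n p)%E by move=> _; rewrite lee_fin sqr_ge0.
have -> : energy dg = (\int[mu2]_(p in @D2 R) limn_einf (F^~ p))%E.
  apply: eq_integral => p; rewrite inE => Dp.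
  suff h : F ^~ p @ \oo --> (nm (dg (Z p)) ^+ 2)%:E by rewrite (cvg_limn_einf_sup h).1.
  apply: cvg_EFin; first by near=> n.
  apply: (@cvg_comp _ _ _ (fun n => nm (df n (Z p))) (fun x : R => x ^+ 2)); last first.
    exact: (@exprn_continuous R 2).
  apply/cvgrPdist_le => e e0; have [N HN] := lim _ Dp e e0.
  near=> n.
  have h : nm (df n (Z p) - dg (Z p)) <= e by apply: HN; near: n; exact: nbhs_infty_ge.
  rewrite ler_norml; apply/andP; split.
    by have := nm_subl (df n (Z p)) (dg (Z p)); lra.
  by have := nm_subl (dg (Z p)) (df n (Z p)); rewrite nm_distC in h; lra.
apply: le_trans (fatou mu2 (@D2_measurable R) mF F0) _.
rewrite limn_einf_lim; apply: lime_le; first exact: is_cvg_einfs.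
apply: nearW => n; apply: le_trans (HE n).
by apply: ereal_inf_lbound; exists n => //=.
Unshelve. all: by end_near.
Qed.

(* The limits are taken along a free ultrafilter, so that they exist at every point at once; a
   failure of uniformity on a compact disc is refuted at an ultralimit of bad points. *)
Lemma montel (f df : nat -> R[i] -> R[i]) E B :
  (forall n, holo (f n) (df n)) -> 0 <= E -> (forall n, (energy (df n) <= E%:E)%E) ->
  (forall n, nm (f n 0) <= B) ->
  exists2 e : nat -> nat, {homo e : m n / (m < n)%N} &
  exists g dg, [/\ holo g dg, (energy dg <= E%:E)%E &
    forall rho eps, rho < 1 -> 0 < eps -> exists N, forall n, (N <= n)%N ->
      forall z, nm z <= rho -> nm (f (e n) z - g z) <= eps /\ nm (df (e n) z - dg z) <= eps].
Proof.
move=> fD E0 HE fB; have [U UU Uoo] := free_ultrafilter.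
have PU : ProperFilter U by exact: ultra_proper.
have [gdg Hg] : {gdg : R[i] -> R[i] * R[i] & forall z, nm z < 1 -> forall eps : R, 0 < eps ->
    U [set n | nm (f n z - (gdg z).1) < eps /\ nm (df n z - (gdg z).2) < eps]}.
  apply: (@choice _ _ (fun z p => nm z < 1 -> forall eps : R, 0 < eps ->
    U [set n | nm (f n z - p.1) < eps /\ nm (df n z - p.2) < eps])) => z.
  have [z1|z1] := ltP (nm z) 1; last by exists (0, 0).
  have [a _ Ha] := @ulim R U UU (fun n => f n z) (B + gradbound E (nm z))
    ltac:(by apply: filterE => n; apply: le_trans (energy_bound0 (fD n) E0 (HE n) z1 (lexx _)) _;
      rewrite lerD2r).
  have [b _ Hb] := @ulim R U UU (fun n => df n z) (gradbound E (nm z))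
    ltac:(by apply: filterE => n; exact: energy_gradbound (fD n) E0 (HE n) z1 (lexx _)).
  by exists (a, b) => _ eps e0; apply: filterI; [exact: Ha|exact: Hb].
pose g z := (gdg z).1; pose dg z := (gdg z).2.
have gD : holo g dg.
  move=> z0 z01; have [d [K [d0 K0 HK]]] := local_control E0 z01.
  have K1 : 0 < K + 1 by lra.
  move=> eps e0; exists (Num.min d (eps / (K + 1))); first by rewrite lt_min d0 divr_gt0.
  move=> w; rewrite lt_min => /andP[wd]; rewrite ltr_pdivlMr// => we.
  have q0 := nm_ge0 (w - z0); set q := nm (w - z0) in wd we q0 *.
  apply: (@le_trans _ _ (K * q ^+ 2)); last by rewrite expr2; nra.
  (* The remainder of [g] differs from that of [f n] by two errors [b] on the values and one error
     [b * q] on the derivative, in total [a]. *)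
  apply/ler_addgt0Pr => a a0; pose b := a / (2 + q).
  have q2 : 0 < 2 + q by lra.
  have b0 : 0 < b by rewrite divr_gt0.
  have [w1 _ _ _] := HK _ _ (fD 0%N) (HE 0%N) w wd.
  have [n [[h1 _] [h2 h3]]] := filter_ex (filterI (Hg w w1 b b0) (Hg z0 z01 b b0)).
  have [_ _ _ h4] := HK _ _ (fD n) (HE n) w wd.
  have -> : g w - g z0 - dg z0 * (w - z0) = (f n w - f n z0 - df n z0 * (w - z0)) -
      (f n w - g w) + (f n z0 - g z0) + (df n z0 - dg z0) * (w - z0) by ring.
  have e1 : b * (2 + q) = a by rewrite /b divfK// gt_eqF.
  have t1 := nmD (f n w - f n z0 - df n z0 * (w - z0) - (f n w - g w) + (f n z0 - g z0))
    ((df n z0 - dg z0) * (w - z0)).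
  have t2 := nmD (f n w - f n z0 - df n z0 * (w - z0) - (f n w - g w)) (f n z0 - g z0).
  have t3 := nmB (f n w - f n z0 - df n z0 * (w - z0)) (f n w - g w).
  rewrite nmM -/q in t1; rewrite -/q in h4.
  have t4 : nm (df n z0 - dg z0) * q <= b * q by rewrite ler_wpM2r// ltW.
  apply: le_trans t1 _; rewrite -e1; move: h1 h2; rewrite -/(g w) -/(g z0); lra.
have unif rho eps : rho < 1 -> 0 < eps ->
    U [set n | forall z, nm z <= rho -> nm (f n z - g z) <= eps /\ nm (df n z - dg z) <= eps].
  move=> rho1 e0.
  pose P n z := nm (f n z - g z) <= eps /\ nm (df n z - dg z) <= eps.
  have [//|bad] := in_ultra_setVsetC [set n | forall z, nm z <= rho -> P n z] UU.
  (* A witness of failure for every bad index; at the other indices the value is irrelevant. *)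
  have [zs Hzs] : {zs : nat -> R[i] & forall n,
      ~ (forall z, nm z <= rho -> P n z) -> nm (zs n) <= rho /\ ~ P n (zs n)}.
    apply: (@choice _ _ (fun n z => ~ (forall z, nm z <= rho -> P n z) -> nm z <= rho /\ ~ P n z)) => n.
    have [h|/existsNP[z /not_implyP h]] := pselect (forall z, nm z <= rho -> P n z).
      by exists 0.
    by exists z.
  have zr : U [set n | nm (zs n) <= rho] by apply: filterS bad => n /Hzs[].
  have [z0 z0r Hz0] := ulim zr.
  have z01 : nm z0 < 1 by exact: le_lt_trans z0r rho1.
  have [d [K [d0 K0 HK]]] := local_control E0 z01.
  have e3 : 0 < eps / 3 by rewrite divr_gt0.
  have [d1 d10 Hd1] := hasder_contat (gD z0 z01) e3.
  have [d2 d20 Hd2] := holo_dcont gD z01 e3.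
  have K1 : 0 < K + 1 by lra.
  pose d3 := Num.min (Num.min d (eps / 3 / (K + 1))) (Num.min d1 d2).
  have d30 : 0 < d3 by rewrite !lt_min d0 d10 d20 divr_gt0.
  have [n [[bn zn] [h1 h2]]] := filter_ex (filterI (filterI bad (Hz0 d3 d30)) (Hg z0 z01 _ e3)).
  have [_ []] := Hzs n bn.
  move: zn; rewrite /mkset !lt_min ltr_pdivlMr// => /andP[/andP[zd zK] /andP[zd1 zd2]].
  have [_ h3 h4 _] := HK _ _ (fD n) (HE n) _ zd.
  have {zd1}h5 := Hd1 _ zd1; have {zd2}h6 := Hd2 _ zd2.
  have q0 := nm_ge0 (zs n - z0).
  have sp (a b c e : R[i]) : nm (a - b) <= nm (a - c) + nm (c - e) + nm (b - e).
    have := nm_tri c a b; have := nm_tri e c b; rewrite (nm_distC e b); lra.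
  rewrite -/(g z0) -/(dg z0) in h1 h2.
  split.
    apply: le_trans (sp _ _ (f n z0) (g z0)) _; move: h1; nra.
  apply: le_trans (sp _ _ (df n z0) (dg z0)) _; move: h2; nra.
(* Diagonal extraction: [pick (k, m)] is an index beyond [m] that is accurate to [1 / (k + 1)] on
   the disc of radius [1 - 1 / (k + 1)]. Sets of [U] being nonempty beyond any index, iteration
   gives a strictly increasing subsequence. *)
have [pick Hpick] : {pick : nat * nat -> nat & forall km, (km.2 < pick km)%N /\
    forall z, nm z <= 1 - km.1.+1%:R^-1 ->
      nm (f (pick km) z - g z) <= km.1.+1%:R^-1 /\ nm (df (pick km) z - dg z) <= km.1.+1%:R^-1}.
  apply: (@choice _ _ (fun km n => (km.2 < n)%N /\ forall z, nm z <= 1 - km.1.+1%:R^-1 ->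
      nm (f n z - g z) <= km.1.+1%:R^-1 /\ nm (df n z - dg z) <= km.1.+1%:R^-1)) => -[k m].
  have k0 : 0 < k.+1%:R^-1 :> R by rewrite invr_gt0.
  have r1 : 1 - k.+1%:R^-1 < 1 :> R by rewrite ltrBlDr ltrDl.
  by have [n [h1 h2]] := filter_ex (filterI (Uoo m.+1) (unif _ _ r1 k0)); exists n.
pose e := fix e (j : nat) := match j with 0%N => pick (0%N, 0%N) | j'.+1 => pick (j'.+1, e j') end.
have eS (j : nat) z : nm z <= 1 - j.+1%:R^-1 ->
    nm (f (e j) z - g z) <= j.+1%:R^-1 /\ nm (df (e j) z - dg z) <= j.+1%:R^-1.
  by case: j => [|j]; [have [_] := Hpick (0%N, 0%N)|have [_] := Hpick (j.+1, e j)]; exact.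
have conv rho eps : rho < 1 -> 0 < eps -> exists N, forall n, (N <= n)%N ->
      forall z, nm z <= rho -> nm (f (e n) z - g z) <= eps /\ nm (df (e n) z - dg z) <= eps.
  move=> rho1 e0; have c0 : 0 < Num.min (1 - rho) eps by rewrite lt_min e0 subr_gt0 rho1.
  have [N _ HN] := near_infty_natSinv_lt (PosNum c0).
  exists N => n /HN /=; rewrite lt_min => /andP[h1 h2] z zr.
  have zn : nm z <= 1 - (n.+1%:R)^-1.
    by apply: le_trans zr _; rewrite lerBrDr -lerBrDl ltW.
  have [h3 h4] := eS n z zn.
  by split; [exact: le_trans h3 (ltW h2)|exact: le_trans h4 (ltW h2)].
exists e.
  by apply: homo_ltn => [m n p|j]; [exact: ltn_trans|have [] := Hpick (j.+1, e j)].
exists g, dg; split=> //.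
apply: (@energy_fatou (fun n => df (e n))).
- by move=> n z z1; exact: holo_dcont (fD _) z1.
- by move=> n; exact: HE.
- move=> z z1 eps e0; have [N HN] := conv _ _ z1 e0.
  by exists N => n /HN/(_ z (lexx _))[].
Qed.

End montel.

(** * Weighted composition *)

Section boundary.
Variable R : realType.
Implicit Types (r s rho L : R) (z w : R[i]).

(** Otherwise points of the compact disc would have images of modulus tending to 1; at an ultralimit
    of these points, continuity contradicts [nm (phi z0) < 1]. *)
Lemma self_map_compact phi dphi rho : @holo R phi dphi ->
  (forall z, nm z < 1 -> nm (phi z) < 1) -> rho < 1 ->
  exists2 sigma, sigma < 1 & forall z, nm z <= rho -> nm (phi z) <= sigma.
Proof.
move=> phiD phi1 rho1; apply: contrapT => H.
have bad (n : nat) : exists z, nm z <= rho /\ 1 - n.+1%:R^-1 < nm (phi z).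
  apply: contrapT => Hn; apply: H; exists (1 - n.+1%:R^-1).
    by rewrite ltrBlDr ltrDl invr_gt0.
  by move=> z zr; rewrite leNgt; apply/negP => h; apply: Hn; exists z.
have [zs Hzs] := choice bad.
have [U UU Uoo] := free_ultrafilter.
have PU : ProperFilter U by exact: ultra_proper.
have [z0 z0r Hz0] := @ulim R U UU zs rho ltac:(by apply: filterE => n; have [] := Hzs n).
have z01 := le_lt_trans z0r rho1; have c1 := phi1 z0 z01.
have c0 : 0 < (1 - nm (phi z0)) / 2 by rewrite divr_gt0// subr_gt0.
have [d d0 Hd] := hasder_contat (phiD z0 z01) c0.
have [N _ HN] := near_infty_natSinv_lt (PosNum c0).
have [n [h1 h2]] := filter_ex (filterI (Hz0 d d0) (Uoo N)).
have /= h3 := HN n h2; have h4 := Hd _ h1; have [_ h5] := Hzs n.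
have h6 := nm_subl (phi (zs n)) (phi z0).
have : (n.+1%:R : R)^-1 < (1 - nm (phi z0)) / 2 by exact: h3.
by move: h4 h5 h6; move: (n.+1%:R^-1 : R) => a; lra.
Qed.

                                                                                                                                                                                              
(** The limit condition is used not at [z] but at [w = (1 - eta) * z]. There [1 - nm w ^+ 2] is at
    least [eta], whereas [1 - nm (phi w) ^+ 2] is at most [2 * (1 + L) * eta] because [phi z] is
    within [eta] of the circle and [phi] is [L]-Lipschitz. So the quotient of the two is bounded,
    [psi w] is small, and the bound on [dpsi] carries this back to [z]. *)
Lemma weight_decay phi dphi psi dpsi L B : @holo R phi dphi -> holo psi dpsi ->
  (forall z, nm z < 1 -> nm (phi z) < 1) -> 0 <= L -> 0 <= B ->
  (forall z, nm z < 1 -> nm (dphi z) <= L) -> (forall z, nm z < 1 -> nm (dpsi z) <= B) ->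
  (forall eps, 0 < eps -> exists2 r, r < 1 & forall z, r < nm z < 1 ->
     nm (psi z) * (1 - nm z ^+ 2) <= eps * (1 - nm (phi z) ^+ 2)) ->
  forall eps, 0 < eps -> exists2 del, 0 < del & forall z, nm z < 1 ->
     1 - del < nm (phi z) -> nm (psi z) <= eps.
Proof.
move=> phiD psiD phi1 L0 B0 phiL psiB lim eps e0.
pose e := eps / (4 * (1 + L)).
have eE : e * (4 * (1 + L)) = eps by rewrite /e divfK// gt_eqF//; lra.
have e'0 : 0 < e by rewrite divr_gt0//; lra.
have [r r1 Hr] := lim e e'0.
(* The second bound gives [B * eta <= eps / 2]; the third one keeps [nm w] above [r], since [nm w]
   exceeds [(1 - eta) ^+ 2]. *)
pose eta := Num.min (Num.min (1 / 2) (eps / (2 * (B + 1)))) ((1 - r) / 3).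
have eta0 : 0 < eta by rewrite !lt_min; apply/andP; split; [apply/andP; split|]; rewrite ?divr_gt0//; lra.
have [eta12 etaB etar] : [/\ eta <= 1 / 2, eta <= eps / (2 * (B + 1)) & eta <= (1 - r) / 3].
  by rewrite /eta !ge_min !lexx ?orbT.
rewrite ler_pdivlMr in etaB; last by lra.
have [sigma sigma1 Hs] := self_map_compact (rho := 1 - eta) phiD phi1 ltac:(lra).
exists (Num.min eta (1 - sigma)); first by rewrite lt_min eta0 subr_gt0.
move=> z z1 zd.
have [h1 h2] : 1 - eta < nm (phi z) /\ sigma < nm (phi z).
  have [m1 m2] : Num.min eta (1 - sigma) <= eta /\ Num.min eta (1 - sigma) <= 1 - sigma.
    by split; rewrite ge_min ?lexx ?orbT.
  by split; lra.
have zeta : 1 - eta < nm z by rewrite ltNge; apply/negP => /Hs; lra.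
pose w := (1 - eta)%:C * z.
have nw : nm w = (1 - eta) * nm z by rewrite nmM nmR ger0_norm//; lra.
have wz : nm (w - z) <= eta.
  have -> : w - z = (- eta)%:C * z by rewrite /w rmorphB rmorphN /= ; ring.
  by rewrite nmM nmR normrN gtr0_norm// ler_piMr// ltW.
have n0 := nm_ge0 z.
have w1 : nm w <= 1 - eta by rewrite nw; nra.
have w2 : r < nm w by rewrite nw; nra.
have h := Hr w ltac:(apply/andP; split => //; lra).
have ball0 u : nm u < 1 -> nm (u - 0) < 1 by rewrite subr0.
have lphi : nm (phi w - phi z) <= L * nm (w - z).
  apply: (@lip_ball R phi dphi 0 1); try by apply: ball0; lra.
  by move=> u; rewrite subr0 => u1; split; [exact: phiD|exact: phiL].
have lpsi : nm (psi z - psi w) <= B * nm (z - w).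
  apply: (@lip_ball R psi dpsi 0 1); try by apply: ball0; lra.
  by move=> u; rewrite subr0 => u1; split; [exact: psiD|exact: psiB].
rewrite (nm_distC z w) in lpsi.
have t1 := nm_subl (psi z) (psi w).
have t2 := nm_subl (phi z) (phi w); rewrite nm_distC in t2.
have p0 := nm_ge0 (psi w); have q0 := nm_ge0 (phi w).
have q1 : nm (phi w) < 1 by apply: phi1; lra.
have nw0 := nm_ge0 w.
have s1 : nm (psi w) * eta <= nm (psi w) * (1 - nm w ^+ 2) by apply: ler_wpM2l => //; nra.
have Lw : L * nm (w - z) <= L * eta by apply: ler_wpM2l.
have Bw : B * nm (w - z) <= B * eta by apply: ler_wpM2l.
have s2 : 1 - nm (phi w) ^+ 2 <= 2 * ((1 + L) * eta).
  apply: (@le_trans _ _ (2 * (1 - nm (phi w)))); [nra|lra].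
have s3 : e * (1 - nm (phi w) ^+ 2) <= e * (2 * ((1 + L) * eta)) by rewrite ler_pM2l.
have s4 : nm (psi w) <= eps / 2.
  rewrite -(ler_pM2r eta0); apply: le_trans s1 (le_trans h (le_trans s3 _)).
  by rewrite -eE; lra.
lra.
Qed.

End boundary.

(** * Translation of the hypotheses and of the Dirichlet integral into [holo], [nm] and [energy] *)

Section bridge.
Variable R : realType.
Implicit Types (f : CC R -> CC R) (z : CC R).

Lemma holomorphic_holo f : holomorphic_disc f <-> holo f (f^`()%classic).
Proof.
split=> [H z z1|H z /discE/H/hasderP[]//].
by apply: derivable_hasder; apply: H; apply/discE.
Qed.

Lemma holo_derive f df z : holo f df -> nm z < 1 -> f^`()%classic z = df z.
Proof. by move=> H /H/hasderP[]. Qed.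

Lemma holo_holomorphic f df : holo f df -> holomorphic_disc f.
Proof. by move=> H z /discE/H/hasderP[]. Qed.

Lemma dirichlet_integralE f df : (forall z, nm z < 1 -> f^`()%classic z = df z) ->
  dirichlet_integral f = energy df.
Proof.
move=> H; rewrite /dirichlet_integral /disc_integral /energy.
have -> : [set p : R * R | disc (p.1 +i* p.2 : CC R)] = @D2 R.
  by apply/seteqP; split=> p /discE.
by apply: eq_integral => p; rewrite inE => Dp; rewrite H.
Qed.

Lemma bounded_nm f : [bounded f z | z in @disc R] ->
  exists2 B : R, 0 <= B & forall z, nm z < 1 -> nm (f z) <= B.
Proof.
move=> /pinfty_ex_gt0[M M0 HM]; have MR : (Re M)%:C = M by apply: RRe_real; exact: gtr0_real.
exists (Re M); first by rewrite -lecR MR ltW.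
by move=> z /discE/HM; rewrite -MR /mkset nmE lecR.
Qed.

Lemma boundary_limit f (phi : CC R -> CC R) :
  (forall z, nm z < 1 -> nm (phi z) < 1) ->
  (`|f z| * (1 - `|z| ^+ 2) / (1 - `|phi z| ^+ 2) : CC R) @[z --> @disc_boundary R]
    --> (0 : CC R) ->
  forall eps : R, 0 < eps -> exists2 r, r < 1 & forall z, r < nm z < 1 ->
     nm (f z) * (1 - nm z ^+ 2) <= eps * (1 - nm (phi z) ^+ 2).
Proof.
move=> phi1 /cvgrPdist_le H eps e0.
have := H eps%:C; rewrite ltcR => /(_ e0) /nbhs_ballP[d /= d0 Hd].
exists (1 - d); first by rewrite ltrBlDr ltrDl.
move=> z /andP[z1 z2].
have zb : ball (1 : R) d (nm z) by rewrite /ball /= ger0_norm; lra.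
have := Hd (nm z) zb z2 z (nmE z).
have q0 : 0 < 1 - nm (phi z) ^+ 2 by rewrite subr_gt0 expr_lt1 ?nm_ge0// phi1.
rewrite /= !nmE sub0r nmN -!rmorphXn -[1 : R[i]]/(1%:C) -!rmorphB /= lecR nmM nmV.
have p0 : 0 < 1 - nm z ^+ 2 by rewrite subr_gt0 expr_lt1 ?nm_ge0.
by rewrite nmM !nmR ger0_norm ?nm_ge0// (gtr0_norm p0) (gtr0_norm q0) ler_pdivrMr.
Qed.

End bridge.

(** * Norm estimates for the weighted composition *)

Section weighted.
Variable R : realType.
Notation mu := (@lebesgue_measure R).
Notation mu2 := (mu \x mu)%E.
Variables (phi dphi ddphi psi dpsi : R[i] -> R[i]) (L L2 B0 B1 : R).
Hypotheses (phiD : holo phi dphi) (dphiD : holo dphi ddphi) (psiD : holo psi dpsi).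
Hypothesis phi1 : forall z, nm z < 1 -> nm (phi z) < 1.
Hypothesis phi_inj : forall z w, nm z < 1 -> nm w < 1 -> phi z = phi w -> z = w.
Hypotheses (L0 : 0 <= L) (L20 : 0 <= L2) (B00 : 0 <= B0) (B10 : 0 <= B1).
Hypothesis dphi_le : forall z, nm z < 1 -> nm (dphi z) <= L.
Hypothesis ddphi_le : forall z, nm z < 1 -> nm (ddphi z) <= L2.
Hypothesis psi_le : forall z, nm z < 1 -> nm (psi z) <= B0.
Hypothesis dpsi_le : forall z, nm z < 1 -> nm (dpsi z) <= B1.
Hypothesis psi_decay : forall eps, 0 < eps -> exists2 del, 0 < del & forall z, nm z < 1 ->
     1 - del < nm (phi z) -> nm (psi z) <= eps.
Implicit Types (r s rho E eps : R) (h dh : R[i] -> R[i]) (v z w : R[i]).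

Lemma holo_compose h dh : holo h dh -> holo (h \o phi) (fun z => dh (phi z) * dphi z).
Proof. by move=> hD z z1; apply: hasder_comp; [exact: phiD|exact: hD (phi1 z1)]. Qed.

Definition wcomp h z := psi z * h (phi z).
Definition wcomp_der h dh z := dpsi z * h (phi z) + psi z * (dh (phi z) * dphi z).

Lemma holo_wcomp h dh : holo h dh -> holo (wcomp h) (wcomp_der h dh).
Proof. by move=> hD z z1; apply: (hasderM (psiD z1) (holo_compose hD z1)). Qed.

(** The bound on [ddphi] enters here: it makes [dphi] Lipschitz, as the change of variables
    requires. The constant is [L2 + 1] because it must be positive. *)
Lemma energy_compose h dh : holo h dh ->
  (energy (fun z => (dh (phi z) * dphi z)%R) <= (cvC R)%:E * energy dh)%E.
Proof.
move=> hD; have [ddh dhD] := holo_der_fun hD.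
have lip z w : nm z < 1 -> nm w < 1 -> nm (dphi z - dphi w) <= (L2 + 1) * nm (z - w).
  move=> z1 w1; apply: (@lip_ball R dphi ddphi 0 1); rewrite ?subr0// => u; rewrite subr0 => u1.
  by split; [exact: dphiD|apply: le_trans (ddphi_le u1) _; rewrite lerDl].
have L1 : 0 < L2 + 1 by rewrite ltr_wpDl.
apply: le_trans (change_of_variables_le phiD phi1 phi_inj L1 lip dhD).
by rewrite /energy; under eq_integral do rewrite nmM exprMn.
Qed.

Lemma wcomp_der_le h dh z : nm (wcomp_der h dh z) ^+ 2 <=
  2 * (nm (dpsi z) ^+ 2 * nm (h (phi z)) ^+ 2) +
  2 * (nm (psi z) ^+ 2 * nm (dh (phi z) * dphi z) ^+ 2).
Proof.
have := sqr_nm_le (wcomp_der h dh z) (dpsi z * h (phi z)).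
by rewrite /wcomp_der addrAC subrr add0r !nmM !exprMn.
Qed.

(** Three contributions: [dpsi] times [h o phi] goes through [poincare] applied to [h o phi]; the
    other term of the derivative is small where [phi] is near the circle, by [psi_decay], and
    elsewhere is bounded through the values of [dh] on a compact disc. *)
Lemma wcomp_energy eps : 0 < eps -> exists rho C, [/\ rho < 1, 0 <= C &
  forall h dh s, holo h dh -> 0 <= s ->
    (forall z, nm z <= rho -> nm (h z) <= s /\ nm (dh z) <= s) ->
    (energy (wcomp_der h dh) <= (C * s ^+ 2)%:E + eps%:E * energy dh)%E].
Proof.
move=> e0; have c0 := cvC_ge0 R; set c := cvC R in c0.
have B20 : 0 <= 32 * (B1 ^+ 2 * c) by rewrite !mulr_ge0 ?sqr_ge0 ?nm_ge0.
(* Chosen so that [2 * B1 ^+ 2], the factor [8 * th] of [poincare] and the factor [c] of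
   [energy_compose] multiply to at most [eps / 2]; the added 1 avoids a zero denominator. *)
pose th := Num.min (1 / 2) (eps / (32 * (B1 ^+ 2 * c) + 1)).
have B21 : 0 < 32 * (B1 ^+ 2 * c) + 1 by rewrite ltr_wpDl.
have c1 : 0 < 4 * (c + 1) by rewrite mulr_gt0// ltr_wpDl.
have th01 : 0 < th < 1.
  by rewrite lt_min gt_min !divr_gt0//=; apply/orP; left; lra.
have thE : 16 * (B1 ^+ 2 * (th * c)) <= eps / 2.
  have : th <= eps / (32 * (B1 ^+ 2 * c) + 1) by rewrite ge_min lexx orbT.
  case/andP: th01 => t0 t1; rewrite ler_pdivlMr//; lra.
(* The size of [psi] near the circle. Since [e <= 1], its square is at most [e], and the second
   bound suffices for [2 * (e ^+ 2 * c) <= eps / 2]. *)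
pose e := Num.min 1 (eps / (4 * (c + 1))).
have e'0 : 0 < e by rewrite lt_min ltr01 divr_gt0.
have e00 := ltW e'0.
have eE : 2 * (e ^+ 2 * c) <= eps / 2.
  have h1 : e <= 1 by rewrite ge_min lexx.
  have h2 : e <= eps / (4 * (c + 1)) by rewrite ge_min lexx orbT.
  rewrite ler_pdivlMr// in h2.
  have h3 : e ^+ 2 * c <= e * c by rewrite ler_wpM2r// expr2 ler_piMl// ltW.
  lra.
have [rho0 /andP[rho00 rho01] Hpc] := poincare th01.
have [sigma sigma1 Hs] := self_map_compact phiD phi1 rho01.
have [del del0 Hdel] := psi_decay e'0.
(* [sigma] covers the image under [phi] of the inner disc of [poincare]; [1 - del] covers the values
   of [phi] where [psi] need not be small. *)
pose rho := Num.max sigma (1 - del).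
(* The first term is [2 * B1 ^+ 2] times the [8 * s ^+ 2] of [poincare]; the second is the pointwise
   bound [2 * (B0 ^+ 2 * L ^+ 2)] times 4, the area of a square containing the disc. *)
exists rho, (16 * B1 ^+ 2 + 8 * (B0 ^+ 2 * L ^+ 2)); split.
- by rewrite gt_max sigma1/= ltrBlDr ltrDl.
- by rewrite addr_ge0// !mulr_ge0 ?sqr_ge0 ?nm_ge0.
move=> h dh s hD s0 hs.
have kD := holo_compose hD; set dk := fun z => _ in kD.
have [ddh dhD] := holo_der_fun hD.
have Ek : (energy dk <= c%:E * energy dh)%E by exact: (energy_compose hD).
have mE : measurable (@D2 R) by exact: D2_measurable.
have cont_sq (g dg : R[i] -> R[i]) : holo g dg ->
    measurable_fun (@D2 R) (fun p => (nm (g (Z p)) ^+ 2)%:E).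
  move=> gD; apply: measurable_nm2; first exact: open2_D2.
  by move=> p Dp; exact: hasder_contat (gD _ Dp).
have [ddk dkD] := holo_der_fun kD.
have mk := cont_sq _ _ kD; have mdk := cont_sq _ _ dkD.
have zrho z : nm z <= rho0 -> nm (h (phi z)) <= s.
  by move=> /Hs h1; apply: (hs _ _).1; rewrite le_max h1.
have P1 := Hpc _ _ s kD s0 zrho.
have ptw z : nm z < 1 -> nm (wcomp_der h dh z) ^+ 2 <=
    2 * B1 ^+ 2 * nm (h (phi z)) ^+ 2 + (2 * e ^+ 2 * nm (dk z) ^+ 2 + 2 * (B0 ^+ 2 * L ^+ 2) * s ^+ 2).
  move=> z1; apply: le_trans (wcomp_der_le h dh z) _; apply: lerD.
    rewrite -mulrA ler_pM2l// ler_wpM2r ?sqr_ge0// ler_pXn2r ?nnegrE ?nm_ge0// dpsi_le//.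
  have [hd|hd] := ltP (1 - del) (nm (phi z)).
    apply: (@le_trans _ _ (2 * e ^+ 2 * nm (dk z) ^+ 2)); last first.
      by rewrite lerDl !mulr_ge0 ?sqr_ge0 ?nm_ge0.
    rewrite -[leRHS]mulrA ler_pM2l// ler_wpM2r ?sqr_ge0// ler_pXn2r ?nnegrE ?nm_ge0//.
    exact: Hdel.
  apply: (@le_trans _ _ (2 * (B0 ^+ 2 * L ^+ 2) * s ^+ 2)); last first.
    by rewrite lerDr !mulr_ge0 ?sqr_ge0 ?nm_ge0.
  rewrite -[leRHS]mulrA ler_pM2l// -mulrA; apply: ler_pM; rewrite ?sqr_ge0//.
    by rewrite ler_pXn2r ?nnegrE ?nm_ge0// psi_le.
  rewrite nmM exprMn mulrC; apply: ler_pM; rewrite ?sqr_ge0//.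
    by rewrite ler_pXn2r ?nnegrE ?nm_ge0// dphi_le.
  rewrite ler_pXn2r ?nnegrE ?nm_ge0//; apply: (hs _ _).2.
  by rewrite le_max hd orbT.
pose F1 p := ((2 * B1 ^+ 2)%:E * (nm (h (phi (Z p))) ^+ 2)%:E)%E.
pose F2 p := ((2 * e ^+ 2)%:E * (nm (dk (Z p)) ^+ 2)%:E)%E.
pose F3 (p : R * R) := (2 * (B0 ^+ 2 * L ^+ 2) * s ^+ 2)%:E.
have mF1 : measurable_fun (@D2 R) F1 by apply: measurable_funeM.
have mF2 : measurable_fun (@D2 R) F2 by apply: measurable_funeM.
have mF3 : measurable_fun (@D2 R) F3 by exact: measurable_cst.
have F10 p : (0 <= F1 p)%E by rewrite /F1 -EFinM lee_fin !mulr_ge0 ?sqr_ge0 ?nm_ge0.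
have F20 p : (0 <= F2 p)%E by rewrite /F2 -EFinM lee_fin !mulr_ge0 ?sqr_ge0 ?nm_ge0.
have F30 p : (0 <= F3 p)%E by rewrite /F3 lee_fin !mulr_ge0 ?sqr_ge0 ?nm_ge0.
apply: (@le_trans _ _ (\int[mu2]_(p in @D2 R) (F1 p + (F2 p + F3 p)))%E).
  apply: ge0_le_integral; first exact: mE.
  - by move=> p _; rewrite lee_fin sqr_ge0.
  - have [T dT] := holo_der_fun (holo_wcomp hD); exact: cont_sq dT.
  - by apply: emeasurable_funD => //; exact: emeasurable_funD.
  - by move=> p Dp; rewrite /F1 /F2 /F3 -!EFinM -!EFinD lee_fin; exact: ptw.
rewrite ge0_integralD; last 5 first.
- exact: mE.
- by move=> p _; exact: F10.
- exact: mF1.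
- by move=> p _; rewrite adde_ge0.
- exact: emeasurable_funD.
rewrite ge0_integralD; last 5 first.
- exact: mE.
- by move=> p _; exact: F20.
- exact: mF2.
- by move=> p _; exact: F30.
- exact: mF3.
have I1 : (\int[mu2]_(p in @D2 R) F1 p <=
    (16 * B1 ^+ 2 * s ^+ 2)%:E + (eps / 2)%:E * energy dh)%E.
  rewrite ge0_integralZl_EFin; last 4 first.
  - exact: mE.
  - by move=> p _; rewrite lee_fin sqr_ge0.
  - exact: mk.
  - by rewrite mulr_ge0 ?sqr_ge0.
  have b0 : (0 <= (2 * B1 ^+ 2)%:E)%E by rewrite lee_fin mulr_ge0 ?sqr_ge0.
  apply: le_trans (lee_wpmul2l b0 P1) _.
  rewrite ge0_muleDr; last 2 first.
  - by rewrite lee_fin mulr_ge0 ?sqr_ge0.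
  - rewrite mule_ge0 ?energy_ge0// lee_fin mulr_ge0//; case/andP: th01 => /ltW//.
  apply: leeD; first by rewrite -EFinM lee_fin; lra.
  rewrite muleA -EFinM.
  have t0 : (0 <= (2 * B1 ^+ 2 * (8 * th))%:E)%E.
    by rewrite lee_fin !mulr_ge0 ?sqr_ge0//; case/andP: th01 => /ltW//.
  apply: le_trans (lee_wpmul2l t0 Ek) _; rewrite muleA -EFinM.
  by apply: lee_wpmul2r; [exact: energy_ge0|rewrite lee_fin; lra].
have I2 : (\int[mu2]_(p in @D2 R) F2 p <= (eps / 2)%:E * energy dh)%E.
  rewrite ge0_integralZl_EFin; last 4 first.
  - exact: mE.
  - by move=> p _; rewrite lee_fin sqr_ge0.
  - exact: mdk.
  - by rewrite mulr_ge0 ?sqr_ge0.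
  have b0 : (0 <= (2 * e ^+ 2)%:E)%E by rewrite lee_fin mulr_ge0 ?sqr_ge0.
  apply: le_trans (lee_wpmul2l b0 Ek) _; rewrite muleA -EFinM.
  by apply: lee_wpmul2r; [exact: energy_ge0|rewrite lee_fin; lra].
have I3 : (\int[mu2]_(p in @D2 R) F3 p <= (8 * (B0 ^+ 2 * L ^+ 2) * s ^+ 2)%:E)%E.
  have -> : (\int[mu2]_(p in @D2 R) F3 p =
     \int[mu2]_(p in @D2 R) (cst (2 * (B0 ^+ 2 * L ^+ 2) * s ^+ 2)%:E p))%E by [].
  rewrite integral_cst; last exact: mE.
  have m4 : (mu2 (@D2 R) <= 4%:E)%E.
    have -> : (4 : R) = 4 * 1 ^+ 2 by rewrite expr1n mulr1.
    rewrite -(csq_measure 0 ltr01); apply: le_measure; rewrite ?inE; [exact: mE|exact: csq_measurable|].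
    move=> p Dp; rewrite /D2 /mkset in Dp; rewrite /csq /mkset /= !subr0; split.
      exact: le_trans (Re_le_nm (Z p)) (ltW Dp).
    exact: le_trans (Im_le_nm (Z p)) (ltW Dp).
  have b0 := F30 (0, 0).
  apply: le_trans (lee_wpmul2l b0 m4) _; rewrite -EFinM lee_fin; lra.
apply: le_trans (leeD I1 (leeD I2 I3)) _.
have E0 := energy_ge0 dh; set X := energy dh in E0 *.
have -> : (eps%:E * X = (eps / 2)%:E * X + (eps / 2)%:E * X)%E.
  by rewrite -ge0_muleDl ?lee_fin; [rewrite -EFinD -splitr|lra|lra].
rewrite (mulrDl (16 * B1 ^+ 2)) EFinD.
rewrite [X in (X <= _)%E](_ : _ = ((16 * B1 ^+ 2 * s ^+ 2)%:E + (8 * (B0 ^+ 2 * L ^+ 2) * s ^+ 2)%:E +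
   ((eps / 2)%:E * X + (eps / 2)%:E * X))%E)//.
by rewrite addeACA [in RHS]addeACA; congr (_ + _)%E; rewrite addeC.
Qed.

(** By [hardy_bound] the Hardy norm costs [10 * c] times the energy of the image, and the area term
    at most once that energy as [pi^-1 <= 1]: hence [wcomp_energy] is called with
    [eps / (10 * c + 1)]. The radius must also cover the image of the disc of radius 9/10 on which
    [hardy_bound] relies. *)
Lemma wcomp_norm eps : 0 < eps -> exists rho C, [/\ rho < 1, 0 <= C &
  forall h dh s E, holo h dh -> 0 <= s -> 0 <= E -> (energy dh <= E%:E)%E ->
    (forall z, nm z <= rho -> nm (h z) <= s /\ nm (dh z) <= s) ->
    (hardy_norm2 (wcomp h : CC R -> CC R) + (pi^-1)%:E * energy (wcomp_der h dh) <=
       (C * s ^+ 2 + eps * E)%:E)%E].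
Proof.
move=> e0; have c0 := cvC_ge0 R; set c := cvC R in c0.
have q0 : 0 < 10 * c + 1 by rewrite ltr_wpDl// mulr_ge0.
have e1 : 0 < eps / (10 * c + 1) by rewrite divr_gt0.
have [rho [C [rho1 C0 HC]]] := wcomp_energy e1.
have h9 : 9 / 10 < 1 :> R by lra.
have [sigma sigma1 Hs] := self_map_compact phiD phi1 h9.
exists (Num.max rho sigma), (3 * B0 ^+ 2 + (10 * c + 1) * C); split.
- by rewrite gt_max rho1.
- by rewrite addr_ge0// !mulr_ge0 ?sqr_ge0// ltW.
move=> h dh s E hD s0 E0 HE hs.
have hrho z : nm z <= rho -> nm (h z) <= s /\ nm (dh z) <= s.
  by move=> zr; apply: hs; rewrite le_max zr.
have H1 := HC h dh s hD s0 hrho.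
pose E1 := C * s ^+ 2 + eps / (10 * c + 1) * E.
have E10 : 0 <= E1 by rewrite addr_ge0// mulr_ge0 ?sqr_ge0// ltW.
have H2 : (energy (wcomp_der h dh) <= E1%:E)%E.
  apply: le_trans H1 _; rewrite /E1 EFinD (EFinM _ E); apply: leeD => //.
  by apply: lee_wpmul2l; rewrite ?lee_fin// ltW.
have bs : 0 <= B0 * s by rewrite mulr_ge0.
have H3 z : nm z <= 9 / 10 -> nm (wcomp h z) <= B0 * s.
  move=> z9; rewrite nmM; apply: ler_pM; rewrite ?nm_ge0//.
    by apply: psi_le; exact: le_lt_trans z9 h9.
  by apply: (hs _ _).1; rewrite le_max (Hs z z9) orbT.
have H4 := hardy_bound (holo_wcomp hD) bs H3 E10 H2.
have p0 : (0 <= (pi^-1 : R)%:E)%E by rewrite lee_fin invr_ge0 pi_ge0.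
have H5 := lee_wpmul2l p0 H2.
apply: le_trans (leeD H4 H5) _; rewrite -EFinM -EFinD lee_fin -/c.
have p1 : pi^-1 <= 1 :> R by rewrite invf_le1 ?pi_gt0//; have := pi_ge2 R; lra.
have p2 : pi^-1 * E1 <= E1 by rewrite ler_piMl.
have -> : (3 * B0 ^+ 2 + (10 * c + 1) * C) * s ^+ 2 + eps * E =
    3 * (B0 * s) ^+ 2 + (10 * (c * E1) + E1).
  by rewrite /E1; field; rewrite gt_eqF.
by rewrite -addrA lerD2l lerD2l.
Qed.

(** The estimate for compactness also gives that the operator maps into the space: finite energy
    already bounds [h] and [dh] on the compact disc involved. *)
Lemma wcomp_energy_fin h dh E : holo h dh -> 0 <= E -> (energy dh <= E%:E)%E ->
  (energy (wcomp_der h dh) < +oo)%E.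
Proof.
move=> hD E0 HE.
have [rho [C [rho1 C0 HC]]] := wcomp_energy ltr01.
pose s := nm (h 0) + gradbound E rho.
have s0 : 0 <= s by rewrite addr_ge0 ?nm_ge0 ?gradbound_ge0.
apply: le_lt_trans (HC h dh s hD s0 _) _.
  move=> z zr; split; first exact: energy_bound0 hD E0 HE rho1 zr.
  by apply: le_trans (energy_gradbound hD E0 HE rho1 zr) _; rewrite lerDr nm_ge0.
rewrite mul1e; apply: le_lt_trans (leeD (lexx _) HE) _.
by rewrite -EFinD ltry.
Qed.

End weighted.

Section norms.
Variable R : realType.
Notation mu := (@lebesgue_measure R).
Notation mu2 := (mu \x mu)%E.

Lemma sqrte_leP (x : \bar R) (M : R) : (0 <= x)%E -> 0 <= M ->
  (sqrte x <= M%:E)%E = (x <= (M ^+ 2)%:E)%E.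
Proof.
case: x => [r| |]//= r0 M0; rewrite !lee_fin; rewrite lee_fin in r0.
by rewrite -(ler_sqrt _ (sqr_ge0 M)) sqrtr_sqr ger0_norm.
Qed.

(** The radius 0 is allowed in the supremum. This supplies the bound at the origin that [montel]
    needs. *)
Lemma hardy_norm2_at0 (f : CC R -> CC R) : ((nm (f 0) ^+ 2)%:E <= hardy_norm2 f)%E.
Proof.
apply: ereal_sup_ubound; exists 0; first by rewrite /= in_itv /= lexx ltr01.
have p0 := pi_gt0 R.
have -> : (\int[mu]_(t in `[0%R, (2 * pi)%R]) (nm (f ((0 * cos t) +i* (0 * sin t))) ^+ 2)%:E =
   \int[mu]_(t in `[0%R, (2 * pi)%R]) (cst (nm (f 0) ^+ 2)%:E t))%E.
  by apply: eq_integral => t _; rewrite !mul0r.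
rewrite integral_cst//= lebesgue_measure_itv /= lte_fin mulr_gt0//.
by rewrite oppr0 adde0 -!EFinM mulrC mulfK// gt_eqF// mulr_gt0.
Qed.

Lemma dirichlet_integral_ge0 (f : CC R -> CC R) : (0 <= dirichlet_integral f)%E.
Proof. by apply: integral_ge0 => p _; rewrite lee_fin sqr_ge0. Qed.

Lemma dirichlet_norm2_ge0 (f : CC R -> CC R) :
  (0 <= hardy_norm2 f + (pi^-1)%:E * dirichlet_integral f)%E.
Proof.
apply: adde_ge0; first by apply: le_trans (hardy_norm2_at0 f); rewrite lee_fin sqr_ge0.
by rewrite mule_ge0 ?dirichlet_integral_ge0// lee_fin invr_ge0 pi_ge0.
Qed.

Lemma dirichlet_norm_le (f : CC R -> CC R) (M : R) : 0 <= M -> (dirichlet_norm f <= M%:E)%E ->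
  nm (f 0) <= M /\ (dirichlet_integral f <= (pi * M ^+ 2)%:E)%E.
Proof.
move=> M0; rewrite sqrte_leP ?dirichlet_norm2_ge0// => h.
have h0 := hardy_norm2_at0 f; have D0 := dirichlet_integral_ge0 f.
have p0 := pi_gt0 R.
have q0 : (0 <= (pi^-1)%:E * dirichlet_integral f)%E.
  by rewrite mule_ge0// lee_fin invr_ge0 ltW.
split.
  rewrite -(@ler_pXn2r _ 2)// ?nnegrE ?nm_ge0// -lee_fin.
  by apply: le_trans h0 (le_trans _ h); rewrite leeDl.
have h1 : ((pi^-1)%:E * dirichlet_integral f <= (M ^+ 2)%:E)%E.
  apply: le_trans h; rewrite leeDr//; apply: le_trans h0; by rewrite lee_fin sqr_ge0.
have p1 : (0 <= (pi : R)%:E)%E by rewrite lee_fin ltW.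
by have := lee_wpmul2l p1 h1; rewrite muleA -!EFinM divff ?gt_eqF// mul1e.
Qed.

Lemma energyB (f df g dg : R[i] -> R[i]) (E F : R) : holo f df -> holo g dg ->
  (energy df <= E%:E)%E -> (energy dg <= F%:E)%E ->
  (energy (fun z => (df z - dg z)%R) <= (2 * E + 2 * F)%:E)%E.
Proof.
move=> fD gD HE HF; have mE : measurable (@D2 R) by exact: D2_measurable.
have cont_sq (k dk : R[i] -> R[i]) : holo k dk ->
    measurable_fun (@D2 R) (fun p => (nm (k (Z p)) ^+ 2)%:E).
  move=> kD; apply: measurable_nm2; first exact: open2_D2.
  by move=> p Dp; exact: hasder_contat (kD _ Dp).
have [ddf dfD] := holo_der_fun fD; have [ddg dgD] := holo_der_fun gD.
have mf := cont_sq _ _ dfD; have mg := cont_sq _ _ dgD.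
pose F1 p := (2%:E * (nm (df (Z p)) ^+ 2)%:E)%E.
pose F2 p := (2%:E * (nm (dg (Z p)) ^+ 2)%:E)%E.
have mF1 : measurable_fun (@D2 R) F1 by apply: measurable_funeM.
have mF2 : measurable_fun (@D2 R) F2 by apply: measurable_funeM.
have F10 p : (0 <= F1 p)%E by rewrite /F1 -EFinM lee_fin mulr_ge0// sqr_ge0.
have F20 p : (0 <= F2 p)%E by rewrite /F2 -EFinM lee_fin mulr_ge0// sqr_ge0.
apply: (@le_trans _ _ (\int[mu2]_(p in @D2 R) (F1 p + F2 p))%E).
  apply: ge0_le_integral; first exact: mE.
  - by move=> p _; rewrite lee_fin sqr_ge0.
  - by apply: (cont_sq (fun z => df z - dg z) (fun z => ddf z - ddg z)) => z z1; apply: hasderB; [exact: dfD|exact: dgD].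
  - exact: emeasurable_funD.
  - move=> p _; rewrite /F1 /F2 -!EFinM -EFinD lee_fin.
    have h := nmB (df (Z p)) (dg (Z p)); have h0 := nm_ge0 (df (Z p) - dg (Z p)).
    have := sqr_ge0 (nm (df (Z p)) - nm (dg (Z p))); nra.
rewrite ge0_integralD; last 5 first.
- exact: mE.
- by move=> p _; exact: F10.
- exact: mF1.
- by move=> p _; exact: F20.
- exact: mF2.
have two (dk : R[i] -> R[i]) K : measurable_fun (@D2 R) (fun p => (nm (dk (Z p)) ^+ 2)%:E) ->
    (energy dk <= K%:E)%E ->
    (\int[mu2]_(p in @D2 R) (2%:E * (nm (dk (Z p)) ^+ 2)%:E) <= (2 * K)%:E)%E.
  move=> mk HK; rewrite ge0_integralZl_EFin; last 4 first.
  - exact: mE.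
  - by move=> p _; rewrite lee_fin sqr_ge0.
  - exact: mk.
  - by [].
  by rewrite (EFinM 2); apply: lee_wpmul2l; rewrite ?lee_fin.
by rewrite EFinD; apply: leeD; exact: two.
Qed.

End norms.

Theorem theorem2p10 (R : realType) (phi psi : CC R -> CC R)
  (phi_disc : set_fun (@disc R) (@disc R) phi)
  (phi_holo : holomorphic_disc phi)
  (psi_holo : holomorphic_disc psi)
  (phi1_bnd : [bounded phi^`() z | z in @disc R])
  (phi2_bnd : [bounded phi^`(2) z | z in @disc R])
  (psi_bnd : [bounded psi z | z in @disc R])
  (psi1_bnd : [bounded psi^`() z | z in @disc R])
  (phi_univalent : set_inj (@disc R) phi)
  (lim_psi : (`|psi z| * (1 - `|z| ^+ 2) / (1 - `|phi z| ^+ 2) : CC R)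
     @[z --> @disc_boundary R] --> (0 : CC R))
  (lim_psi2 : (`|psi^`(2)%classic z| * (1 - `|z| ^+ 2) : CC R)
     @[z --> @disc_boundary R] --> (0 : CC R)) :
  dirichlet_compact (weighted_comp psi phi).
Proof.
have phi1 z : nm z < 1 -> nm (phi z) < 1 by move=> /discE/phi_disc/discE.
have /holomorphic_holo phiD := phi_holo; have /holomorphic_holo psiD := psi_holo.
have [ddphi dphiD] := holo_der_fun phiD.
have [L L0 dphi_le] := bounded_nm phi1_bnd.
have [B0 B00 psi_le] := bounded_nm psi_bnd.
have [B1 B10 dpsi_le] := bounded_nm psi1_bnd.
have [L2 L20 phi2_le] := bounded_nm phi2_bnd.
have ddphi_le z : nm z < 1 -> nm (ddphi z) <= L2.
  by move=> z1; rewrite -(holo_derive dphiD z1); exact: phi2_le.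
have phi_inj z w : nm z < 1 -> nm w < 1 -> phi z = phi w -> z = w.
  by move=> z1 w1; apply: phi_univalent; rewrite inE; apply/discE.
have psi_decay := weight_decay phiD psiD phi1 L0 B10 dphi_le dpsi_le
  (boundary_limit phi1 lim_psi).
pose dphi : R[i] -> R[i] := phi^`()%classic; pose dpsi : R[i] -> R[i] := psi^`()%classic.
have wD h dh : holo h dh -> holo (wcomp phi psi h) (wcomp_der phi dphi psi dpsi h dh).
  by move=> hD; exact: (holo_wcomp phiD psiD phi1 hD).
have wfin h dh E : holo h dh -> 0 <= E -> (energy dh <= E%:E)%E ->
    dirichlet_space (weighted_comp psi phi h).
  move=> hD E0 HE; split; first exact: holo_holomorphic (wD _ _ hD).
  rewrite (dirichlet_integralE (fun z z1 => holo_derive (wD _ _ hD) z1)).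
  exact: (wcomp_energy_fin phiD dphiD psiD phi1 phi_inj L0 L20 B00 B10
    dphi_le ddphi_le psi_le dpsi_le psi_decay hD E0 HE).
split.
- move=> f [/holomorphic_holo fD]; rewrite (dirichlet_integralE (fun z _ => erefl)) => fin.
  have e0 : (0 <= energy (f^`()%classic))%E by apply: integral_ge0 => p _; rewrite lee_fin sqr_ge0.
  have fE : energy (f^`()%classic) = (fine (energy (f^`()%classic)))%:E.
    by rewrite fineK// ge0_fin_numE.
  apply: (wfin f _ (fine (energy (f^`()%classic))) fD); first exact: fine_ge0.
  by rewrite -fE.
- move=> a f g _ _ z _; rewrite /weighted_comp.
  have -> : (a *: f + g) (phi z) = a * f (phi z) + g (phi z) by [].
  by ring.
move=> f_ fS [M fM].
have M0 : 0 <= M by rewrite -lee_fin; apply: le_trans (fM 0%N); exact: sqrte_ge0.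
pose df n : R[i] -> R[i] := (f_ n)^`()%classic.
have fD n : holo (f_ n) (df n) by apply/holomorphic_holo; have [] := fS n.
have p0 := pi_gt0 R; pose E := pi * M ^+ 2.
have E0 : 0 <= E by rewrite mulr_ge0 ?sqr_ge0// ltW.
have f0 n : nm (f_ n 0) <= M by have [] := dirichlet_norm_le M0 (fM n).
have fE n : (energy (df n) <= E%:E)%E.
  have [_] := dirichlet_norm_le M0 (fM n).
  by rewrite (dirichlet_integralE (fun z _ => erefl)).
have [e e_mono [g [dg [gD gE conv]]]] := montel fD E0 fE f0.
exists e => //; exists (weighted_comp psi phi g); first exact: wfin gD E0 gE.
pose h n z := f_ (e n) z - g z; pose dh n z := df (e n) z - dg z.
have hD n : holo (h n) (dh n) by move=> z z1; apply: hasderB; [exact: fD|exact: gD].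
have hE n : (energy (dh n) <= (2 * E + 2 * E)%:E)%E by exact: energyB (fD _) gD (fE _) gE.
have E40 : 0 <= 2 * E + 2 * E by lra.
have TE n : weighted_comp psi phi (f_ (e n)) - weighted_comp psi phi g = wcomp phi psi (h n).
  apply/funext => z.
  have -> : (weighted_comp psi phi (f_ (e n)) - weighted_comp psi phi g) z =
    psi z * f_ (e n) (phi z) - psi z * g (phi z) by [].
  by rewrite /wcomp /h mulrBr.
have small (eps : R) : 0 < eps -> exists N, forall n, (N <= n)%N ->
    (dirichlet_norm (weighted_comp psi phi (f_ (e n)) - weighted_comp psi phi g)%R <= eps%:E)%E.
  (* The energy of a difference is at most [2 * E + 2 * E], so this factor makes its share at most
     half of [eps ^+ 2]; the added 1 covers [E = 0]. *)
  move=> eps0; have eps20 : 0 < eps ^+ 2 / 2 / (2 * E + 2 * E + 1).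
    by rewrite !divr_gt0 ?exprn_gt0//; lra.
  have [rho [C [rho1 C0 HC]]] := wcomp_norm phiD dphiD psiD phi1 phi_inj L0 L20 B00 B10
    dphi_le ddphi_le psi_le dpsi_le psi_decay eps20.
  (* With this accuracy on the compact disc, [C * s ^+ 2] is at most [eps ^+ 2 / 2], because
     [C <= 2 * (C + 1) ^+ 2]. *)
  pose s := eps / (2 * (C + 1)).
  have s0 : 0 < s by rewrite divr_gt0//; lra.
  have [N HN] := conv rho s rho1 s0.
  exists N => n nN; rewrite TE sqrte_leP ?(ltW eps0) ?dirichlet_norm2_ge0//.
  rewrite (dirichlet_integralE (fun z z1 => holo_derive (wD _ _ (hD n)) z1)).
  have h1 := HC _ _ s _ (hD n) (ltW s0) E40 (hE n) (HN n nN).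
  apply: le_trans h1 _.
  rewrite lee_fin.
  have sE : s * (2 * (C + 1)) = eps by rewrite /s divfK// gt_eqF//; lra.
  have c1 : C * s ^+ 2 <= eps ^+ 2 / 2.
    have s20 : 0 <= s ^+ 2 by exact: sqr_ge0.
    have h2 : C <= 2 * (C + 1) ^+ 2 by nra.
    have -> : eps ^+ 2 / 2 = 2 * (C + 1) ^+ 2 * s ^+ 2 by rewrite -[in LHS]sE; field.
    exact: ler_wpM2r s20 _ _ h2.
  have c2 : eps ^+ 2 / 2 / (2 * E + 2 * E + 1) * (2 * E + 2 * E) <= eps ^+ 2 / 2.
    rewrite mulrAC ler_pdivrMr; last by lra.
    by rewrite ler_pM2l; [lra|rewrite divr_gt0// exprn_gt0].
  lra.
have N0 n : (0 <= dirichlet_norm (weighted_comp psi phi (f_ (e n)) - weighted_comp psi phi g)%R)%E.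
  exact: sqrte_ge0.
apply/fine_cvgP; split.
  have [N HN] := small 1 ltr01; exists N => // n /HN h1; rewrite /mkset ge0_fin_numE//.
  exact: le_lt_trans h1 (ltry _).
apply/cvgrPdist_le => eps eps0; have [N HN] := small eps eps0; exists N => // n /HN h1.
rewrite /mkset /= sub0r normrN ger0_norm ?fine_ge0// -lee_fin fineK// ge0_fin_numE//.
exact: le_lt_trans h1 (ltry _).
Qed.
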